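(* In the random-effects model described in the context ($p\ge2$), let $$\delta=\bar x-\sum_{j=1}^{p-1}\sqrt{b_j}\,w_j\,y_j,\qquad 0\le w_j\le t_j^{-2}.$$ If the coefficients $w_j=w_j(y_1^2,\dots,y_{p-1}^2,u_1^2,\dots,u_p^2)$ defining this estimator are piecewise differentiable in $y_1,\dots,y_{p-1}$, then $$\operatorname{Var}(\delta)=\operatorname{Var}(\hat\mu_{\mathrm{opt}})+\sum_{j=1}^{p-1}b_j\,E\,y_j^2\left(w_j-\frac{1}{\tau^2+t_j^2}\right)^2=\operatorname{Var}(\bar x)+E\sum_{j=1}^{p-1}b_j\left(f_j^2-2\frac{\partial}{\partial y_j}f_j\right),$$ where $f_j=y_jw_j$. When $p>3$, $\bar x$ is an inadmissible estimator of $\mu$ under the quadratic loss.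
   Context: Model. Let $s_1^2,\dots,s_p^2$ be pairwise distinct known positive numbers ($p\ge2$), let $\nu_1,\dots,\nu_p\ge1$ be integers (multiplicities), and put $n=\sum_i\nu_i$. The unknown parameters are $\mu\in\mathbb{R}$ and $\tau^2\ge0$. The data are independent random variables $x_1,\dots,x_p,u_1^2,\dots,u_p^2$ with $x_i\sim N\big(\mu,(\tau^2+s_i^2)/\nu_i\big)$; if $\nu_i\ge2$, $(\nu_i-1)u_i^2\sim(\tau^2+s_i^2)\chi^2_{\nu_i-1}$, and $u_i^2=0$ if $\nu_i=1$. Notation. $\bar x=\frac1n\sum_i\nu_ix_i$ (the sample mean) and $\hat\mu_{\mathrm{opt}}=\sum_i\frac{\nu_i x_i}{\tau^2+s_i^2}\Big/\sum_i\frac{\nu_i}{\tau^2+s_i^2}$, so $\operatorname{Var}(\hat\mu_{\mathrm{opt}})=\big[\sum_i\nu_i/(\tau^2+s_i^2)\big]^{-1}$. Polynomials: $M(v)=\prod_{i=1}^p(v+s_i^2)$ and $Q(v)=\sum_{i=1}^p\nu_i\prod_{k\ne i}(v+s_k^2)$. The polynomial $Q$ has degree $p-1$ and only real negative roots, denoted $-t_1^2,\dots,-t_{p-1}^2$; moreover $M(-t_j^2)\ne0$. Put $$A_{ij}=\frac{\nu_iM(-t_j^2)}{Q'(-t_j^2)(t_j^2-s_i^2)},\qquad b_j=-\frac{M(-t_j^2)}{Q'(-t_j^2)}>0,\qquad y_j=\frac{1}{\sqrt{b_j}}\sum_{i=1}^pA_{ij}x_i,$$ for $i=1,\dots,p$,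 $j=1,\dots,p-1$. The $y_j$ are independent, $y_j\sim N(0,\tau^2+t_j^2)$. Inadmissibility of $\bar x$ under the quadratic loss means that some estimator $\delta^*$ satisfies $E(\delta^*-\mu)^2\le E(\bar x-\mu)^2$ for all $(\mu,\tau^2)$, with strict inequality for at least one $(\mu,\tau^2)$.
   Formalization: The second equality is stated assuming each derivative ∂f_j/∂y_j has finite expectation (otherwise its right side can be undefined), and ''piecewise differentiable'' includes continuity in each y_k at the break points (with jumps that formula fails). *)

(* Defs.v *)
From HB Require Import structures.
From mathcomp Require Import all_boot all_order all_algebra.
From mathcomp Require Import all_classical all_reals all_analysis.

Set Implicit Arguments.
Unset Strict Implicit.
Unset Printing Implicit Defensive.

Import Order.TTheory GRing.Theory Num.Theory.
Import numFieldNormedType.Exports.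

Local Open Scope classical_set_scope.
Local Open Scope ring_scope.

Section probability_notions.
Context {d : measure_display} {T : measurableType d} {R : realType}.
Implicit Types P : probability T R.

Definition has_law P (X : T -> R) (Q : set R -> \bar R) : Prop :=
  forall A : set R, measurable A -> P (X @^-1` A) = Q A.

Definition mutually_independent P (I : finType) (X : I -> T -> R) : Prop :=
  forall (J : {set I}) (B : I -> set R), (forall i, measurable (B i)) ->
    P (\bigcap_(i in [set` J]) (X i @^-1` B i)) =
    (\prod_(i in J) P (X i @^-1` B i))%E.

End probability_notions.

(* The law of Z_1^2 + ... + Z_k^2 for independent standard normal Z_i, obtained
   by conditioning on the last summand. *)
Fixpoint chi_square {R : realType} (k : nat) : set R -> \bar R :=
  if k is k'.+1 then fun A =>
    (\int[normal_prob (0 : R) (1 : R)]_z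
       chi_square k' [set c | A (c + z ^+ 2)%R])%E
  else dirac (0 : R).

Section random_effects.
Context {R : realType} {p : nat} (nu : 'I_p -> nat) (s2 : 'I_p -> R).

(* [tau2], [s2 i] and [u2 i] stand for the squared quantities tau^2, s_i^2 and
   u_i^2. *)
Definition data_family (T : Type) (x u2 : 'I_p -> T -> R)
    (k : 'I_p + 'I_p) : T -> R :=
  match k with inl i => x i | inr i => u2 i end.

(* The second argument of [normal_prob] is the standard deviation. *)
Record random_effects_model (d : measure_display) (T : measurableType d)
    (P : probability T R) (mu tau2 : R) (x u2 : 'I_p -> T -> R) : Prop := {
  rem_measurable_x : forall i, measurable_fun [set: T] (x i);
  rem_measurable_u2 : forall i, measurable_fun [set: T] (u2 i);
  rem_u2_ge0 : forall i omega, 0 <= u2 i omega;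
  rem_independent : mutually_independent P (data_family x u2);
  rem_law_x : forall i,
    has_law P (x i) (normal_prob mu (Num.sqrt ((tau2 + s2 i) / (nu i)%:R)));
  rem_law_u2 : forall i, (2 <= nu i)%N ->
    has_law P (fun omega => (nu i).-1%:R * u2 i omega)
      (fun A => chi_square (nu i).-1 [set c | A ((tau2 + s2 i) * c)]);
  rem_u2_eq0 : forall i, nu i = 1%N -> forall omega, u2 i omega = 0
}.

Definition sample_mean (x : 'I_p -> R) : R :=
  (\sum_i (nu i)%:R * x i) / (\sum_i nu i)%:R.

Definition mu_opt (tau2 : R) (x : 'I_p -> R) : R :=
  (\sum_i (nu i)%:R * x i / (tau2 + s2 i)) /
  (\sum_i (nu i)%:R / (tau2 + s2 i)).

Definition polyM : {poly R} := \prod_i ('X + (s2 i)%:P).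

Definition polyQ : {poly R} :=
  \sum_i (nu i)%:R *: \prod_(k | k != i) ('X + (s2 k)%:P).

(* [- t2 0, ..., - t2 (p - 2)] lists the roots of [polyQ], with multiplicity. *)
Definition negated_roots_of_Q (t2 : 'I_p.-1 -> R) : Prop :=
  polyQ = lead_coef polyQ *: \prod_j ('X + (t2 j)%:P).

Section contrasts.
Variable t2 : 'I_p.-1 -> R.

Definition coefA (i : 'I_p) (j : 'I_p.-1) : R :=
  (nu i)%:R * polyM.[- t2 j] / ((polyQ^`()).[- t2 j] * (t2 j - s2 i)).

Definition coefb (j : 'I_p.-1) : R := - (polyM.[- t2 j] / (polyQ^`()).[- t2 j]).

Definition contrast (x : 'I_p -> R) : p.-1.-tuple R :=
  [tuple (Num.sqrt (coefb j))^-1 * \sum_i coefA i j * x i | j < p.-1].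

End contrasts.
End random_effects.

Section coordinates.
Context {R : realType} {m : nat}.

Definition squares (y : m.-tuple R) : m.-tuple R :=
  [tuple tnth y j ^+ 2 | j < m].

Definition set_coord (y : m.-tuple R) (k : 'I_m) (t : R) : m.-tuple R :=
  [tuple if j == k then t else tnth y j | j < m].

Definition partial_derivative (k : 'I_m) (F : m.-tuple R -> R)
    (y : m.-tuple R) : R :=
  derive1 (fun t => F (set_coord y k t)) (tnth y k).

Definition nonneg (y : m.-tuple R) : Prop := forall j, 0 <= tnth y j.

End coordinates.

(* The pieces have to fit together continuously: with a jump, the integration
   by parts behind the variance formula fails. *)
Definition piecewise_differentiable {R : realType} (g : R -> R) : Prop :=
  continuous g /\
  exists B : set R, (forall a b : R, finite_set (B `&` `[a, b])) /\
                    (forall t, ~ B t -> derivable g t 1).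

Definition piecewise_differentiable_in_each {R : realType} {m : nat}
    (F : m.-tuple R -> R) : Prop :=
  forall (y : m.-tuple R) (k : 'I_m),
    piecewise_differentiable (fun t => F (set_coord y k t)).

Section shrinkage.
Context {R : realType} {p : nat} (nu : 'I_p -> nat) (s2 : 'I_p -> R).
Variable t2 : 'I_p.-1 -> R.
(* [w j (a, u)] is the coefficient w_j at y_k^2 = a_k and u_i^2 = u_i. *)
Variable w : 'I_p.-1 -> p.-1.-tuple R * p.-tuple R -> R.

Record shrinkage_weights : Prop := {
  sw_measurable : forall j, measurable_fun [set: p.-1.-tuple R * p.-tuple R] (w j);
  sw_bounds : forall j a u, nonneg a -> nonneg u -> 0 <= w j (a, u) <= (t2 j)^-1;
  sw_piecewise_differentiable : forall j u, nonneg u ->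
    piecewise_differentiable_in_each (fun y => w j (squares y, u))
}.

Definition weighted_contrast (j : 'I_p.-1) (y : p.-1.-tuple R)
    (u : p.-tuple R) : R :=
  tnth y j * w j (squares y, u).

Definition shrinkage_estimator (z : p.-tuple R * p.-tuple R) : R :=
  let y := contrast nu s2 t2 (tnth z.1) in
  sample_mean nu (tnth z.1) -
  \sum_j Num.sqrt (coefb nu s2 t2 j) * w j (squares y, z.2) * tnth y j.

End shrinkage.

Section decision.
Context {R : realType} {p : nat}.

Definition data (T : Type) (x u2 : 'I_p -> T -> R) (omega : T) :
    p.-tuple R * p.-tuple R :=
  ([tuple x i omega | i < p], [tuple u2 i omega | i < p]).

Definition quadratic_risk (d : measure_display) (T : measurableType d)
    (P : probability T R) (mu : R) (x u2 : 'I_p -> T -> R)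
    (delta : p.-tuple R * p.-tuple R -> R) : \bar R :=
  'E_P[fun omega => ((delta (data x u2 omega) - mu) ^+ 2)%R]%E.

(* [P mu tau2] is the distribution on the sample space under the parameter
   (mu, tau2); only tau2 >= 0 belongs to the parameter space. *)
Definition inadmissible (d : measure_display) (T : measurableType d)
    (P : R -> R -> probability T R) (x u2 : 'I_p -> T -> R)
    (delta : p.-tuple R * p.-tuple R -> R) : Prop :=
  exists deltastar : p.-tuple R * p.-tuple R -> R,
    [/\ measurable_fun [set: p.-tuple R * p.-tuple R] deltastar,
        forall mu tau2, 0 <= tau2 ->
          (quadratic_risk (P mu tau2) mu x u2 deltastar <=
           quadratic_risk (P mu tau2) mu x u2 delta)%E
      & exists mu tau2, 0 <= tau2 /\
          (quadratic_risk (P mu tau2) mu x u2 deltastar <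
           quadratic_risk (P mu tau2) mu x u2 delta)%E].

End decision.

(* Main.v *)
(* Standardised, the vector (mu_opt, y_1, ..., y_{p-1}) is an orthogonal transform
   of the data; hence its components are independent centred normal variables,
   independent of the u_i^2, and xbar = mu_opt + sum_j sqrt(b_j) y_j / (tau^2 + t_j^2).
   So delta - mu is a sum of terms (normal component) * (even function of all
   components); sign changes of single components show that the terms have mean 0
   and are uncorrelated, which gives the first formula.  Stein's identity
   E y_j f_j = (tau^2 + t_j^2) E (d f_j / d y_j) turns it into the second one.
   For the weights w_j = 1 / (b_j (A + S)), where S = sum_k y_k^2 / b_k and
   A = sum_k t_k^2 / b_k, the integrand of the second formula is
   (5 S - 2 (p - 1) (A + S)) / (A + S)^2, which is negative when p > 3. *)
Require Import Defs.
From HB Require Import structures.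
From mathcomp Require Import all_boot all_order all_algebra.
From mathcomp Require Import all_classical all_reals all_analysis.
From mathcomp Require Import measurable_realfun.
From mathcomp Require Import ring lra.
From mathcomp Require polyrcf.

Set Implicit Arguments.
Unset Strict Implicit.
Unset Printing Implicit Defensive.

Import Order.TTheory GRing.Theory Num.Theory.
Import numFieldNormedType.Exports.

Local Open Scope classical_set_scope.
Local Open Scope ring_scope.

(** The orthogonal transform is not handled by a matrix change of variables: plane reflections and
    sign changes reduce an orthogonal matrix to the identity, and a reflection of two coordinates
    needs only one-dimensional affine substitutions and Tonelli. The [u2] are carried along, so that
    independence from them survives. In place of conditioning, one coordinate of the data is
    replaced by an independent copy, which leaves the joint law unchanged; Fubini then isolates that
    coordinate. The delicate point is Stein's identity. In each coordinate the weights are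
    continuous and differentiable off a locally finite set, but the derivative need not be
    continuous. Its integral is computed by comparison with measures lying above it, and its
    measurability, as a limit of difference quotients, needs an argument of its own. The bounds on
    the weights give f_j linear growth, so boundary terms vanish and products of components are
    integrable; they do not control the derivative, whose integrability is assumed for the second
    formula and verified for the weights that improve on the sample mean. *)

Ltac meas := repeat first
  [ by [] | assumption | exact: measurable_cst | exact: measurable_id
  | exact: measurable_fst | exact: measurable_snd | exact: measurable_tnth
  | apply: measurable_funD | apply: measurable_funB | apply: measurable_funN
  | apply: measurable_funM | apply: measurable_funX
  | apply: measurable_fun_pair | apply/measurable_EFinP ].

(** * Normal distributions *)

Lemma measurable_preimage d d' (T : measurableType d) (T' : measurableType d')
    (f : T -> T') (A : set T') :
  measurable_fun [set: T] f -> measurable A -> measurable (f @^-1` A).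
Proof. by move=> mf mA; rewrite -[X in measurable X]setTI; exact: mf. Qed.

Section affine_change_of_variables.
Context {R : realType}.
Local Notation mu := (@lebesgue_measure R).
Implicit Types a b : R.

Let affine a b (x : measurableTypeR R) : measurableTypeR R := a * x + b.

Let measurable_affine a b : measurable_fun setT (affine a b).
Proof. by apply: measurable_funD => //; exact: measurable_funM. Qed.

Let preimage_affine_itv a b u v : 0 < a ->
  affine a b @^-1` `]u, v] = `](u - b) / a, (v - b) / a]%classic.
Proof.
move=> a0; apply/seteqP; split => x /=; rewrite !in_itv/= /affine.
  by rewrite ltr_pdivrMr// ler_pdivlMr// ltrBlDr lerBrDr mulrC.
by rewrite ltr_pdivrMr// ler_pdivlMr// ltrBlDr lerBrDr mulrC.
Qed.

(** After multiplication by [a] the pushforward gives half-open intervals their length, so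
    uniqueness of Lebesgue measure applies. *)
Let lebesgue_measure_affine_gt0 a b (A : set R) : 0 < a -> measurable A ->
  pushforward mu (affine a b) A = (a^-1%:E * mu A)%E.
Proof.
move=> a0 mA.
have ma := measurable_affine a b.
have -> : (pushforward mu (affine a b) A =
           a^-1%:E * (a%:E * pushforward mu (affine a b) A))%E.
  by rewrite muleA -EFinM mulVf ?gt_eqF// mul1e.
congr (_ * _)%E; apply/esym.
pose m := mscale (NngNum (ltW a0)) (pushforward mu (affine a b)).
rewrite (_ : (a%:E * _)%E = m ma A)//.
apply: (@lebesgue_measure_unique _ (m ma)) => // X [[u v]] _ <-.
rewrite -[RHS]/(a%:E * mu (affine a b @^-1` `]u, v]))%E.
rewrite preimage_affine_itv// !lebesgue_measure_itv/=.
rewrite !lte_fin ltr_pM2r ?invr_gt0// ltrD2r.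
case: ifPn => _; last by rewrite mule0.
rewrite -!EFinB -EFinM; congr (_%:E); field.
by rewrite gt_eqF.
Qed.

Lemma lebesgue_measure_affine a b (A : set R) : a != 0 -> measurable A ->
  pushforward mu (affine a b) A = (`|a|^-1%:E * mu A)%E.
Proof.
move=> a0 mA; have [a_lt0|a_gt0|] := ltgtP a 0; last by move/eqP; rewrite (negbTE a0).
  rewrite -lebesgue_measureN// -[X in _ = (_ * X)%E]/(mu (-%R @^-1` A)).
  rewrite -(@lebesgue_measure_affine_gt0 _ (- b)) ?normr_gt0//; last first.
    by rewrite -[X in measurable X]setTI; exact: (oppr_measurable measurableT).
  rewrite /pushforward; congr (mu _); apply/seteqP; split => x /=;
    by rewrite /affine ltr0_norm// mulNr opprD !opprK.
by rewrite lebesgue_measure_affine_gt0// gtr0_norm.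
Qed.

Lemma ge0_integral_affine a b (f : R -> \bar R) : a != 0 ->
  measurable_fun [set: R] f -> (forall x, 0 <= f x)%E ->
  (\int[mu]_x f (a * x + b)%R = `|a|^-1%:E * \int[mu]_x f x)%E.
Proof.
move=> a0 mf f0.
have ma := measurable_affine a b.
rewrite -[LHS](@ge0_integral_pushforward _ _ _ _ R (affine a b) ma mu setT f)//.
pose k : {nonneg R} := NngNum (normr_ge0 a^-1).
transitivity (\int[mscale k mu]_x f x)%E.
  apply: eq_measure_integral => A mA _.
  rewrite -[RHS]/(`|a^-1|%:E * mu A)%E normfV.
  exact: lebesgue_measure_affine.
by rewrite ge0_integral_mscale//= normfV.
Qed.

End affine_change_of_variables.

Section integral_normal_prob.
Context {R : realType}.
Local Notation mu := (@lebesgue_measure R).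
Variables (m s : R).
Local Open Scope ereal_scope.

Lemma integral_normal_prob (f : R -> \bar R) : measurable_fun [set: R] f ->
  \int[normal_prob m s]_x `|f x| < +oo ->
  \int[normal_prob m s]_x f x = \int[mu]_x (f x * (normal_pdf m s x)%:E).
Proof.
move=> mf finf.
rewrite -(Radon_Nikodym_change_of_variables (normal_prob_dominates m s))//=; last first.
  by apply/integrableP; split.
have mpdf : measurable_fun [set: R] (EFin \o normal_pdf m s).
  by apply/measurable_EFinP; exact: measurable_normal_pdf.
apply: ae_eq_integral => //.
- apply: emeasurable_funM => //; apply: (measurable_int mu).
  by apply: Radon_Nikodym_integrable; exact: normal_prob_dominates.
- exact: emeasurable_funM.
(* The Radon-Nikodym derivative is determined only up to a null set; it agrees almost everywhere
   with [normal_pdf] because both have the same integrals over measurable sets. *)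
- apply: ae_eqe_mul2l => /=.
  rewrite Radon_NikodymE//=; first exact: normal_prob_dominates.
  move=> abmu; case: cid => /= h [h1 h2 h3].
  by apply: integral_ae_eq => //= E _ mE; rewrite -h3.
Qed.

Import HBNNSimple.

(** Simple functions are bounded, hence integrable for a probability, so the integrable case applies
    to them; monotone convergence does the rest. *)
Lemma ge0_integral_normal_prob (f : R -> \bar R) : measurable_fun [set: R] f -> (forall x, 0 <= f x) ->
  \int[normal_prob m s]_x f x = \int[mu]_x (f x * (normal_pdf m s x)%:E).
Proof.
move=> mf f0; pose f_ := nnsfun_approx measurableT mf.
have pdf0 x : 0 <= (normal_pdf m s x)%:E by rewrite lee_fin normal_pdf_ge0.
have mpdf : measurable_fun [set: R] (EFin \o normal_pdf m s).
  by apply/measurable_EFinP; exact: measurable_normal_pdf.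
have mf_ n : measurable_fun [set: R] (EFin \o f_ n).
  by apply/measurable_EFinP; exact: measurable_funPT.
have nd_f_ x : {homo (fun n => (f_ n x)%:E) : a b / (a <= b)%N >-> a <= b}.
  by move=> a b ab; rewrite lee_fin; exact/lefP/nd_nnsfun_approx.
have cvgf_ x : (f_ n x)%:E @[n --> \oo] --> f x by exact: cvg_nnsfun_approx.
transitivity (limn (fun n => \int[normal_prob m s]_x (f_ n x)%:E)).
  rewrite -monotone_convergence//=.
  - by apply: eq_integral => x _; exact/esym/cvg_lim.
  - by move=> n x _; rewrite lee_fin.
transitivity (limn (fun n => \int[mu]_x ((f_ n x)%:E * (normal_pdf m s x)%:E))).
  apply/congr_lim/funext => n.
  apply: (@integral_normal_prob (EFin \o f_ n) (mf_ n)).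
  have [M [_ /(_ (M + 1)%R)]] := simple_bounded (f_ n).
  rewrite ltrDl ltr01 => /(_ isT) fM.
  apply: (@le_lt_trans _ _ (\int[normal_prob m s]_x (M + 1)%:E)).
    apply: ge0_le_integral => //.
    - exact: (measurableT_comp (@abse_measurable R setT) (mf_ n)).
  rewrite integral_cst// [X in (_ * X)%E](_ : _ = 1) ?mule1 ?ltry//.
  exact: (@probability_setT _ _ _ (normal_prob m s)).
rewrite -monotone_convergence//=.
- apply: eq_integral => x _; apply/cvg_lim => //.
  exact: cvgeZr.
- by move=> n; apply: (@emeasurable_funM _ _ _ _ (EFin \o f_ n)).
- by move=> n x _; rewrite mule_ge0// lee_fin.
- by move=> x _ a b ab; rewrite lee_wpmul2r//; exact: nd_f_.
Qed.

End integral_normal_prob.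

Section reflection.
Context {R : realType}.
Local Notation mu := (@lebesgue_measure R).

(* The two coordinates are substituted one after the other, each by a
   one-dimensional affine map; this is where [s != 0] is needed. *)
Lemma ge0_integral_reflection (c s : R) (h : R * R -> \bar R) :
  s != 0 -> c ^+ 2 + s ^+ 2 = 1 ->
  measurable_fun [set: R * R] h -> (forall z, 0 <= h z)%E ->
  (\int[mu]_y \int[mu]_x h (x, y) =
   \int[mu]_v \int[mu]_w h (c * w + s * v, s * w - c * v)%R)%E.
Proof.
move=> s0 cs1 mh h0.
have mE (f g : R * R -> R) : measurable_fun setT f -> measurable_fun setT g ->
    measurable_fun [set: R * R] (fun z => h (f z, g z)).
  by move=> mf mg; apply: (measurableT_comp mh); exact/measurable_fun_pair.
have mE1 (f g : R -> R) : measurable_fun setT f -> measurable_fun setT g ->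
    measurable_fun [set: R] (fun z => h (f z, g z)).
  by move=> mf mg; apply: (measurableT_comp mh); exact/measurable_fun_pair.
transitivity (\int[mu]_y \int[mu]_v (`|s|^-1%:E * h (s^-1 * v + c * y / s, y)%R))%E.
  apply: eq_integral => y _.
  rewrite ge0_integralZl//; last by apply: mE1; meas.
  rewrite (@ge0_integral_affine R s^-1 (c * y / s) (fun x => h (x, y))) ?invr_eq0//; last first.
    by apply: mE1; meas.
  rewrite muleA -EFinM normfV invrK mulVf ?mul1e// normr_eq0//.
rewrite (@fubini_tonelli _ _ _ _ R mu mu (fun z => `|s|^-1%:E * h (s^-1 * z.2 + c * z.1 / s, z.1)%R)%E); last 2 first.
- by apply: emeasurable_funM => //; apply: mE; meas.
- by move=> z; rewrite mule_ge0.
apply: eq_integral => v _ /=.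
rewrite ge0_integralZl//; last by apply: mE1; meas.
rewrite -(@ge0_integral_affine R s (- (c * v)) (fun y => h (s^-1 * v + c * y / s, y)) s0)//; last first.
  by apply: mE1; meas.
apply: eq_integral => w _; congr (h (_, _)).
transitivity (s^-1 * ((c ^+ 2 + s ^+ 2) * v) + c * (s * w - c * v) / s).
  by rewrite cs1 mul1r.
by field.
Qed.

End reflection.

Section normal_reflection.
Context {R : realType}.
Local Notation mu := (@lebesgue_measure R).
Local Notation N := (normal_prob (0 : R) 1).
Local Notation phi := (normal_pdf (0 : R) 1).

Let normal_prod_density (E : set (R * R)) : measurable E ->
  ((N \x N) E =
   \int[mu]_y \int[mu]_x (\1_E (x, y) * phi x * phi y)%:E)%E.
Proof.
move=> mE.
have mphi : measurable_fun [set: R] phi by exact: measurable_normal_pdf.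
have mI (y : R) : measurable_fun [set: R] (fun x => \1_E (x, y) : R).
  by apply: (measurableT_comp (@measurable_indic _ _ _ setT E mE)); meas.
rewrite -[E in LHS]setIT -integral_indic// fubini_tonelli2//; last first.
  by apply/measurable_EFinP; exact: measurable_indic.
rewrite ge0_integral_normal_prob; last 2 first.
- apply: (@measurable_fun_fubini_tonelli_G _ _ _ _ R N (EFin \o \1_E)).
  + by apply/measurable_EFinP; exact: measurable_indic.
  + by move=> z; rewrite lee_fin.
- by move=> y; apply: integral_ge0 => x _; rewrite lee_fin.
apply: eq_integral => y _; rewrite /fubini_G.
rewrite ge0_integral_normal_prob; last 2 first.
- by meas.
- by move=> x; rewrite lee_fin.
rewrite -ge0_integralZr//.
- apply: emeasurable_funM; apply/measurable_EFinP; first exact: mI.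
  exact: measurable_normal_pdf.
- by move=> x _; rewrite -EFinM lee_fin mulr_ge0// normal_pdf_ge0.
- by rewrite lee_fin normal_pdf_ge0.
Qed.

(** The map (x, y) -> (c x + s y, s x - c y) is an orthogonal involution: substituting it returns
    the indicator of [A] times [B], and the product density, a function of x^2 + y^2, does not
    change. *)
Lemma normal_prob_reflection (c s : R) (A B : set R) : s != 0 ->
  c ^+ 2 + s ^+ 2 = 1 -> measurable A -> measurable B ->
  ((N \x N) [set z | A (c * z.1 + s * z.2)%R /\ B (s * z.1 - c * z.2)%R]
   = N A * N B)%E.
Proof.
move=> s0 cs1 mA mB.
have mphi : measurable_fun [set: R] phi by exact: measurable_normal_pdf.
set E := [set z | _].
have mE : measurable E.
  rewrite (_ : E = (fun z : R * R => c * z.1 + s * z.2) @^-1` A `&`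
                   (fun z : R * R => s * z.1 - c * z.2) @^-1` B)//.
  apply: measurableI; rewrite -[X in measurable X]setTI.
    by apply: (_ : measurable_fun setT _) => //; meas.
  by apply: (_ : measurable_fun setT _) => //; meas.
transitivity ((N \x N) (A `*` B))%E; last by rewrite product_measure1E.
rewrite (normal_prod_density mE) (normal_prod_density (measurableX mA mB)).
pose h (z : R * R) := (\1_E z * phi z.1 * phi z.2)%:E.
have mh : measurable_fun [set: R * R] h.
  apply/measurable_EFinP; apply: measurable_funM; last first.
    exact: (measurableT_comp mphi measurable_snd).
  apply: measurable_funM; first exact: measurable_indic.
  exact: (measurableT_comp mphi measurable_fst).
have h0 z : (0 <= h z)%E by rewrite lee_fin !mulr_ge0// normal_pdf_ge0.
transitivity (\int[mu]_y \int[mu]_x h (x, y))%E; first by [].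
rewrite (ge0_integral_reflection s0 cs1 mh h0).
apply: eq_integral => y _; apply: eq_integral => x _; congr (_%:E).
rewrite -!mulrA; congr (_ * _).
  rewrite !indicE; congr (_%:R); congr (nat_of_bool _).
  apply/idP/idP; rewrite !inE /E/=.
    have -> : c * (c * x + s * y) + s * (s * x - c * y) = (c ^+ 2 + s ^+ 2) * x by ring.
    have -> : s * (c * x + s * y) - c * (s * x - c * y) = (c ^+ 2 + s ^+ 2) * y by ring.
    by rewrite cs1 !mul1r.
  have -> : c * (c * x + s * y) + s * (s * x - c * y) = (c ^+ 2 + s ^+ 2) * x by ring.
  have -> : s * (c * x + s * y) - c * (s * x - c * y) = (c ^+ 2 + s ^+ 2) * y by ring.
  by rewrite cs1 !mul1r.
rewrite !normal_pdfE ?oner_neq0//= /normal_fun mulrACA [RHS]mulrACA; congr (_ * _).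
rewrite -!expRD; congr expR; rewrite !subr0 expr1n.
transitivity (- ((c ^+ 2 + s ^+ 2) * (x ^+ 2 + y ^+ 2)) / 2); first by field.
by rewrite cs1 mul1r; field.
Qed.

End normal_reflection.

Section normal_affine.
Context {R : realType}.
Local Notation mu := (@lebesgue_measure R).

Lemma normal_prob_affine (m s : R) (A : set R) : s != 0 -> measurable A ->
  normal_prob m s A = normal_prob 0 1 [set z | A (s * z + m)].
Proof.
move=> s0 mA; rewrite /normal_prob.
pose f x := (\1_A x * normal_pdf m s x)%:E.
have mf : measurable_fun [set: R] f.
  apply/measurable_EFinP; apply: measurable_funM; first exact: measurable_indic.
  exact: measurable_normal_pdf.
have f0 (x : R) : (0 <= f x)%E.
  by rewrite lee_fin mulr_ge0// normal_pdf_ge0.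
have := ge0_integral_affine m s0 mf f0.
have ns0 : 0 < `|s| by rewrite normr_gt0.
move=> /(congr1 (fun x => `|s|%:E * x)%E); rewrite muleA -EFinM divff ?gt_eqF// mul1e.
rewrite -ge0_integralZl//; last first.
  apply: (measurableT_comp mf).
  by apply: measurable_funD => //; exact: measurable_funM.
have indE (B : set R) (g : R -> R) :
    (\int[mu]_(x in B) (g x)%:E = \int[mu]_x (\1_B x * g x)%:E)%E.
  rewrite integral_mkcond; apply: eq_integral => x _.
  by rewrite patchE indicE; case: ifP => _; rewrite ?mul1r ?mul0r.
move=> E; rewrite (indE A) (indE [set z | A (s * z + m)]).
transitivity (\int[mu]_x f x)%E; first by [].
rewrite -E; apply: eq_integral => z _.
rewrite -EFinM; congr (_%:E); rewrite mulrCA; congr (_ * _).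
rewrite !normal_pdfE ?oner_neq0//= /normal_fun /normal_peak addrK subr0 expr1n mul1r.
rewrite mulrA; congr (_ * expR _).
  rewrite -mulrnAr sqrtrM ?sqr_ge0// sqrtr_sqr invfM mulrA divff ?mul1r//.
  by rewrite gt_eqF.
by rewrite exprMn; field.
Qed.

Lemma has_law_normal_standardize d (T : measurableType d) (P : probability T R)
    (X : T -> R) (m s : R) : s != 0 ->
  has_law P X (normal_prob m s) ->
  has_law P (fun w => (X w - m) / s) (normal_prob 0 1).
Proof.
move=> s0 lX A mA.
have mB : measurable [set x : R | A ((x - m) / s)].
  rewrite -[X in measurable X]/((fun x : R => (x - m) / s) @^-1` A).
  by apply: measurable_preimage => //; meas.
rewrite -[LHS]/(P (X @^-1` [set x | A ((x - m) / s)])) lX//.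
rewrite normal_prob_affine//; congr (normal_prob 0 1 _).
by apply/seteqP; split => x /=; rewrite addrK mulrAC divff ?mul1r.
Qed.

Lemma has_law_normal_scale d (T : measurableType d) (P : probability T R)
    (X : T -> R) (s : R) : s != 0 ->
  has_law P X (normal_prob 0 1) ->
  has_law P (fun w => s * X w) (normal_prob 0 s).
Proof.
move=> s0 lX A mA.
have mB : measurable [set x : R | A (s * x + 0)].
  rewrite -[X in measurable X]/((fun x : R => s * x + 0) @^-1` A).
  by apply: measurable_preimage => //; meas.
rewrite normal_prob_affine// -lX//; congr (P _).
by apply/seteqP; split => x /=; rewrite addr0.
Qed.

(** The standard deviation enters the density only through its square. This lets a sign change count
    as scaling by -1. *)
Lemma normal_probN (m s : R) : normal_prob m (- s) = normal_prob m s.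
Proof.
apply/funext => A; apply: eq_integral => x _.
by rewrite /normal_pdf oppr_eq0 /normal_fun /normal_peak !sqrrN.
Qed.

End normal_affine.

(** * Orthogonal transformations of independent normal families *)

Section orthogonal_generation.
Context {R : rcfType} {n : nat}.
Implicit Types (O : 'M[R]_n) (a b : 'I_n) (c s : R).

Definition orthonormal_cols O : Prop :=
  forall j k, \sum_i O i j * O i k = (j == k)%:R.

(** A reflection instead of the usual Givens rotation: it is its own inverse, so undoing an
    elimination step is again a step of the same kind. *)
Definition row_reflection a b c s O : 'M[R]_n :=
  \matrix_(i, j) if i == a then c * O a j + s * O b j
                 else if i == b then s * O a j - c * O b j else O i j.

Definition row_sign a O : 'M[R]_n :=
  \matrix_(i, j) if i == a then - O a j else O i j.

Lemma row_reflectionK a b c s O : a != b -> c ^+ 2 + s ^+ 2 = 1 ->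
  row_reflection a b c s (row_reflection a b c s O) = O.
Proof.
move=> ab cs1; have ba : (b == a) = false by rewrite eq_sym (negbTE ab).
apply/matrixP => i j; rewrite !mxE !eqxx ba.
case: eqP => [->|_].
  transitivity ((c ^+ 2 + s ^+ 2) * O a j); first by ring.
  by rewrite cs1 mul1r.
case: eqP => [->|//].
transitivity ((c ^+ 2 + s ^+ 2) * O b j); first by ring.
by rewrite cs1 mul1r.
Qed.

Lemma row_signK a O : row_sign a (row_sign a O) = O.
Proof.
by apply/matrixP => i j; rewrite !mxE !eqxx; case: eqP => // ->; rewrite opprK.
Qed.

Lemma orthonormal_cols_reflection a b c s O : a != b -> c ^+ 2 + s ^+ 2 = 1 ->
  orthonormal_cols O -> orthonormal_cols (row_reflection a b c s O).
Proof.
move=> ab cs1 oO j k; rewrite -oO.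
have ba : (b == a) = false by rewrite eq_sym (negbTE ab).
rewrite (bigD1 a)//= (bigD1 b) 1?eq_sym//= [in RHS](bigD1 a)//= [in RHS](bigD1 b) 1?eq_sym//=.
rewrite !addrA; congr (_ + _); last first.
  by apply: eq_bigr => i /andP[ia ib]; rewrite !mxE (negbTE ia) (negbTE ib).
rewrite !mxE !eqxx ba.
transitivity ((c ^+ 2 + s ^+ 2) * (O a j * O a k + O b j * O b k)); first by ring.
by rewrite cs1 mul1r.
Qed.

Lemma orthonormal_cols_sign a O :
  orthonormal_cols O -> orthonormal_cols (row_sign a O).
Proof.
move=> oO j k; rewrite -oO; apply: eq_bigr => i _; rewrite !mxE.
by case: eqP => // ->; rewrite mulrNN.
Qed.

Variable Good : 'M[R]_n -> Prop.
Hypothesis Good_reflection : forall O a b c s, a != b -> s != 0 ->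
  c ^+ 2 + s ^+ 2 = 1 -> Good O -> Good (row_reflection a b c s O).
Hypothesis Good_sign : forall O a, Good O -> Good (row_sign a O).
Hypothesis Good1 : Good 1%:M.

Let fixes (k : nat) O := forall i j : 'I_n, (j < k)%N -> O i j = (i == j)%:R.

(* Givens elimination: the entries of column [k] other than the pivot are cleared
   one by one by plane reflections, and a pivot -1 is corrected by a sign change. *)
Let fixes_step (k : 'I_n) :
  (forall O, orthonormal_cols O -> fixes k.+1 O -> Good O) ->
  forall O, orthonormal_cols O -> fixes k O -> Good O.
Proof.
(* Induction on the number of nonzero entries of column [k] off the pivot. *)
move=> IH O; move: {2}(#|_|) (leqnn #|[pred i | (i != k) && (O i k != 0)]|) => m.
elim: m O => [|m IHm] O Om oO fO.
  have Oik i : i != k -> O i k = 0.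
    move=> ik; apply/eqP; apply: contraT => Oik.
    have := card0_eq (elimT eqP (etrans (esym (leqn0 _)) Om)) i.
    by rewrite !inE ik Oik.
  have : O k k ^+ 2 = 1.
    have := oO k k; rewrite eqxx (bigD1 k)//= big1 ?addr0// => i ik.
    by rewrite Oik// mul0r.
  move=> /eqP; rewrite sqrf_eq1 => /orP[]/eqP Okk.
    apply: IH => // i j; rewrite ltnS leq_eqVlt => /orP[/eqP/val_inj ->|]; last exact: fO.
    by have [->|ik] := eqVneq i k; rewrite ?Okk// Oik.
  rewrite -(row_signK k O); apply: Good_sign; apply: IH; first exact: orthonormal_cols_sign.
  move=> i j; rewrite ltnS leq_eqVlt => /orP[/eqP/val_inj ->|jk]; rewrite mxE.
    by have [_|ik] := eqVneq i k; rewrite ?Okk ?opprK// Oik.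
  have [ik|ik] := eqVneq i k; last exact: fO.
  by rewrite ik fO// (_ : k == j = false) ?oppr0//; apply/negbTE; rewrite gt_eqF.
case: (pickP [pred i | (i != k) && (O i k != 0)]) => [a /andP[ak Oak]|O0]; last first.
  by apply: IHm => //; rewrite eq_card0.
(* Orthogonality to the columns already fixed clears column [k] above the pivot. The reflection
   therefore mixes rows [k] and [a] with k < a, both zero in the fixed columns, and leaves those
   columns alone. *)
have Ojk (j : 'I_n) : (j < k)%N -> O j k = 0.
  move=> jk; have := oO j k; rewrite (_ : (j == k) = false) ?lt_eqF//.
  rewrite (bigD1 j)//= fO// eqxx mul1r big1 ?addr0// => i ij.
  by rewrite fO// (negbTE ij) mul0r.
have ka : (k < a)%N.
  rewrite ltn_neqAle eq_sym ak leqNgt; apply/negP => /Ojk /eqP.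
  by rewrite (negbTE Oak).
pose r2 := O k k ^+ 2 + O a k ^+ 2.
have r2_gt0 : 0 < r2 by rewrite ltr_wpDl ?sqr_ge0// exprn_even_gt0.
pose r := Num.sqrt r2.
have r_gt0 : 0 < r by rewrite sqrtr_gt0.
have rE : r ^+ 2 = r2 by rewrite sqr_sqrtr// ltW.
pose c := O k k / r; pose s := O a k / r.
have cs1 : c ^+ 2 + s ^+ 2 = 1.
  by rewrite /c /s !expr_div_n -mulrDl rE divff// gt_eqF.
have s0 : s != 0 by rewrite mulf_neq0// invr_eq0 gt_eqF.
have ka' : k != a by rewrite eq_sym.
rewrite -(row_reflectionK O ka' cs1); apply: Good_reflection => //.
apply: IHm; [|exact: orthonormal_cols_reflection|].
- have aS : a \in [pred i | (i != k) && (O i k != 0)] by rewrite inE ak.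
  rewrite -ltnS; apply: leq_trans Om; rewrite [leqRHS](cardD1 a) aS add1n ltnS.
  apply: subset_leq_card; apply/fintype.subsetP => i; rewrite !inE !mxE.
  case: (eqVneq i k) => //= ik; case: (eqVneq i a) => [->|//].
  by rewrite (_ : _ - _ = 0) ?eqxx// /s /c; ring.
- move=> i j jk; rewrite mxE !fO//.
  have -> : k == j = false by rewrite gt_eqF.
  have aj : (a == j) = false by apply: gt_eqF; exact: ltn_trans ka.
  rewrite aj.
  rewrite !mulr0 addr0 subr0.
  case: (eqVneq i k) => [->|_]; first by rewrite gt_eqF.
  by case: (eqVneq i a) => // ->; rewrite aj.
Qed.

(** Induction on the number of columns not yet known to be those of the identity. The law of an
    orthogonal transform is thereby reduced to a statement about two coordinates. *)
Lemma orthogonal_generation O : orthonormal_cols O -> Good O.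
Proof.
suff H m O' : orthonormal_cols O' -> (m <= n)%N -> fixes (n - m) O' -> Good O'.
  by move=> oO; apply: (H n) => //; rewrite subnn.
elim: m O' => [|m IH] O' oO' mn fO'.
  rewrite (_ : O' = 1%:M)//; apply/matrixP => i j.
  by rewrite fO' ?subn0// mxE.
have nm : (n - m.+1 < n)%N by rewrite ltn_subrL (leq_trans _ mn).
apply: (@fixes_step (Ordinal nm)) => // O1 oO1 fO1.
by apply: IH => //; [exact: ltnW|rewrite -subnSK].
Qed.

End orthogonal_generation.

(** * Independent families and reflection of two of their normal members *)

Section independence.
Context d (T : measurableType d) {R : realType} (P : probability T R).

Lemma eq_measure_prod d1 d2 (T1 : measurableType d1) (T2 : measurableType d2)
    (m1 m2 : {measure set (T1 * T2) -> \bar R}) :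
  (m1 setT < +oo)%E ->
  (forall A B, measurable A -> measurable B -> m1 (A `*` B) = m2 (A `*` B)) ->
  forall E, measurable E -> m1 E = m2 E.
Proof.
move=> m1oo m12 E mE.
pose C : set_system (T1 * T2) :=
  [set X | exists A, measurable A /\ exists B, measurable B /\ X = A `*` B].
apply: (measure_unique C (fun=> setT)) => //.
- rewrite measurable_prod_measurableType; congr (<<s _ >>).
  by rewrite predeqE => X; split => [[A mA [B mB <-]]|[A [mA [B [mB ->]]]]];
    [exists A; split => //; exists B|exists A => //; exists B].
- move=> _ _ [A1 [mA1 [B1 [mB1 ->]]]] [A2 [mA2 [B2 [mB2 ->]]]].
  exists (A1 `&` A2); split; first exact: measurableI.
  by exists (B1 `&` B2); split; [exact: measurableI|rewrite setXI].
- by move=> _; exists setT; split => //; exists setT; split => //; rewrite setXTT.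
- by rewrite predeqE => x; split => // _; exists 0%N.
- by move=> _ [A [mA [B [mB ->]]]]; exact: m12.
Qed.

Section finite_families.
Context {I : finType}.
Implicit Types X : I -> T -> R.

Lemma mutually_independentP X :
  mutually_independent P X <->
  forall B : I -> set R, (forall i, measurable (B i)) ->
    P (\bigcap_i (X i @^-1` B i)) = (\prod_i P (X i @^-1` B i))%E.
Proof.
split => [iX B mB|iX J B mB].
  have := iX [set: I]%SET B mB.
  rewrite (_ : [set` [set: I]%SET] = setT); last by apply/seteqP; split => // i _ /=; rewrite inE.
  by under eq_bigl do rewrite inE.
pose B' i := if i \in J then B i else setT.
have := iX B'; rewrite (_ : \bigcap_i _ = \bigcap_(i in [set` J]) (X i @^-1` B i)); last first.
  apply/seteqP; split => [w wB i /= iJ|w wB i _].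
    by have := wB i Logic.I; rewrite /B' iJ.
  by rewrite /B'; case: ifPn => // iJ; exact: wB.
move=> ->; last by move=> i; rewrite /B'; case: ifPn.
rewrite [RHS]big_mkcond; apply: eq_bigr => i _; rewrite /B'; case: ifPn => // _.
by rewrite preimage_setT probability_setT.
Qed.

Lemma mutually_independent_comp X (g : I -> R -> R) :
  (forall i, measurable_fun setT (g i)) ->
  mutually_independent P X -> mutually_independent P (fun i w => g i (X i w)).
Proof.
move=> mg iX J B mB; apply: (iX J (fun i => g i @^-1` B i)) => i.
exact: measurable_preimage.
Qed.

End finite_families.

End independence.

Section independent_normal_reflection.
Context d (T : measurableType d) {R : realType} (P : probability T R).
Context {I : finType}.
Variables (X : I -> T -> R) (a b : I).
Hypothesis mX : forall i, measurable_fun setT (X i).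
Hypothesis iX : mutually_independent P X.
Hypothesis ab : a != b.
Local Notation N := (normal_prob (0 : R) 1).
Hypothesis Xa : has_law P (X a) N.
Hypothesis Xb : has_law P (X b) N.

(** Both sides are finite measures in [E] that agree on rectangles by independence. The extension to
    all [E] is needed because a reflection turns rectangles into sets that are not rectangles. *)
Let joint (B : I -> set R) (E : set (R * R)) : (forall i, measurable (B i)) ->
  B a = setT -> B b = setT -> measurable E ->
  P ([set w | E (X a w, X b w)] `&` \bigcap_i (X i @^-1` B i)) =
  ((N \x N)%E E * \prod_(i | (i != a) && (i != b)) P (X i @^-1` B i))%E.
Proof.
move=> mB Ba Bb mE; set K := \bigcap_i _; set q := (\prod_(i | _) _)%E.
have mpre i : measurable (X i @^-1` B i) by exact: measurable_preimage.
have mK : measurable K.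
  by apply: fin_bigcap_measurable => //; exact: finite_finset.
have q_fin : q \is a fin_num.
  by rewrite /q; apply: prode_fin_num => i _; exact: fin_num_measure.
have q0 : (0 <= q)%E by apply: prode_ge0 => i _; exact: measure_ge0.
have fq0 : 0 <= fine q by rewrite fine_ge0.
pose V w : measurableTypeR R * measurableTypeR R := (X a w, X b w).
have mV : measurable_fun [set: T] V.
  exact: (measurable_fun_pair (mX a : measurable_fun _ (_ : T -> measurableTypeR R)) (mX b : measurable_fun _ (_ : T -> measurableTypeR R))).
pose m1 : {measure set (measurableTypeR R * measurableTypeR R) -> \bar R} := pushforward (mrestr P mK) V.
pose m2 : {measure set (measurableTypeR R * measurableTypeR R) -> \bar R} := mscale (NngNum fq0) (N \x N)%E.
have -> : ((N \x N)%E E * q = m2 E)%E by rewrite -[RHS]/((fine q)%:E * (N \x N)%E E)%E fineK// muleC.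
rewrite -[LHS]/(m1 mV E); apply: eq_measure_prod => // [|A1 A2 mA1 mA2].
  rewrite -[X in (X < _)%E]/(P (V @^-1` setT `&` K)).
  by rewrite (le_lt_trans (probability_le1 _ _))// ?ltry// preimage_setT setTI.
rewrite -[LHS]/(P (V @^-1` (A1 `*` A2) `&` K)).
rewrite -[RHS]/((fine q)%:E * (N \x N)%E (A1 `*` A2))%E product_measure1E// fineK//.
pose B' i := if i == a then A1 else if i == b then A2 else B i.
have mB' i : measurable (B' i).
  by rewrite /B'; case: ifP => _; [exact: mA1|case: ifP => _; [exact: mA2|exact: mB]].
rewrite (_ : _ `&` _ = \bigcap_i (X i @^-1` B' i)); last first.
  apply/seteqP; split => [w [[/= A1w A2w] Kw] i _|w Bw].
    rewrite /B'/=; case: eqP => [->//|_]; case: eqP => [->//|_]; exact: Kw.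
  split; first split => /=.
  - by have := Bw a Logic.I; rewrite /B' eqxx.
  - by have := Bw b Logic.I; rewrite /B' eqxx eq_sym (negbTE ab).
  move=> i _; have := Bw i Logic.I; rewrite /B'/=.
  by case: eqP => [->|_]; [rewrite Ba|case: eqP => [->|//]; rewrite Bb].
have /mutually_independentP -> // := iX.
rewrite (bigD1 a)//= (bigD1 b) 1?eq_sym//= /B' !eqxx (eq_sym b) (negbTE ab) Xa// Xb//.
rewrite muleA muleC; congr (_ * _)%E; apply: eq_bigr => i /andP[ia ib].
by rewrite (negbTE ia) (negbTE ib).
Qed.

Variables (c s : R).
Hypotheses (s0 : s != 0) (cs1 : c ^+ 2 + s ^+ 2 = 1).

Definition reflected_family i w :=
  if i == a then c * X a w + s * X b w
  else if i == b then s * X a w - c * X b w else X i w.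
Local Notation X' := reflected_family.

Let reflected (B : I -> set R) : (forall i, measurable (B i)) ->
  P (\bigcap_i (X' i @^-1` B i)) =
  (N (B a) * (N (B b) * \prod_(i | (i != a) && (i != b)) P (X i @^-1` B i)))%E.
Proof.
move=> mB; rewrite muleA -(normal_prob_reflection s0 cs1)//.
set E := [set z | _].
have mE : measurable E.
  rewrite (_ : E = (fun z : R * R => c * z.1 + s * z.2) @^-1` B a `&`
                   (fun z : R * R => s * z.1 - c * z.2) @^-1` B b)//.
  by apply: measurableI; apply: measurable_preimage => //; meas.
pose B' i := if i == a then setT else if i == b then setT else B i.
have mB' i : measurable (B' i) by rewrite /B'; case: ifP => // _; case: ifP.
have B'a : B' a = setT by rewrite /B' eqxx.
have B'b : B' b = setT by rewrite /B' eqxx; case: ifP.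
transitivity ((N \x N)%E E * \prod_(i | (i != a) && (i != b)) P (X i @^-1` B' i))%E; last first.
  by congr (_ * _)%E; apply: eq_bigr => i /andP[ia ib]; rewrite /B' (negbTE ia) (negbTE ib).
rewrite -joint//; congr (P _); apply/seteqP; split => [w Bw|w [[/= Ea Eb] Bw] i _].
  split.
    have := Bw a Logic.I; have := Bw b Logic.I.
    by rewrite /reflected_family /E/= !eqxx eq_sym (negbTE ab).
  move=> i _; have := Bw i Logic.I; rewrite /B' /reflected_family/=.
  by case: eqP => // _; case: eqP.
have := Bw i Logic.I; rewrite /B' /reflected_family/=.
by case: eqP => [->//|_]; case: eqP => [->//|_].
Qed.

(** The marginal law follows from the joint formula by prescribing the full line at every other
    index; the index in ['I_2] serves [a] and [b] at once. *)
Let single (i : 'I_2) (A : set R) : measurable A ->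
  P (X' (if i == ord0 then a else b) @^-1` A) = N A.
Proof.
move=> mA; set k := if _ then _ else _.
have kab : (k == a) || (k == b) by rewrite /k; case: ifP; rewrite eqxx ?orbT.
pose B j := if j == k then A else setT.
have -> : X' k @^-1` A = \bigcap_j (X' j @^-1` B j).
  apply/seteqP; split => [w Aw j _|w Bw]; last first.
    by have := Bw k Logic.I; rewrite /B eqxx.
  by rewrite /B/=; case: eqP => [->|].
rewrite reflected; last by move=> j; rewrite /B; case: ifP.
rewrite big1 => [|j /andP[ja jb]]; last first.
  rewrite /B; have [jk|_] := eqVneq j k; last by rewrite preimage_setT probability_setT.
  by move: kab; rewrite -jk (negbTE ja) (negbTE jb).
have N1 : N setT = 1%E by exact: (@probability_setT _ _ _ N).
rewrite mule1 /B /k; have [_|_] := eqVneq i ord0; rewrite eqxx.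
  by rewrite eq_sym (negbTE ab) N1 mule1.
by rewrite (negbTE ab) N1 mul1e.
Qed.

Lemma has_law_normal_reflection i :
  has_law P (X i) N -> has_law P (X' i) N.
Proof.
move=> Xi A mA.
have [->|ia] := eqVneq i a; first exact: (@single ord0).
have [->|ib] := eqVneq i b; first exact: (@single ord_max).
by rewrite -Xi// /reflected_family (negbTE ia) (negbTE ib).
Qed.

Lemma mutually_independent_normal_reflection : mutually_independent P X'.
Proof.
apply/mutually_independentP => B mB; rewrite reflected//.
rewrite [RHS](bigD1 a)//= [X in (_ = _ * X)%E](bigD1 b) 1?eq_sym//=.
rewrite !has_law_normal_reflection//; congr (_ * (_ * _))%E.
by apply: eq_bigr => i /andP[ia ib]; rewrite /reflected_family (negbTE ia) (negbTE ib).
Qed.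

End independent_normal_reflection.

Section orthogonal_transformation.
Context d (T : measurableType d) {R : realType} (P : probability T R).
Context {p : nat}.
Variables (z u : 'I_p -> T -> R).
Hypothesis mz : forall i, measurable_fun setT (z i).
Hypothesis mu : forall i, measurable_fun setT (u i).
Hypothesis izu : mutually_independent P (data_family z u).
Hypothesis lz : forall i, has_law P (z i) (normal_prob 0 1).

Definition linear_combinations (O : 'M[R]_p) i w := \sum_k O i k * z k w.

Lemma measurable_linear_combinations O i :
  measurable_fun setT (linear_combinations O i).
Proof. by apply: measurable_sum => k; exact: measurable_funM. Qed.

Let Good O := mutually_independent P (data_family (linear_combinations O) u) /\
  forall i, has_law P (linear_combinations O i) (normal_prob 0 1).

Let inl_eq (i j : 'I_p) : (inl i == inl j :> 'I_p + 'I_p) = (i == j).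
Proof. by []. Qed.

(** The [u] belong to the family throughout because the transformed normals must also be independent
    of them; reflections and sign changes act on [inl] indices only. *)
Lemma orthogonal_independent O : orthonormal_cols O ->
  mutually_independent P (data_family (linear_combinations O) u) /\
  forall i, has_law P (linear_combinations O i) (normal_prob 0 1).
Proof.
apply: (orthogonal_generation (Good := Good)) => {O} [ O a b c s ab s0 cs1 [iO lO]|O a [iO lO]|].
- have ab' : inl a != inl b :> 'I_p + 'I_p by [].
  have mO i : measurable_fun setT (data_family (linear_combinations O) u i).
    by case: i => i /=; [exact: measurable_linear_combinations|exact: mu].
  have E : data_family (linear_combinations (row_reflection a b c s O)) u =
      reflected_family (data_family (linear_combinations O) u) (inl a) (inl b) c s.
    apply/funext => -[i|i]; apply/funext => w //.
    rewrite /reflected_family /= /linear_combinations.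
    under eq_bigr do rewrite mxE.
    rewrite !inl_eq.
    case: ifP => _; last (case: ifP => _ //).
      by rewrite !mulr_sumr -big_split/=; apply: eq_bigr => k _; ring.
    by rewrite !mulr_sumr -sumrB; apply: eq_bigr => k _; ring.
  split; first by rewrite E; exact: (mutually_independent_normal_reflection mO iO ab' (lO a) (lO b) s0 cs1).
  move=> i; have := @has_law_normal_reflection _ _ _ P _ _ (inl a) (inl b) mO iO ab' (lO a) (lO b) c s s0 cs1 (inl i) (lO i).
  by rewrite -E.
- have E i w : linear_combinations (row_sign a O) i w =
      (if i == a then - linear_combinations O i w else linear_combinations O i w).
    rewrite /linear_combinations; under eq_bigr do rewrite mxE.
    case: eqP => [->|//]; rewrite -sumrN.
    by apply: eq_bigr => k _; rewrite mulNr.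
  split.
    rewrite (_ : data_family _ _ = fun i w => (if i == inl a then -%R else idfun)
      (data_family (linear_combinations O) u i w)); last first.
      apply/funext => -[i|i]; apply/funext => w //=.
      by rewrite inl_eq E; case: ifP.
    apply: (mutually_independent_comp (g := fun i => if i == inl a then -%R else idfun)) => // i.
    by case: ifP => _; [exact: oppr_measurable|exact: measurable_id].
  move=> i; have [ia|ia] := eqVneq i a; last first.
    rewrite (_ : linear_combinations _ i = linear_combinations O i)//.
    by apply/funext => w; rewrite E (negbTE ia).
  rewrite (_ : linear_combinations _ i = fun w => -1 * linear_combinations O i w); last first.
    by apply/funext => w; rewrite E ia eqxx mulN1r.
  rewrite -normal_probN; apply: has_law_normal_scale; last exact: lO.
  by rewrite oppr_eq0 oner_neq0.
- have E i : linear_combinations 1%:M i = z i.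
    apply/funext => w; rewrite /linear_combinations (bigD1 i)//= big1 => [|k ki].
      by rewrite mxE eqxx mul1r addr0.
    by rewrite mxE eq_sym (negbTE ki) mul0r.
  by split => [|i]; rewrite ?E//; rewrite (_ : linear_combinations _ = z)//; exact/funext.
Qed.

End orthogonal_transformation.

(** * Resampling one coordinate *)

Section data_law.
Context {R : realType} {p : nat}.
Local Notation S := (p.-tuple R * p.-tuple R)%type.

Definition data_box (B : 'I_p + 'I_p -> set R) : set S :=
  \bigcap_k [set z | B k (match k with inl i => tnth z.1 i | inr i => tnth z.2 i end)].

Let coord (k : 'I_p + 'I_p) (z : S) : R :=
  match k with inl i => tnth z.1 i | inr i => tnth z.2 i end.

Let measurable_coord k : measurable_fun setT (coord k).
Proof.
case: k => i.
  by apply: (measurableT_comp (measurable_tnth i) measurable_fst).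
by apply: (measurableT_comp (measurable_tnth i) measurable_snd).
Qed.

Let boxes : set_system S :=
  [set X | exists2 B, (forall k, measurable (B k)) & X = data_box B].

(** The product sigma-algebra is the smallest making all coordinates measurable, and each coordinate
    condition is a box. Boxes are closed under intersection, so they determine finite measures. *)
Let measurable_boxes : measurable = <<s boxes >>.
Proof.
apply/seteqP; split => [A mA|A].
  pose id' (z : g_sigma_algebraType boxes) : S := z.
  have mcoord k : measurable_fun [set: g_sigma_algebraType boxes] (coord k \o id').
    move=> _ B mB; rewrite setTI; apply: sub_sigma_algebra.
    exists (fun l => if l == k then B else setT); first by move=> l; case: ifP.
    apply/seteqP; split => [z Bz l _ /=|z /(_ k Logic.I)/=]; last by rewrite eqxx.
    by case: eqP => // ->.
  have mid : measurable_fun [set: g_sigma_algebraType boxes] id'.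
    apply/measurable_fun_pairP; split; apply/measurable_fun_tnthP => i.
      exact: (mcoord (inl i)).
    exact: (mcoord (inr i)).
  by have := mid measurableT A mA; rewrite setTI.
apply: smallest_sub; first exact: sigma_algebra_measurable.
move=> _ [B mB ->]; apply: fin_bigcap_measurable => // k _.
exact: measurable_preimage (measurable_coord k) (mB k).
Qed.

Lemma eq_measure_data (m1 m2 : {measure set S -> \bar R}) :
  (m1 setT < +oo)%E ->
  (forall B, (forall k, measurable (B k)) -> m1 (data_box B) = m2 (data_box B)) ->
  forall E, measurable E -> m1 E = m2 E.
Proof.
move=> m1oo m12 E mE.
apply: (measure_unique boxes (fun=> setT)) => //.
- move=> _ _ [B1 mB1 ->] [B2 mB2 ->]; exists (fun k => B1 k `&` B2 k).
    by move=> k; exact: measurableI.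
  by rewrite /data_box -bigcapI; apply: eq_bigcapr => k _.
- move=> _; exists (fun=> setT) => //.
  by apply/seteqP; split.
- by rewrite predeqE => x; split => // _; exists 0%N.
- by move=> _ [B mB ->]; exact: m12.
Qed.

End data_law.

Section resampling.
Context d (T : measurableType d) {R : realType} (P : probability T R).
Context {p : nat}.
Local Notation S := (p.-tuple R * p.-tuple R)%type.
Variables (X U : 'I_p -> T -> R).
Hypothesis mX : forall i, measurable_fun setT (X i).
Hypothesis mU : forall i, measurable_fun setT (U i).
Hypothesis iXU : mutually_independent P (data_family X U).
Variables (j : 'I_p) (Q : probability (measurableTypeR R) R).
Hypothesis lXj : has_law P (X j) Q.

Definition set_data (z : S) (t : R) : S := (set_coord z.1 j t, z.2).

Lemma measurable_set_coord d' (T' : measurableType d') n (k : 'I_n)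
    (f : T' -> n.-tuple R) (g : T' -> R) :
  measurable_fun setT f -> measurable_fun setT g ->
  measurable_fun setT (fun w => set_coord (f w) k (g w)).
Proof.
move=> mf mg; apply/measurable_fun_tnthP => i.
rewrite [Z in measurable_fun _ Z](_ : _ = fun w => if i == k then g w else tnth (f w) i); last first.
  by apply/funext => w /=; rewrite /set_coord tnth_mktuple.
by case: (i == k) => //; apply: (measurableT_comp (measurable_tnth i) mf).
Qed.

Lemma measurable_data : measurable_fun setT (data X U).
Proof.
apply: measurable_fun_pair; apply/measurable_fun_tnthP => i.
  rewrite [Z in measurable_fun _ Z](_ : _ = X i)//.
  by apply/funext => w /=; rewrite tnth_mktuple.
rewrite [Z in measurable_fun _ Z](_ : _ = U i)//.
by apply/funext => w /=; rewrite tnth_mktuple.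
Qed.

Let V (w : T) : S := data X U w.
Let V' (wt : T * measurableTypeR R) : S := set_data (V wt.1) wt.2.

Let mV' : measurable_fun setT V'.
Proof.
apply: measurable_fun_pair.
  apply: measurable_set_coord; last exact: measurable_snd.
  exact: (measurableT_comp measurable_fst (measurableT_comp measurable_data measurable_fst)).
exact: (measurableT_comp measurable_snd (measurableT_comp measurable_data measurable_fst)).
Qed.

(** On boxes both sides factor by independence, and the overwritten coordinate contributes the
    factor 1. With Fubini this plays the part of conditioning on all data except coordinate [j]. *)
Let resampling_law (E : set S) : measurable E ->
  pushforward P V E = pushforward (P \x Q)%E V' E.
Proof.
move=> mE.
pose m1 : {measure set S -> \bar R} := pushforward P V.
pose m2 : {measure set S -> \bar R} := pushforward (P \x Q)%E V'.
apply: (@eq_measure_data R p (m1 measurable_data) (m2 mV')) => // [|B mB].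
  by rewrite -[Z in (Z < _)%E]/(P setT) probability_setT ltry.
rewrite -[LHS]/(P (V @^-1` data_box B)) -[RHS]/((P \x Q)%E (V' @^-1` data_box B)).
pose B' k := if k == inl j then setT else B k.
have mB' k : measurable (B' k) by rewrite /B'; case: ifP.
have mfam k : measurable_fun setT (data_family X U k).
  by case: k => i /=; [exact: mX|exact: mU].
have mK : measurable (\bigcap_k data_family X U k @^-1` B' k).
  by apply: fin_bigcap_measurable => // k _; exact: measurable_preimage.
rewrite (_ : V' @^-1` _ = (\bigcap_k data_family X U k @^-1` B' k) `*` B (inl j)); last first.
  apply/seteqP; split => [[w t] /= Bwt|[w t] [/= Bw Bt] k _].
    split; last first.
      by have := Bwt (inl j) Logic.I; rewrite /V' /set_data /= /set_coord tnth_mktuple eqxx.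
    move=> k _; have := Bwt k Logic.I; rewrite /B'.
    case: k => i /=; rewrite /set_coord !tnth_mktuple//.
    by rewrite -[inl i == inl j]/(i == j); case: (i == j).
  have := Bw k Logic.I; rewrite /B'.
  case: k => i /=; rewrite /set_coord !tnth_mktuple//.
  by rewrite -[inl i == inl j]/(i == j); case: eqP => [->|].
rewrite product_measure1E//; last exact: mB.
rewrite (_ : V @^-1` _ = \bigcap_k data_family X U k @^-1` B k); last first.
  apply/seteqP; split => [w Bw k _|w Bw k _]; have := Bw k Logic.I;
    by case: k => i /=; rewrite tnth_mktuple.
have /mutually_independentP iXU' := iXU.
rewrite (iXU' B mB) [Z in (_ = Z * _)%E](_ : _ = \prod_k P (data_family X U k @^-1` B' k))%E; last exact: iXU'.
rewrite (bigD1 (inl j))//= [in RHS](bigD1 (inl j))//= (_ : B' (inl j) = setT); last by rewrite /B' eqxx.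
rewrite preimage_setT probability_setT mul1e lXj// muleC; congr (_ * _)%E.
by apply: eq_bigr => k kj; rewrite /B' (negbTE kj).
Qed.

Lemma ge0_resampling (H : S -> \bar R) : measurable_fun setT H ->
  (forall z, 0 <= H z)%E ->
  (\int[P]_w H (data X U w) =
   \int[P \x Q]_z H (set_data (data X U z.1) z.2))%E.
Proof.
move=> mH H0.
transitivity (\int[pushforward P V]_z H z)%E.
  by rewrite ge0_integral_pushforward//; exact: measurable_data.
transitivity (\int[pushforward (P \x Q) V']_z H z)%E; last first.
  by rewrite (ge0_integral_pushforward mV').
apply: eq_measure_integral; [exact: measurable_data|by move=> ? A mA _; exact: resampling_law].
Qed.

Lemma integrable_resampling (H : S -> \bar R) : measurable_fun setT H ->
  P.-integrable setT (H \o data X U) ->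
  (P \x Q)%E.-integrable setT (fun z => H (set_data (data X U z.1) z.2)).
Proof.
move=> mH /integrableP[_ iH]; apply/integrableP; split.
  exact: (measurableT_comp mH mV').
rewrite -(@ge0_resampling (fun z => `|H z|)%E)//.
exact: measurableT_comp.
Qed.

Lemma resampling (H : S -> \bar R) : measurable_fun setT H ->
  P.-integrable setT (H \o data X U) ->
  (\int[P]_w H (data X U w) =
   \int[P \x Q]_z H (set_data (data X U z.1) z.2))%E.
Proof.
move=> mH iH.
transitivity (\int[pushforward P V]_z H z)%E.
  by rewrite (integral_pushforward measurable_data mH)//= preimage_setT.
transitivity (\int[pushforward (P \x Q) V']_z H z)%E; last first.
  rewrite (integral_pushforward mV' mH)//= preimage_setT//.
  exact: integrable_resampling.
apply: eq_measure_integral; [exact: measurable_data|by move=> ? A mA _; exact: resampling_law].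
Qed.

End resampling.

(** * Stein's identity *)

Section right_monotone.
Context {R : realType}.

(** Continuous induction: let s be the supremum of the points up to which [f] stays above [f a]. The
    second hypothesis carries the bound to s itself, and the first carries it beyond s unless s =
    b. *)
Lemma locally_right_nondecreasing (f : R -> R) (a b : R) : a <= b ->
  (forall x, a <= x < b -> exists2 e, 0 < e &
     forall y, x < y < x + e -> f x <= f y) ->
  (forall x, a < x <= b -> (forall y, a <= y < x -> f a <= f y) -> f a <= f x) ->
  f a <= f b.
Proof.
move=> ab fright fleft.
pose S := [set x | a <= x <= b /\ forall y, a <= y <= x -> f a <= f y].
have Sa : S a.
  by split; [rewrite lexx|move=> y; rewrite -eq_le => /eqP <-].
have Sb x : S x -> x <= b by case=> /andP[].
have hS : has_sup S by split; [exists a|exists b => x; exact: Sb].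
pose s := sup S.
have as_ : a <= s by apply: ub_le_sup => //; exact: hS.2.
have sb : s <= b by apply: ge_sup; [exact: hS.1|move=> x; exact: Sb].
have before y : a <= y < s -> f a <= f y.
  move=> /andP[ay ys]; have [x Sx] := sup_adherent (ltac:(rewrite subr_gt0; exact: ys) : 0 < s - y) hS.
  rewrite opprB subrKC => yx; apply: Sx.2; by rewrite ay ltW.
have fs : f a <= f s.
  have [<-//|sa] := eqVneq a s.
  by apply: fleft => //; rewrite lt_neqAle sa as_ sb.
have Ss : S s.
  split; first by rewrite as_.
  by move=> y /andP[ay]; rewrite le_eqVlt => /orP[/eqP ->//|ys]; apply: before; rewrite ay.
have [<-//|sb'] := eqVneq s b.
have s_lt_b : s < b by rewrite lt_neqAle sb'.
have [e e0 fe] := fright s (ltac:(by rewrite as_)).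
pose t := Num.min b (s + e / 2).
have st : s < t by rewrite lt_min s_lt_b ltrDl divr_gt0.
suff : S t by move=> /(ub_le_sup hS.2); rewrite leNgt st.
split; first by rewrite (le_trans as_ (ltW st))/= ge_min lexx.
move=> y /andP[ay yt]; have [ys|sy] := leP y s; first by apply: Ss.2; rewrite ay.
rewrite (le_trans fs)// fe// sy (le_lt_trans yt)// gt_min.
by rewrite ltrD2l ltr_pdivrMr// ltr_pMr// ltr1n orbT.
Qed.

End right_monotone.

Section upper_cover.
Context {R : realType}.
Local Notation mu := (@lebesgue_measure R).
Local Open Scope ereal_scope.

(* Vitali-Caratheodory: [nu] plays the role of the measure whose density is a
   lower semicontinuous function lying strictly above [g]. *)
Lemma lebesgue_upper_cover (I : set R) (g : R -> R) (e : R) :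
  measurable I -> mu I < +oo -> measurable_fun I g ->
  (forall x, I x -> 0 <= g x)%R -> (0 < e)%R ->
  exists nu : {measure set (measurableTypeR R) -> \bar R},
    nu setT <= \int[mu]_(x in I) (g x)%:E + e%:E * mu I + e%:E /\
    forall x, I x -> exists r : R, exists V : set R,
      [/\ (g x < r)%R, open V, V x &
          forall A, measurable A -> A `<=` V -> r%:E * mu A <= nu A].
Proof.
move=> mI Ioo mg g0 e0.
pose E k := I `&` g @^-1` `[(k%:R * e)%R, (k.+1%:R * e)%R[.
have mE k : measurable (E k) by apply: mg => //; exact: measurable_itv.
have Eoo k : mu (E k) < +oo.
  apply: le_lt_trans Ioo; apply: le_measure; last by move=> x [].
    exact (mem_set (mE k)).
  exact: mem_set.
(* Slice [k] will be weighted by (k + 1) e, so its open cover may exceed it by 1 / (2^(k+1) (k +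
   1)); the excess masses e / 2^(k+1) then add up to e. *)
pose dl k := (((2 ^ k.+1)%:R)^-1 / k.+1%:R)%R : R.
have dl0 k : (0 < dl k)%R by rewrite divr_gt0// invr_gt0// ltr0n expn_gt0.
have /choice[V VP] : forall k, exists U : set R, [/\ open U, E k `<=` U & mu (U `\` E k) < (dl k)%:E].
  by move=> k; exact: (lebesgue_regularity_outer (mE k) (Eoo k) (dl0 k)).
have mV k : measurable (V k) by apply: open_measurable; case: (VP k).
have ke0 k : (0 <= k.+1%:R * e :> R)%R by rewrite mulr_ge0// ltW.
(* On [V k] this has density (k + 1) e, strictly above every value of [g] on the slice [E k]. *)
pose m k : {measure set (measurableTypeR R) -> \bar R} := mscale (NngNum (ke0 k)) (mrestr mu (mV k)).
exists (mseries m 0); split; last first.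
  move=> x Ix; pose k := Num.truncn (g x / e)%R.
  have ge0 : (0 <= g x / e)%R by rewrite divr_ge0 ?g0// ltW.
  have /andP[kg gk] := truncn_itv ge0.
  have [oV EV _] := VP k.
  exists (k.+1%:R * e)%R, (V k); split => //.
  - by rewrite -ltr_pdivrMr.
  - by apply: EV; split => //=; rewrite in_itv/= -ler_pdivlMr// kg -ltr_pdivrMr.
  move=> A mA AV.
  have m0 i : 0 <= m i A by exact: measure_ge0.
  rewrite -[leRHS]/(\sum_(0 <= i <oo) m i A) (nneseriesD1 (n := k))//.
  rewrite -[leLHS]adde0 leeD//; last by apply: nneseries_ge0.
  by rewrite -[leRHS]/((k.+1%:R * e)%:E * mu (A `&` V k)) (setIidl AV).
have IE : I = \bigcup_k E k.
  apply/seteqP; split => [x Ix|x [k _ []//]].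
  have ge0 : (0 <= g x / e)%R by rewrite divr_ge0 ?g0// ltW.
  have /andP[kg gk] := truncn_itv ge0.
  exists (Num.truncn (g x / e)%R) => //; split => //=.
  by rewrite in_itv/= -ler_pdivlMr// kg -ltr_pdivrMr.
have tE : trivIset setT E.
  apply/trivIsetP => i j _ _; apply: contraNP => /eqP/set0P[x [[_ /=]]].
  rewrite !in_itv/= => /andP[ix xi] [_ /=]; rewrite in_itv/= => /andP[jx xj].
  rewrite eqn_leq; apply/andP; split; rewrite -ltnS -(ltr_nat R) -(ltr_pM2r e0).
    exact: le_lt_trans xj.
  exact: le_lt_trans xi.
have mge : measurable_fun I (fun x => (g x)%:E + e%:E).
  by apply: emeasurable_funD => //; exact/measurable_EFinP.
have -> : \int[mu]_(x in I) (g x)%:E + e%:E * mu I = \sum_(k <oo) \int[mu]_(x in E k) ((g x)%:E + e%:E).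
  rewrite -ge0_integral_bigcup -?IE//; last first.
    by move=> x Ix; rewrite adde_ge0// lee_fin ?g0// ltW.
  rewrite ge0_integralD//; last 2 first.
  - exact/measurable_EFinP.
  - by move=> x _; rewrite lee_fin ltW.
  by congr (_ + _); rewrite integral_cst.
apply: le_trans (epsilon_trick xpredT _ (ltW e0)); last first.
  by move=> k; apply: integral_ge0 => x [Ix _]; rewrite adde_ge0// lee_fin ?g0// ltW.
rewrite -[leLHS]/(\sum_(0 <= i <oo) m i setT).
apply: lee_nneseries => k _.
  by move=> _; exact: measure_ge0.
have [oV EV Vdl] := VP k.
rewrite -[leLHS]/((k.+1%:R * e)%:E * mu (setT `&` V k)) setTI.
apply: (@le_trans _ _ ((k.+1%:R * e)%:E * (mu (E k) + (dl k)%:E))).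
  rewrite lee_wpmul2l ?lee_fin//.
  rewrite -{1}(setDUK EV); apply: le_trans (leeD (lexx _) (ltW Vdl)).
  apply: measureU2; first exact (mE k).
  exact: (@measurableD _ (measurableTypeR R) _ _ (mV k) (mE k)).
rewrite muleDr// ?ge0_adde_def ?inE ?lee_fin ?(ltW (dl0 k))//.
apply: leeD.
  rewrite -(@integral_cst _ (measurableTypeR R) R mu (E k) (mE k)).
  apply: ge0_le_integral => //.
  - exact (mE k).
  - by move=> x _; rewrite lee_fin.
  - by apply: measurable_funS mge => // x [].
  move=> x [Ix]; rewrite /= in_itv/= => /andP[kg _].
  by rewrite -EFinD lee_fin -natr1 mulrDl mul1r lerD2r.
rewrite -EFinM lee_fin /dl mulrC mulrA -[leRHS]mulrC.
by rewrite mulfVK ?pnatr_eq0.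
Qed.

End upper_cover.

Section derivative_integral.
Context {R : realType}.
Local Notation mu := (@lebesgue_measure R).

Lemma is_derive_right_lt (h : R -> R) (x l c : R) :
  is_derive x 1 h l -> l < c ->
  exists2 e, 0 < e & forall y, x < y < x + e -> h y - h x <= c * (y - x).
Proof.
move=> [dh hl] lc.
have := @cvgr_lt _ _ _ _ _ _ dh c; rewrite -[lim _]/('D_1 h x) hl => /(_ _ lc).
move=> /nbhs_ballP[e /= e0 He]; exists e => // y /andP[xy yxe].
have yx0 : 0 < y - x by rewrite subr_gt0.
have /= := He (y - x); rewrite /ball/= sub0r normrN gtr0_norm// ltrBlDl yxe.
move=> /(_ isT); rewrite gt_eqF// => /(_ isT).
rewrite scaler1 subrK -[_ *: _]/(_ * _) => /ltW.
by rewrite ler_pdivrMl// mulrC.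
Qed.

Lemma continuous_near (h : R -> R) (x e : R) : {for x, continuous h} -> 0 < e ->
  exists2 dl, 0 < dl & forall y, `|y - x| < dl -> `|h y - h x| < e.
Proof.
move=> ch e0; have /cvgrPdist_lt/(_ _ e0)/nbhs_ballP[dl /= dl0 H] := ch.
exists dl => // y yx; rewrite distrC; apply: H.
by rewrite /ball/= distrC.
Qed.

Lemma count_lt_le (s : seq R) (x y : R) : x <= y ->
  (count (fun z => (z < x)%R) s <= count (fun z => (z < y)%R) s)%N.
Proof. by move=> xy; apply: sub_count => z /= /lt_le_trans; apply. Qed.

Lemma count_lt_lt (s : seq R) (x y : R) : x < y -> x \in s ->
  (count (fun z => (z < x)%R) s < count (fun z => (z < y)%R) s)%N.
Proof.
move=> xy; elim: s => // z s IH; rewrite inE => /orP[/eqP <-|xs] /=.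
  by rewrite ltxx xy add0n add1n ltnS count_lt_le// ltW.
have := IH xs; case: ltP => [zx|_]; first by rewrite (lt_trans zx xy) ltn_add2l.
by move=> /leq_trans; apply; exact: leq_addl.
Qed.

(* With [nu] the upper measure of [max(f, -M) + M] and [J x] the number of
   exceptional points before [x], the function
   [Phi x = nu ]a, x] - M (x - a) + e J x - h x] satisfies the local condition of
   [locally_right_nondecreasing]; at an exceptional point the jump of [e J]
   outweighs the oscillation of [h]. *)
Lemma derivative_integral_bounded (h f : R -> R) (a b M : R) (B : set R) :
  a < b -> 0 <= M -> continuous h -> finite_set (B `&` `[a, b]) ->
  mu.-integrable `[a, b] (EFin \o f) ->
  (forall x, a <= x <= b -> ~ B x -> is_derive x 1 h (f x)) ->
  ((h b - h a)%:E <= \int[mu]_(x in `[a, b]) (Num.max (f x) (- M))%:E)%E.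
Proof.
move=> ab M0 ch /finite_seqP[s Bs] intf dh.
set I : set R := `[a, b]%classic.
have mI : measurable I by exact: measurable_itv.
have muI : mu I = (b - a)%:E by rewrite /I lebesgue_measure_itv/= lte_fin ab.
have mf : measurable_fun I f by apply/measurable_EFinP; exact: measurable_int intf.
have mmax : measurable_fun I (fun x => Num.max (f x) (- M)) by exact: measurable_maxr.
have intmax : mu.-integrable I (fun x => (Num.max (f x) (- M))%:E).
  apply: le_integrable intf; [exact: mI|exact/measurable_EFinP|move=> x _].
  rewrite lee_fin; have [fM|fM] := leP (f x) (- M); last by [].
  by rewrite normrN (ger0_norm M0) ler_normr orbC lerNr fM.
pose G := fine (\int[mu]_(x in I) (Num.max (f x) (- M))%:E).
have GE : (\int[mu]_(x in I) (Num.max (f x) (- M))%:E)%E = G%:E.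
  by rewrite fineK// integrable_fin_num.
rewrite GE lee_fin.
suff main e : 0 < e -> h b - h a <= G + e * (b - a + 1 + (size s)%:R).
  apply/ler_addgt0Pr => e e0.
  have K0 : 0 < b - a + 1 + (size s)%:R.
    by rewrite ltr_wpDr// addr_gt0// subr_gt0.
  by have := main _ (divr_gt0 e0 K0); rewrite divfK// gt_eqF.
move=> e0.
pose g x := Num.max (f x) (- M) + M.
have mg : measurable_fun I g by apply: measurable_funD.
have g0 x : I x -> 0 <= g x.
  by move=> _; rewrite /g -[leLHS](addNr M) lerD2r le_max lexx orbT.
have Ioo : (mu I < +oo)%E by rewrite muI ltry.
have [nu [nuT nuV]] := lebesgue_upper_cover mI Ioo mg g0 e0.
have intg : (\int[mu]_(x in I) (g x)%:E = (G + M * (b - a))%:E)%E.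
  rewrite /g; under eq_integral do rewrite EFinD.
  rewrite integralD//; last first.
    apply/integrableP; split; first exact: measurable_cst.
    by rewrite integral_cst//= muI -EFinM ltry.
  by rewrite GE integral_cst//= muI.
have {}nuT : (nu setT <= (G + M * (b - a) + e * (b - a) + e)%:E)%E.
  by apply: (le_trans nuT); rewrite intg muI -EFinM -!EFinD.
have fin_nu A : measurable A -> nu A \is a fin_num.
  move=> mA; rewrite ge0_fin_numE//; apply: le_lt_trans (ltry (G + M * (b - a) + e * (b - a) + e)).
  apply: le_trans nuT; apply: le_measure => //.
  - exact: (mem_set mA).
  - by apply: mem_set; exact: measurableT.
pose N x := fine (nu `]a, x]%classic).
have mocitv x y : measurable (`]x, y]%classic : set R) by exact: measurable_itv.
have N_add x y : a <= x <= y -> N y = N x + fine (nu `]x, y]%classic).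
  move=> /andP[ax xy]; rewrite /N -fineD ?fin_nu// -measureU//; last first.
    apply/seteqP; split => z //= [] /=; rewrite !in_itv/= => /andP[_ zx] /andP[xz _].
    by move: xz; rewrite ltNge zx.
  congr (fine (nu _)); rewrite -itv_bndbnd_setU//.
have N_le x y : a <= x <= y -> N x <= N y.
  by move=> axy; rewrite (N_add _ _ axy) lerDl fine_ge0.
(* Points strictly before [x] are counted, so the jump comes immediately to the right of an
   exceptional point, where the condition to the right has to hold. *)
pose J x : R := (count (fun z => z < x) s)%:R.
have J_le x y : x <= y -> J x <= J y by move=> xy; rewrite ler_nat count_lt_le.
pose Phi x := N x - M * (x - a) + e * J x - h x.
have : Phi a <= Phi b.
  apply: locally_right_nondecreasing; first exact: ltW.
  - move=> x /andP[ax xb]; have [xs|xs] := boolP (x \in s).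
      have [dl dl0 Hdl] := continuous_near (ch x) (divr_gt0 e0 (ltr0n _ 2)).
      have M1 : 0 < 2 * (M + 1) by rewrite mulr_gt0// ltr_wpDl.
      (* Over this distance [h] and the term with [M] change by at most e / 2 each, while e J rises
         by at least e. *)
      exists (Num.min dl (e / (2 * (M + 1)))); first by rewrite lt_min dl0 divr_gt0.
      move=> y /andP[xy]; rewrite -ltrBlDl lt_min => /andP[yx1].
      rewrite ltr_pdivlMr// => yx2.
      have := Hdl y; rewrite gtr0_norm ?subr_gt0// => /(_ yx1).
      rewrite ltr_norml => /andP[_ hy].
      have Ny := N_le x y; rewrite ax (ltW xy) in Ny; have {}Ny := Ny isT.
      have Jy : J x + 1 <= J y by rewrite natr1 ler_nat count_lt_lt.
      have eJ : e * (J x + 1) <= e * J y by rewrite ler_pM2l.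
      have xy' : 0 < y - x by rewrite subr_gt0.
      rewrite /Phi; nra.
    have nBx : ~ B x.
      move=> Bx; have : (B `&` `[a, b]) x by split => //=; rewrite in_itv/= ax ltW.
      by rewrite Bs /= (negbTE xs).
    have axb : a <= x <= b by rewrite ax ltW.
    have [r [V [gr oV Vx HV]]] := nuV x axb.
    have fr : f x < r - M.
      by rewrite ltrBrDr; apply: le_lt_trans gr; rewrite /g lerD2r le_max lexx.
    have [e1 e10 He1] := is_derive_right_lt (dh _ axb nBx) fr.
    have /nbhs_ballP[e2 /= e20 He2] := open_nbhs_nbhs (conj oV Vx).
    exists (Num.min e1 e2); first by rewrite lt_min e10.
    move=> y /andP[xy]; rewrite -ltrBlDl lt_min => /andP[yx1 yx2].
    have := He1 y; rewrite xy -ltrBlDl yx1 => /(_ isT) hy.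
    have := HV _ (mocitv x y); rewrite /= lebesgue_measure_itv/= lte_fin xy -EFinB -EFinM.
    have xyV : `]x, y]%classic `<=` V.
      move=> z /=; rewrite in_itv/= => /andP[xz zy]; apply: He2.
      rewrite /ball/= distrC gtr0_norm ?subr_gt0//.
      by apply: le_lt_trans yx2; rewrite lerD2r.
    move=> /(_ xyV); rewrite -(fineK (fin_nu _ (mocitv x y))) lee_fin => Nxy.
    have -> : Phi y = N x + fine (nu `]x, y]%classic) - M * (y - a) + e * J y - h y.
      by rewrite /Phi (N_add x y)// ax ltW.
    have eJ : e * J x <= e * J y by rewrite ler_pM2l// J_le// ltW.
    rewrite /Phi; nra.
  (* [Phi] cannot drop when [x] is approached from the left: [N] and e J are nondecreasing and the
     other terms are continuous. A drop [gm] would have to fit into two changes, each less than gm /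
     2. *)
  - move=> x /andP[ax xb] Hy; rewrite leNgt; apply/negP => xa.
    pose gm := Phi a - Phi x.
    have gm0 : 0 < gm by rewrite subr_gt0.
    have [dl dl0 Hdl] := continuous_near (ch x) (divr_gt0 gm0 (ltr0n _ 2)).
    have M1 : 0 < 2 * (M + 1) by rewrite mulr_gt0// ltr_wpDl.
    pose e1 := Num.min dl (gm / (2 * (M + 1))).
    have e10 : 0 < e1 by rewrite lt_min dl0 divr_gt0.
    pose y := Num.max a (x - e1 / 2).
    have yx : y < x by rewrite gt_max ax ltrBlDr ltrDl divr_gt0.
    have ay : a <= y by rewrite le_max lexx.
    have yx1 : x - y < e1.
      rewrite ltrBlDr -ltrBlDl lt_max; apply/orP; right.
      by rewrite ltrD2l ltrN2 ltr_pdivrMr// ltr_pMr// ltr1n.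
    move: yx1; rewrite lt_min ltr_pdivlMr// => /andP[yx1 yx2].
    have := Hdl y; rewrite distrC gtr0_norm ?subr_gt0// => /(_ yx1).
    rewrite ltr_norml => /andP[hy _].
    have Py := Hy y; rewrite ay yx in Py; have {}Py := Py isT.
    have Ny := N_le y x; rewrite ay (ltW yx) in Ny; have {}Ny := Ny isT.
    have eJ : e * J y <= e * J x by rewrite ler_pM2l// J_le// ltW.
    have gmE : Phi a = gm + Phi x by rewrite /gm subrK.
    have xy' : 0 < x - y by rewrite subr_gt0.
    move: Py; rewrite gmE /Phi => Py; nra.
have Na : N a = 0 by rewrite /N set_itvoc0 measure0.
have Nb : N b <= G + M * (b - a) + e * (b - a) + e.
  rewrite -lee_fin fineK ?fin_nu//; apply: le_trans nuT; apply: le_measure => //.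
  - exact: (mem_set (mocitv a b)).
  - by apply: mem_set; exact: measurableT.
have Jb : e * J b <= e * (size s)%:R by rewrite ler_pM2l// ler_nat count_size.
have Ja : 0 <= e * J a by rewrite mulr_ge0// ltW.
rewrite /Phi Na subrr mulr0; nra.
Qed.

End derivative_integral.

Section fundamental_theorem.
Context {R : realType}.
Local Notation mu := (@lebesgue_measure R).

(** The truncation level tends to infinity; the truncated functions are dominated by |f|. *)
Lemma derivative_integral_le (h f : R -> R) (a b : R) (B : set R) :
  a < b -> continuous h -> finite_set (B `&` `[a, b]) ->
  mu.-integrable `[a, b] (EFin \o f) ->
  (forall x, a <= x <= b -> ~ B x -> is_derive x 1 h (f x)) ->
  ((h b - h a)%:E <= \int[mu]_(x in `[a, b]) (f x)%:E)%E.
Proof.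
move=> ab ch fB intf dh.
have mI : measurable (`[a, b]%classic : set R) by exact: measurable_itv.
have mf : measurable_fun `[a, b]%classic f by apply/measurable_EFinP; exact: measurable_int intf.
pose f_ n x := (Num.max (f x) (- n%:R))%:E.
have mf_ n : measurable_fun `[a, b]%classic (f_ n).
  by apply/measurable_EFinP; exact: measurable_maxr.
have cvg_f x : f_ n x @[n --> \oo] --> (f x)%:E.
  apply: cvg_near_cst; near=> n.
  rewrite /f_ max_l// lerNl; apply: le_trans (ler_norm _) _.
  by rewrite normrN; near: n; exact: nbhs_infty_ger.
have bnd n x : (`|f_ n x| <= `|(f x)%:E|)%E.
  rewrite lee_fin; have [fM|//] := leP (f x) (- n%:R).
  by rewrite normrN normr_nat ler_normr orbC lerNr fM.
have cvgI : (\int[mu]_(x in `[a, b]) f_ n x @[n --> \oo] --> \int[mu]_(x in `[a, b]) (f x)%:E)%E.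
  apply: (@dominated_cvg _ (measurableTypeR R) R mu _ mI f_ _ (fun x => `|(f x)%:E|)%E) => //.
  exact: integrable_abse.
apply: (cvge_to_ge cvgI); apply: nearW => n.
exact: (derivative_integral_bounded ab (ler0n _ n) ch fB intf dh).
Unshelve. all: by end_near. Qed.

(** The inequality is applied to [h] and to [- h]. It is a fundamental theorem of calculus for a
    derivative assumed integrable but not continuous. *)
Lemma derivative_integral (h f : R -> R) (a b : R) (B : set R) :
  a < b -> continuous h -> finite_set (B `&` `[a, b]) ->
  mu.-integrable `[a, b] (EFin \o f) ->
  (forall x, a <= x <= b -> ~ B x -> is_derive x 1 h (f x)) ->
  (\int[mu]_(x in `[a, b]) (f x)%:E = (h b - h a)%:E)%E.
Proof.
move=> ab ch fB intf dh; apply/eqP; rewrite eq_le; apply/andP; split; last first.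
  exact: (derivative_integral_le ab ch fB intf dh).
have intNf : mu.-integrable `[a, b] (EFin \o (fun x => - f x)).
  rewrite (_ : EFin \o _ = (fun x => - (EFin \o f) x)%E)//.
  exact: integrableN.
have chN : continuous (fun x => - h x) by move=> x; apply: cvgN; exact: ch.
have dhN x : a <= x <= b -> ~ B x -> is_derive x 1 (fun x => - h x) (- f x).
  by move=> axb Bx; have := dh x axb Bx => ?; exact: is_deriveN.
have := derivative_integral_le ab chN fB intNf dhN.
have -> : (\int[mu]_(x in `[a, b]) (- f x)%:E = - \int[mu]_(x in `[a, b]) (f x)%:E)%E.
  have := @integralZl _ (measurableTypeR R) R mu _ (measurable_itv `[a, b]) _ intf (-1).
  rewrite mulN1e => <-; apply: eq_integral => x _.
  by rewrite mulN1e.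
by rewrite -opprD EFinN leeN2.
Qed.

Lemma integral_derivative_eq0 (h f : R -> R) (B : set R) :
  continuous h -> (forall a b, finite_set (B `&` `[a, b])) ->
  mu.-integrable setT (EFin \o f) ->
  (forall x, ~ B x -> is_derive x 1 h (f x)) ->
  h n%:R @[n --> \oo] --> 0 -> h (- n%:R) @[n --> \oo] --> 0 ->
  (\int[mu]_x (f x)%:E = 0)%E.
Proof.
move=> ch fB intf dh hy hNy.
have mf : measurable_fun setT f by apply/measurable_EFinP; exact: measurable_int intf.
pose D n : set R := `[- n%:R, n%:R]%classic.
have mD n : measurable (D n) by exact: measurable_itv.
pose f_ n := (EFin \o f) \_ (D n).
have mf_ n : measurable_fun setT (f_ n).
  apply/(measurable_restrictT _ (mD n)); apply: (measurable_funS measurableT) => //.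
  exact/measurable_EFinP.
have cvgI : (\int[mu]_x f_ n x @[n --> \oo] --> \int[mu]_x (f x)%:E)%E.
  apply: (@dominated_cvg _ (measurableTypeR R) R mu _ measurableT f_ _ (fun x => `|(f x)%:E|)%E) => //.
  - move=> x _; apply: cvg_near_cst; near=> n.
    rewrite /f_ patchE mem_set// /D /= in_itv/= -ler_norml.
    by near: n; exact: nbhs_infty_ger.
  - exact: integrable_abse.
  - by move=> n x _; rewrite /f_ patchE; case: ifP => // _; rewrite abse0.
apply: (cvg_unique _ cvgI) => //.
have E : \forall n \near \oo, (h n%:R - h (- n%:R))%:E = (\int[mu]_x f_ n x)%E.
  near=> n; have n0 : (0 < n)%N by near: n; exact: nbhs_infty_gt.
  rewrite -integral_mkcond/=; apply/esym/(derivative_integral (B := B)) => //.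
    by rewrite gtrN// ltr0n.
  exact: integrableS intf.
apply: (@cvg_trans _ ((fun n => (h n%:R - h (- n%:R))%:E) @ \oo)).
  exact: near_eq_cvg E.
apply: cvg_EFin; first exact: nearW.
by rewrite -[0]subr0; exact: cvgB.
Unshelve. all: by end_near. Qed.

End fundamental_theorem.

(** * Integration by parts against a normal density *)

Section stein.
Context {R : realType}.
Local Notation mu := (@lebesgue_measure R).

Lemma is_derive_comp1 (f g : R -> R) (x df dg : R) :
  is_derive x 1 f df -> is_derive (f x) 1 g dg ->
  is_derive x 1 (g \o f) (dg * df).
Proof.
move=> [dfx fE] [dgx gE]; apply: DeriveDef; last first.
  by rewrite -derive1E (derive1_comp dfx dgx) !derive1E fE gE.
move: dfx dgx => /derivable1_diffP dfx /derivable1_diffP dgx.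
by apply/derivable1_diffP; exact: differentiable_comp.
Qed.

Variable s : R.
Hypothesis s0 : 0 < s.
Local Notation phi := (normal_pdf 0 s).

Let sn0 : s != 0. Proof. by rewrite gt_eqF. Qed.

Lemma is_derive_normal_pdf (x : R) : is_derive x 1 phi (- (x / s ^+ 2) * phi x).
Proof.
pose q : R -> R := (- (2 * s ^+ 2)^-1) \*: (id ^+ 2).
have -> : phi = normal_peak s \*: (expR \o q).
  apply/funext => y; rewrite normal_pdfE// /q /normal_fun/=; congr (_ * expR _).
  rewrite subr0 /GRing.scale/= exprfctE -mulr_natl mulNr [in RHS]mulNr.
  by rewrite mulrC.
have dq : is_derive x 1 q (- (x / s ^+ 2)).
  apply: is_derive_eq; rewrite /GRing.scale/=; field.
  exact: sn0.
have := is_derive_comp1 dq (is_derive_expR (q x)) => dexp.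
apply: is_derive_eq; rewrite /GRing.scale/= -[_ *: _]/(_ * _); ring.
Qed.

(** From exp v >= v at v = x^2 / (2 s^2). Quadratic decay is enough for the boundary terms, because
    it is set against a function of linear growth. *)
Let phi_le x : x != 0 -> phi x <= normal_peak s * (2 * s ^+ 2) / x ^+ 2.
Proof.
move=> x0; rewrite normal_pdfE// -mulrA ler_wpM2l ?normal_peak_ge0//.
have x20 : 0 < x ^+ 2 by rewrite exprn_even_gt0.
have s20 : 0 < 2 * s ^+ 2 by rewrite mulr_gt0// exprn_gt0.
rewrite /normal_fun subr0 mulNr expRN -mulr_natl -[leRHS]invf_div lef_pV2 ?posrE ?divr_gt0// ?expR_gt0//.
by apply: le_trans (expR_ge1Dx _); rewrite lerDr.
Qed.

(** The integrand times the density is the derivative of s^2 g phi, which tends to 0 at both ends.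
    Only the combination is assumed integrable, since that is what Fubini provides on almost every
    slice. *)
Lemma normal_stein (g : R -> R) (C : R) (B : set R) :
  continuous g -> (forall a b, finite_set (B `&` `[a, b])) ->
  (forall t, ~ B t -> derivable g t 1) ->
  (forall t, `|g t| <= C * `|t|) ->
  (normal_prob 0 s).-integrable setT
    (fun t => (s ^+ 2 * derive1 g t - t * g t)%:E) ->
  (\int[normal_prob 0 s]_t (s ^+ 2 * derive1 g t - t * g t)%:E = 0)%E.
Proof.
move=> cg fB dg gC /integrableP[mD iD].
set D := fun t => _ in mD iD *.
rewrite (integral_normal_prob mD iD).
have phi0 t : (0 <= (phi t)%:E)%E by rewrite lee_fin normal_pdf_ge0.
have mphi : measurable_fun [set: R] (EFin \o phi).
  by apply/measurable_EFinP; exact: measurable_normal_pdf.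
have iDphi : mu.-integrable setT (fun t => D t * (phi t)%:E)%E.
  apply/integrableP; split; first exact: emeasurable_funM.
  under eq_integral do rewrite abseM (gee0_abs (phi0 _)).
  rewrite -ge0_integral_normal_prob//; exact: measurableT_comp.
have cphi : continuous phi by exact: continuous_normal_pdf.
pose h t := s ^+ 2 * (g t * phi t).
have hb t : t != 0 -> `|h t| <= s ^+ 2 * C * (normal_peak s * (2 * s ^+ 2)) / `|t|.
  move=> t0; rewrite /h normrM (ger0_norm (sqr_ge0 s)) normrM (ger0_norm (normal_pdf_ge0 _ _ _)).
  rewrite -(mulrA (s ^+ 2) C) -(mulrA (s ^+ 2)) ler_pM2l ?exprn_gt0//.
  apply: (@le_trans _ _ (C * `|t| * (normal_peak s * (2 * s ^+ 2) / t ^+ 2))).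
    by apply: ler_pM => //; [exact: normal_pdf_ge0|exact: phi_le].
  rewrite -(real_normK (num_real t)) le_eqVlt; apply/orP; left; apply/eqP.
  by field; rewrite normr_eq0.
have C'0 : {C' : R | forall t, t != 0 -> `|h t| <= C' / `|t|} by eexists; exact: hb.
case: C'0 => C' {}hb.
have h_cvg (sg : R) : `|sg| = 1 -> h (sg * n%:R) @[n --> \oo] --> 0.
  move=> sg1; apply/cvgrPdist_le => e e0; near=> n.
  have n0 : 0 < n%:R :> R by near: n; exact: nbhs_infty_gtr.
  rewrite sub0r normrN; apply: le_trans (hb _ _) _.
    by apply: mulf_neq0; [rewrite -normr_gt0 sg1|rewrite gt_eqF].
  rewrite normrM sg1 mul1r gtr0_norm// ler_pdivrMr// mulrC -ler_pdivrMr//.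
  by near: n; exact: nbhs_infty_ger.
have hd t : ~ B t -> is_derive t 1 h ((s ^+ 2 * derive1 g t - t * g t) * phi t).
  move=> Bt; have dgt := dg _ Bt.
  have dg' : is_derive t 1 g (derive1 g t) by split => //; rewrite derive1E.
  have dphi := is_derive_normal_pdf t.
  rewrite (_ : h = (s ^+ 2) \*: (g * phi))//.
  apply: is_derive_eq; rewrite /GRing.scale/=; field.
  exact: sn0.
apply: (@integral_derivative_eq0 _ h (fun t => (s ^+ 2 * derive1 g t - t * g t) * phi t) B) => //.
- move=> t; apply: cvgM; first exact: cvg_cst.
  by apply: cvgM; [exact: cg|exact: cphi].
- by have := h_cvg 1 (normr1 _); under eq_fun do rewrite mul1r.
- have := h_cvg (-1); rewrite normrN normr1 => /(_ erefl).
  by under eq_fun do rewrite mulN1r.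
Unshelve. all: by end_near. Qed.

End stein.

(** * Measurability of a derivative in one coordinate *)

Section limit_along_rationals.
Context {R : realType}.

(* Restricting the Cauchy criterion to rational increments leaves countably many
   conditions, so that the set where the limit exists is measurable. *)
Definition rational_cauchy (q : R -> R) : Prop :=
  forall m : nat, exists n : nat, forall rs : rat * rat,
    0 < `|ratr rs.1 : R| < n.+1%:R^-1 -> 0 < `|ratr rs.2 : R| < n.+1%:R^-1 ->
    `|q (ratr rs.1) - q (ratr rs.2)| <= m.+1%:R^-1.

(** Continuity away from 0 carries a bound on rational increments over to all nonzero increments. *)
Lemma cvg_dnbhs_rationalP (q : R -> R) :
  (forall h, h != 0 -> {for h, continuous q}) ->
  cvg (q @ 0^') <-> rational_cauchy q.
Proof.
move=> cq; split.
  move=> /cvg_ex[l ql] m.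
  have m0 : 0 < m.+1%:R^-1 / 2 :> R by rewrite divr_gt0// invr_gt0.
  have /cvgrPdist_le/(_ _ m0)/nbhs_ballP[dl /= dl0 H] := ql.
  have [n nd] : exists n : nat, n.+1%:R^-1 < dl.
    have := near_infty_natSinv_lt (PosNum dl0).
    by move=> /filter_ex[n]; exists n.
  have Hq (r : R) : 0 < `|r| < n.+1%:R^-1 -> `|l - q r| <= m.+1%:R^-1 / 2.
    move=> /andP[r0 rn]; apply: H; last by rewrite -normr_gt0.
    by rewrite /ball/= sub0r normrN (lt_trans rn).
  exists n => -[r r'] /= /Hq lr /Hq lr'.
  rewrite (_ : _ - _ = (l - q (ratr r')) - (l - q (ratr r))); last by ring.
  apply: le_trans (ler_normB _ _) _.
  by rewrite [leRHS]splitr lerD.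
move=> qC; apply: cauchy_cvg; apply: cauchy_exP => e e0.
have [m me] : exists m : nat, m.+1%:R^-1 < e.
  by have := near_infty_natSinv_lt (PosNum e0) => /filter_ex[m]; exists m.
have [n Hn] := qC m.
have n0 : 0 < n.+1%:R^-1 :> R by rewrite invr_gt0.
have [r0 r0n] := rat_in_itvoo n0.
have r0n' : 0 < `|ratr r0 : R| < n.+1%:R^-1.
  by move: r0n; rewrite in_itv/= => /andP[a b]; rewrite gtr0_norm// a.
exists (q (ratr r0)); apply/nbhs_ballP; exists n.+1%:R^-1 => //= h.
rewrite /ball/= sub0r normrN => hn h0; apply: le_lt_trans me.
rewrite leNgt; apply/negP => gap.
pose e1 := `|q (ratr r0) - q h| - m.+1%:R^-1.
have e10 : 0 < e1 by rewrite subr_gt0.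
have /cvgrPdist_lt/(_ _ e10)/nbhs_ballP[d1 /= d10 Hd] := cq h h0.
(* A rational within [d2] of [h] satisfies three demands: [q] changes by less than the gap [e1], the
   rational is nonzero, and it stays inside the radius 1 / (n + 1). *)
pose d2 := Num.min d1 (Num.min `|h| (n.+1%:R^-1 - `|h|)).
have d20 : 0 < d2 by rewrite !lt_min d10 normr_gt0 h0 subr_gt0.
have [r] := @rat_in_itvoo R (h - d2) (h + d2) (ltac:(by rewrite ltrD2l gtrN)).
rewrite in_itv/= => /andP[hr rh].
have hrd : `|h - ratr r| < d2.
  by rewrite distrC ltr_distl hr rh.
have : `|h - ratr r| < d1 by apply: lt_le_trans hrd _; rewrite ge_min lexx.
move=> /Hd; rewrite /= => qhr.
have r1 : 0 < `|ratr r : R|.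
  rewrite normr_gt0; apply: contraTneq hrd => ->.
  by rewrite subr0 -leNgt !ge_min lexx orbT.
have r2 : `|ratr r : R| < n.+1%:R^-1.
  have : `|h - ratr r| < n.+1%:R^-1 - `|h|.
    by apply: lt_le_trans hrd _; rewrite !ge_min lexx !orbT.
  rewrite ltrBrDr; apply: le_lt_trans.
  rewrite -{1}(subrK h (ratr r)) distrC; exact: ler_normD.
have := Hn (r0, r) r0n'; rewrite /= r1 r2 => /(_ isT).
apply/negP; rewrite -ltNge.
rewrite -(ltrD2r (`|q h - q (ratr r)|)); apply: lt_le_trans (_ : `|q (ratr r0) - q h| <= _).
  by move: qhr; rewrite /e1 ltrBrDl.
by rewrite (_ : q (ratr r0) - q h = (q (ratr r0) - q (ratr r)) - (q h - q (ratr r))); [exact: ler_normB|ring].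
Qed.

(** The limit exists on a set cut out by countably many measurable conditions, and there it is the
    limit along the increments 1 / (n + 1). *)
Lemma measurable_lim_dnbhs d (T : measurableType d) (q : T -> R -> R) :
  (forall h, measurable_fun setT (q ^~ h)) ->
  (forall w h, h != 0 -> {for h, continuous (q w)}) ->
  measurable_fun setT (fun w => lim (q w @ 0^')).
Proof.
move=> mq cq.
pose close m (n : nat) (rs : rat * rat) : set T :=
  [set w | (0 < `|ratr rs.1 : R| < n.+1%:R^-1) ==> (0 < `|ratr rs.2 : R| < n.+1%:R^-1) ==>
    (`|q w (ratr rs.1) - q w (ratr rs.2)| <= m.+1%:R^-1)].
have mclose m n rs : measurable (close m n rs).
  rewrite /close; case: (0 < `|ratr rs.1 : R| < n.+1%:R^-1) => /=; last by rewrite (_ : mkset _ = setT) //; apply/seteqP.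
  case: (0 < `|ratr rs.2 : R| < n.+1%:R^-1) => /=; last by rewrite (_ : mkset _ = setT) //; apply/seteqP.
  rewrite -[X in measurable X]setTI; apply: measurable_fun_ler => //.
  apply: measurableT_comp => //; exact: measurable_funB.
pose A : set T := \bigcap_m \bigcup_n \bigcap_rs close m n rs.
have mA : measurable A.
  apply: bigcapT_measurable => m; apply: bigcupT_measurable => n.
  rewrite -[X in measurable X]setCK setC_bigcap; apply: measurableC.
  by apply: countable_bigcupT_measurable => // rs; exact: measurableC.
have AP w : A w <-> cvg (q w @ 0^').
  rewrite cvg_dnbhs_rationalP; last exact: cq.
  split => [Aw m|Aw m _].
    have [n _ Hn] := Aw m Logic.I; exists n => rs r1 r2.
    by have := Hn rs Logic.I; rewrite /close/= r1 r2.
  have [n Hn] := Aw m; exists n => // rs _; rewrite /close/=.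
  by apply/implyP => r1; apply/implyP => r2; exact: Hn.
(* Where the limit does not exist, [lim] takes the junk value [point]. *)
pose f_ (n : nat) w := \1_A w * q w n.+1%:R^-1 + \1_(~` A) w * (point : R).
apply: (@measurable_fun_cvg _ _ _ _ f_).
  move=> n; apply: measurable_funD; apply: measurable_funM.
  - exact: (measurable_indic mA).
  - exact: mq.
  - exact: (measurable_indic (measurableC mA)).
  - exact: measurable_cst.
move=> w _; have [wA|wA] := boolP (w \in A).
  under eq_fun do rewrite /f_ !indicE in_setC wA mul1r mul0r addr0.
  have /AP cw := set_mem wA.
  apply: (cvg_comp (fun n => n.+1%:R^-1 : R) (q w)); last exact: cw.
  move=> U /nbhs_ballP[e /= e0 He]; near=> n; apply: He => //=.
  rewrite /ball/= sub0r normrN ger0_norm//; near: n; exact: (near_infty_natSinv_lt (PosNum e0)).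
rewrite dvgP.
  under eq_fun do rewrite /f_ !indicE in_setC (negbTE wA) mul1r mul0r add0r.
  exact: cvg_cst.
by apply/AP => /mem_set; exact/negP.
Unshelve. all: by end_near. Qed.

End limit_along_rationals.

(** * Sign symmetry and Stein's identity in one coordinate of the data *)

Section independent_coordinate.
Context d (T : measurableType d) {R : realType} (P : probability T R).
Context {p : nat}.
Local Notation S := (p.-tuple R * p.-tuple R)%type.
Variables (X U : 'I_p -> T -> R).
Hypothesis mX : forall i, measurable_fun setT (X i).
Hypothesis mU : forall i, measurable_fun setT (U i).
Hypothesis iXU : mutually_independent P (data_family X U).
Variables (k : 'I_p) (s : R).
Hypothesis s0 : 0 < s.
Hypothesis lXk : has_law P (X k) (normal_prob 0 s).

Let sn0 : s != 0. Proof. by rewrite gt_eqF. Qed.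

Lemma has_law_normalN : has_law P (fun w => - X k w) (normal_prob 0 s).
Proof.
move=> A mA.
have mNA : measurable (-%R @^-1` A) by apply: measurable_preimage => //.
rewrite -[LHS]/(P (X k @^-1` (-%R @^-1` A))) lXk// -[normal_prob 0 s in RHS]normal_probN.
have nsn0 : - s != 0 by rewrite oppr_eq0.
rewrite (normal_prob_affine 0 sn0 mNA) (normal_prob_affine 0 nsn0 mA); congr (normal_prob 0 1 _).
by apply/seteqP; split => x /=; rewrite !addr0 mulNr.
Qed.

Lemma integral_odd_coordinate (H : S -> R) : measurable_fun setT H ->
  (forall z, H (set_data k z (- tnth z.1 k)) = - H z) ->
  P.-integrable setT (EFin \o H \o data X U) ->
  (\int[P]_w (H (data X U w))%:E = 0)%E.
Proof.
move=> mH oddH iH.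
pose X' i w := if i == k then - X i w else X i w.
have mX' i : measurable_fun setT (X' i).
  by rewrite /X'; case: (i == k) => //; exact: measurable_funN.
have iX' : mutually_independent P (data_family X' U).
  rewrite (_ : data_family X' U = fun i w => (if i == inl k then -%R else idfun)
      (data_family X U i w)); last first.
    apply/funext => -[i|i]; apply/funext => w //=.
    by rewrite -[inl i == inl k]/(i == k) /X'; case: ifP.
  apply: (mutually_independent_comp (g := fun i => if i == inl k then -%R else idfun)) => // i.
  by case: ifP => _; [exact: oppr_measurable|exact: measurable_id].
have lX' : has_law P (X' k) (normal_prob 0 s).
  rewrite (_ : X' k = fun w => - X k w); first exact: has_law_normalN.
  by apply/funext => w; rewrite /X' eqxx.
have dataX' w : data X' U w = set_data k (data X U w) (- tnth (data X U w).1 k).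
  congr (_, _); apply: eq_from_tnth => i; rewrite !tnth_mktuple /X'.
  by case: eqP => // ->.
have HX' w : H (data X' U w) = - H (data X U w) by rewrite dataX' oddH.
have mHE : measurable_fun setT (EFin \o H) by exact/measurable_EFinP.
have iH' : P.-integrable setT (EFin \o H \o data X' U).
  apply/integrableP; split; first by apply: (measurableT_comp mHE); exact: measurable_data.
  have /integrableP[_] := iH; congr (_ < _)%E.
  by apply: eq_integral => w _ /=; rewrite HX' normrN.
(* Resampling coordinate [k] overwrites the only coordinate in which the original and the flipped
   data differ, and it does so with the same law in both cases. *)
have E : (\int[P]_w (H (data X U w))%:E = \int[P]_w (H (data X' U w))%:E)%E.
  rewrite (resampling mX mU iXU lXk mHE iH) (resampling mX' mU iX' lX' mHE iH').
  apply: eq_integral => -[w t] _ /=; congr (H _)%:E.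
  congr (_, _); apply: eq_from_tnth => i; rewrite !tnth_mktuple /X'.
  by case: eqP.
have : (\int[P]_w (H (data X' U w))%:E = - \int[P]_w (H (data X U w))%:E)%E.
  have := integralZl measurableT iH (-1); rewrite mulN1e => <-.
  by apply: eq_integral => w _; rewrite HX' mulN1e.
rewrite -E.
have := integrable_fin_num measurableT iH; case: (\int[P]_w _)%E => //= r _.
by move=> /eqP; rewrite eqe -addr_eq0 -mulr2n mulrn_eq0/= => /eqP ->.
Qed.

Definition coord_derivative (G : S -> R) (z : S) : R :=
  derive1 (fun t => G (set_data k z t)) (tnth z.1 k).

Lemma set_data_set (z : S) (t t' : R) : set_data k (set_data k z t) t' = set_data k z t'.
Proof.
congr (_, _); apply: eq_from_tnth => i; rewrite !tnth_mktuple.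
by case: ifP => // ik; rewrite ?ik.
Qed.

Lemma tnth_set_data (z : S) (t : R) : tnth (set_data k z t).1 k = t.
Proof. by rewrite tnth_mktuple eqxx. Qed.

Lemma measurable_coord_derivative (G : S -> R) : measurable_fun setT G ->
  (forall z, continuous (fun t => G (set_data k z t))) ->
  measurable_fun setT (coord_derivative G).
Proof.
move=> mG cG; rewrite /coord_derivative /derive1.
have mk : measurable_fun setT (fun z : S => tnth z.1 k).
  exact: (measurableT_comp (measurable_tnth k) measurable_fst).
have mset (f : S -> R) : measurable_fun setT f ->
    measurable_fun setT (fun z => G (set_data k z (f z))).
  move=> mf; apply: (measurableT_comp mG).
  by apply: measurable_fun_pair => //; exact: measurable_set_coord.
apply: measurable_lim_dnbhs => [h|z h h0].
  apply: measurable_funM => //; apply: measurable_funB; apply: mset => //.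
  exact: measurable_funD.
have cGz : continuous (fun t => G (set_data k z t)) := cG z.
apply: cvgM; first exact: cvgV.
apply: cvgB; last exact: cvg_cst.
apply: (cvg_comp (fun h : R => h + tnth z.1 k) (fun t => G (set_data k z t))); last exact: cGz.
by apply: cvgD; [exact: cvg_id|exact: cvg_cst].
Qed.

(** Once coordinate [k] is resampled, Fubini leaves one-dimensional slices. Almost all of them have
    an integrable integrand, and on those [normal_stein] gives 0, the linear bound on [G] being its
    growth condition. *)
Lemma coordinate_stein (G : S -> R) (C : R) : measurable_fun setT G ->
  (forall z, piecewise_differentiable (fun t => G (set_data k z t))) ->
  (forall z, `|G z| <= C * `|tnth z.1 k|) ->
  P.-integrable setT (fun w => (X k w * G (data X U w))%:E) ->
  P.-integrable setT (fun w => (coord_derivative G (data X U w))%:E) ->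
  (\int[P]_w (X k w * G (data X U w))%:E =
   (s ^+ 2)%:E * \int[P]_w (coord_derivative G (data X U w))%:E)%E.
Proof.
move=> mG pG GC iXG iD.
have mD : measurable_fun setT (coord_derivative G).
  by apply: measurable_coord_derivative => // z; case: (pG z).
have mk : measurable_fun setT (fun z : S => tnth z.1 k).
  exact: (measurableT_comp (measurable_tnth k) measurable_fst).
pose H z := s ^+ 2 * coord_derivative G z - tnth z.1 k * G z.
have mH : measurable_fun setT (EFin \o H).
  by apply/measurable_EFinP; apply: measurable_funB; apply: measurable_funM.
have HE w : (EFin \o H \o data X U) w = ((s ^+ 2)%:E * (coord_derivative G (data X U w))%:E -
    (X k w * G (data X U w))%:E)%E.
  by rewrite /= /H tnth_mktuple.
have is2D : P.-integrable setT (fun w => (s ^+ 2)%:E * (coord_derivative G (data X U w))%:E)%E.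
  exact: integrableZl.
have iH : P.-integrable setT (EFin \o H \o data X U).
  by rewrite (funext HE); exact: integrableB.
suff : (\int[P]_w (EFin \o H \o data X U) w = 0)%E.
  under eq_integral do rewrite HE.
  rewrite integralB// integralZl// => /eqP; rewrite sube_eq ?add0e.
  - by move=> /eqP <-.
  - by rewrite fin_numM// integrable_fin_num.
  - exact: fin_num_adde_defr.
rewrite (resampling mX mU iXU lXk mH iH).
have iH2 := integrable_resampling mX mU iXU lXk mH iH.
rewrite -integral12_prod_meas1//.
have mF := measurable_int _ (integrable_fubini_F iH2).
rewrite (ae_eq_integral (cst 0%E)) ?integral0//.
have := ae_integrable1 iH2; apply: filterS => w /= iHw _.
rewrite /fubini_F.
have E t : ((EFin \o H) (set_data k (data X U w) t) =
    (s ^+ 2 * derive1 (fun t => G (set_data k (data X U w) t)) t -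
     t * G (set_data k (data X U w) t))%:E)%E.
  rewrite /= /H /coord_derivative tnth_set_data.
  have -> // : (fun t' => G (set_data k (set_data k (data X U w) t) t')) =
      (fun t' => G (set_data k (data X U w) t')).
  by apply/funext => t'; rewrite set_data_set.
pose g t := G (set_data k (data X U w) t).
transitivity (\int[normal_prob 0 s]_t (s ^+ 2 * derive1 g t - t * g t)%:E)%E.
  by apply: eq_integral => t _; exact: E.
have [cg [B [fB dB]]] := pG (data X U w).
apply: (normal_stein s0 cg fB dB (C := C)).
  by move=> t; have := GC (set_data k (data X U w) t); rewrite tnth_set_data.
rewrite (_ : (fun _ => _) = fun t => (EFin \o H) (set_data k (data X U w) t)) //.
by apply/funext => t; exact/esym/E.
Qed.

End independent_coordinate.

(** * The roots of Q and the orthogonal decomposition of the sample mean *)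

Section roots_of_Q.
Context {R : realType} {p : nat} (nu : 'I_p -> nat) (s2 : 'I_p -> R).
Hypothesis p_gt0 : (0 < p)%N.
Hypothesis nu_ge1 : forall i, (1 <= nu i)%N.
Hypothesis s2_gt0 : forall i, 0 < s2 i.
Hypothesis s2_inj : injective s2.

Let hornerXaddC (c v : R) : ('X + c%:P).[v] = v + c.
Proof. by rewrite hornerD hornerX hornerC. Qed.

Lemma horner_polyM v : (polyM s2).[v] = \prod_i (v + s2 i).
Proof. by rewrite horner_prod; apply: eq_bigr => i _; rewrite hornerXaddC. Qed.

Lemma horner_polyQ v :
  (polyQ nu s2).[v] = \sum_i (nu i)%:R * \prod_(k | k != i) (v + s2 k).
Proof.
rewrite horner_sum; apply: eq_bigr => i _; rewrite hornerZ horner_prod.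
by congr (_ * _); apply: eq_bigr => k _; rewrite hornerXaddC.
Qed.

Lemma polyQ_gt0 v : 0 <= v -> 0 < (polyQ nu s2).[v].
Proof.
move=> v0; rewrite horner_polyQ.
have pos i : 0 < (nu i)%:R * \prod_(k | k != i) (v + s2 k).
  by rewrite mulr_gt0 ?ltr0n// prodr_gt0// => k _; rewrite ltr_wpDl.
by rewrite (bigD1 (Ordinal p_gt0))//= ltr_pwDl// sumr_ge0// => i _; exact: ltW.
Qed.

Section root.
Variable t : R.
Hypothesis root_t : (polyQ nu s2).[- t] = 0.

Lemma root_gt0 : 0 < t.
Proof.
rewrite ltNge; apply/negP => t0; have := @polyQ_gt0 (- t).
by rewrite root_t ltxx oppr_ge0 => /(_ t0).
Qed.

(** At -s_i^2 only the i-th summand of Q survives, and it is nonzero because the s_k^2 are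
    distinct. *)
Lemma root_neq i : s2 i - t != 0.
Proof.
apply/negP => /eqP sit; have : (polyQ nu s2).[- t] != 0.
  rewrite horner_polyQ (bigD1 i)//= [X in _ + X]big1 => [|j ji]; last first.
    rewrite (bigD1 i) 1?eq_sym//= (_ : - t + s2 i = 0) ?mul0r ?mulr0//.
    by rewrite addrC.
  rewrite addr0 mulf_neq0 ?pnatr_eq0 -?lt0n//.
  apply/prodf_neq0 => k ki.
  rewrite addrC; apply: contraNneq ki => skt.
  by apply/eqP/s2_inj; move: sit skt => /eqP; rewrite subr_eq0 => /eqP -> /eqP; rewrite subr_eq0 => /eqP.
by rewrite root_t eqxx.
Qed.

Lemma root_polyM_neq0 : (polyM s2).[- t] != 0.
Proof.
rewrite horner_polyM; apply/prodf_neq0 => i _.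
by rewrite addrC root_neq.
Qed.

Let prodE i : \prod_(k | k != i) (- t + s2 k) = (polyM s2).[- t] / (s2 i - t).
Proof.
rewrite horner_polyM [in RHS](bigD1 i)//= [- t + s2 i]addrC mulrAC mulfV ?mul1r//.
exact: root_neq.
Qed.

(** The quotient Q(v) / M(v) is the sum of nu_i / (v + s_i^2). This identity and its derivative
    produce every orthogonality relation below. *)
Lemma root_partial_fractions : \sum_i (nu i)%:R / (s2 i - t) = 0.
Proof.
have := root_t; rewrite horner_polyQ.
under eq_bigr do rewrite prodE mulrCA.
rewrite -mulr_sumr => /eqP; rewrite mulf_eq0 (negbTE root_polyM_neq0)/=.
by move=> /eqP.
Qed.

(** Write Q = M F with F(v) the sum of nu_i / (v + s_i^2). At a root F vanishes, so Q' = M F'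
    there. *)
Lemma root_derivQ : (polyQ nu s2)^`().[- t] =
  - ((polyM s2).[- t] * \sum_i (nu i)%:R / (s2 i - t) ^+ 2).
Proof.
pose Pi i : {poly R} := \prod_(k | k != i) ('X + (s2 k)%:P).
have derPi i : (Pi i)^`().[- t] =
    (((polyM s2)^`()).[- t] - (polyM s2).[- t] / (s2 i - t)) / (s2 i - t).
  have : (polyM s2)^`() = (('X + (s2 i)%:P) * Pi i)^`() by rewrite /polyM (bigD1 i).
  rewrite derivM derivD derivX derivC addr0 mul1r => ->.
  rewrite hornerD hornerM hornerXaddC -prodE horner_prod.
  under eq_bigr do rewrite hornerXaddC.
  rewrite addrAC subrr add0r [- t + _]addrC mulrAC mulfV ?mul1r//.
  exact: root_neq.
rewrite /polyQ raddf_sum horner_sum /=.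
under eq_bigr => i _ do rewrite derivZ hornerZ -/(Pi i) derPi.
transitivity (((polyM s2)^`()).[- t] * (\sum_i (nu i)%:R / (s2 i - t)) -
    (polyM s2).[- t] * \sum_i (nu i)%:R / (s2 i - t) ^+ 2).
  rewrite !mulr_sumr -sumrB; apply: eq_bigr => i _; field.
  exact: root_neq.
by rewrite root_partial_fractions mulr0 sub0r.
Qed.

Lemma root_sum_gt0 : 0 < \sum_i (nu i)%:R / (s2 i - t) ^+ 2.
Proof.
have pos i : 0 < (nu i)%:R / (s2 i - t) ^+ 2.
  by rewrite divr_gt0 ?ltr0n// exprn_even_gt0//= root_neq.
by rewrite (bigD1 (Ordinal p_gt0))//= ltr_pwDl// sumr_ge0// => i _; exact: ltW.
Qed.

Lemma root_derivQ_neq0 : (polyQ nu s2)^`().[- t] != 0.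
Proof.
rewrite root_derivQ oppr_eq0 mulf_neq0 ?root_polyM_neq0// gt_eqF//.
exact: root_sum_gt0.
Qed.

End root.

Variable t2 : 'I_p.-1 -> R.
Hypothesis t2_roots : negated_roots_of_Q nu s2 t2.

Lemma negated_root j : (polyQ nu s2).[- t2 j] = 0.
Proof.
rewrite t2_roots hornerZ horner_prod (bigD1 j)//= hornerXaddC addNr.
by rewrite mul0r mulr0.
Qed.

(** A repeated entry would be a multiple root of Q, where Q' vanishes, contrary to
    [root_derivQ_neq0]. *)
Lemma negated_roots_inj : injective t2.
Proof.
move=> j k tjk; apply/eqP; apply: contraT => jk.
have := root_derivQ_neq0 (negated_root j); rewrite t2_roots derivZ hornerZ.
rewrite (bigD1 j)//= (bigD1 k) 1?eq_sym//= mulrA derivM derivM.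
rewrite !hornerE tjk addNr !(mul0r, mulr0, addr0, add0r).
by rewrite ?(mul0r, mulr0, addr0, add0r) eqxx.
Qed.

(** In this form b_j is visibly positive, and it is recognisable as the constant that normalises the
    coefficients nu_i / (s_i^2 - t_j^2). *)
Lemma coefbE j : coefb nu s2 t2 j = (\sum_i (nu i)%:R / (s2 i - t2 j) ^+ 2)^-1.
Proof.
rewrite /coefb root_derivQ ?negated_root// invrN mulrN opprK.
have M0 := root_polyM_neq0 (negated_root j).
by rewrite invfM mulrA mulfV ?mul1r.
Qed.

Lemma coefb_gt0 j : 0 < coefb nu s2 t2 j.
Proof. by rewrite coefbE invr_gt0 root_sum_gt0// negated_root. Qed.

Lemma coefAE i j :
  coefA nu s2 t2 i j = coefb nu s2 t2 j * ((nu i)%:R / (s2 i - t2 j)).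
Proof.
have Q0 := root_derivQ_neq0 (negated_root j).
have st := root_neq (negated_root j) i.
rewrite /coefA /coefb; field.
by rewrite Q0 st -(opprB (s2 i)) oppr_eq0 st.
Qed.

Lemma contrastE (x : 'I_p -> R) j : tnth (contrast nu s2 t2 x) j =
  Num.sqrt (coefb nu s2 t2 j) * \sum_i (nu i)%:R / (s2 i - t2 j) * x i.
Proof.
rewrite tnth_mktuple; under eq_bigr do rewrite coefAE -mulrA.
rewrite -mulr_sumr mulrA; congr (_ * _).
have b0 := coefb_gt0 j.
rewrite -[X in _ * X = _](sqr_sqrtr (ltW b0)) expr2 mulrA mulVf ?mul1r//.
by rewrite gt_eqF// sqrtr_gt0.
Qed.

End roots_of_Q.

(** * The orthogonal matrix behind the optimal estimator and the contrasts *)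

Section orthogonal_decomposition.
Context {R : realType} {m : nat} (nu : 'I_m.+1 -> nat) (s2 : 'I_m.+1 -> R).
Hypothesis nu_ge1 : forall i, (1 <= nu i)%N.
Hypothesis s2_gt0 : forall i, 0 < s2 i.
Hypothesis s2_inj : injective s2.
Variable t2 : 'I_m.+1.-1 -> R.
Hypothesis t2_roots : negated_roots_of_Q nu s2 t2.
Variable tau2 : R.
Hypothesis tau2_ge0 : 0 <= tau2.

Local Notation b := (coefb nu s2 t2).
Local Notation n i := ((nu i)%:R : R).
Definition obs_sd i := Num.sqrt ((tau2 + s2 i) / (nu i)%:R).
Local Notation sd := obs_sd.
Definition total_precision := \sum_i (nu i)%:R / (tau2 + s2 i).
Local Notation W := total_precision.

Let m_gt0 : (0 < m.+1)%N. Proof. by []. Qed.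
Let n_gt0 i : 0 < n i. Proof. by rewrite ltr0n. Qed.
Let n_neq0 i : n i != 0. Proof. by rewrite gt_eqF. Qed.
Let ts_gt0 i : 0 < tau2 + s2 i. Proof. by rewrite ltr_wpDl. Qed.
Let ts_neq0 i : tau2 + s2 i != 0. Proof. by rewrite gt_eqF. Qed.
Let rootj j := negated_root t2_roots j.
Let t2_gt0 j : 0 < t2 j. Proof. exact: (root_gt0 m_gt0 nu_ge1 s2_gt0 (rootj j)). Qed.
Let tt_gt0 j : 0 < tau2 + t2 j. Proof. by rewrite ltr_wpDl. Qed.
Let tt_neq0 j : tau2 + t2 j != 0. Proof. by rewrite gt_eqF. Qed.
Let st_neq0 i j : s2 i - t2 j != 0. Proof. exact: (root_neq nu_ge1 s2_inj (rootj j)). Qed.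
Let b_gt0 j : 0 < b j. Proof. exact: coefb_gt0. Qed.
Let b_neq0 j : b j != 0. Proof. by rewrite gt_eqF. Qed.

Lemma obs_sd_gt0 i : 0 < sd i.
Proof. by rewrite sqrtr_gt0 divr_gt0. Qed.

Let sd2 i : sd i ^+ 2 = (tau2 + s2 i) / n i.
Proof. by rewrite sqr_sqrtr//; apply/ltW/divr_gt0. Qed.

Let sd_neq0 i : sd i != 0. Proof. by rewrite gt_eqF// obs_sd_gt0. Qed.

Lemma total_precision_gt0 : 0 < W.
Proof.
rewrite /W big_ord_recl ltr_pwDl ?divr_gt0// sumr_ge0// => i _.
by rewrite ltW// divr_gt0.
Qed.

Let W_neq0 : W != 0. Proof. by rewrite gt_eqF// total_precision_gt0. Qed.
Local Notation rW := (Num.sqrt W).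
Let rW2 : rW ^+ 2 = W. Proof. by rewrite sqr_sqrtr// ltW// total_precision_gt0. Qed.
Let rW_neq0 : rW != 0. Proof. by rewrite gt_eqF// sqrtr_gt0 total_precision_gt0. Qed.
Local Notation rb j := (Num.sqrt (b j)).
Let rb2 j : rb j ^+ 2 = b j. Proof. by rewrite sqr_sqrtr// ltW. Qed.
Let rb_neq0 j : rb j != 0. Proof. by rewrite gt_eqF// sqrtr_gt0. Qed.
Local Notation rt j := (Num.sqrt (tau2 + t2 j)).
Let rt2 j : rt j ^+ 2 = tau2 + t2 j. Proof. by rewrite sqr_sqrtr// ltW. Qed.
Let rt_neq0 j : rt j != 0. Proof. by rewrite gt_eqF// sqrtr_gt0. Qed.

(** Its rows express the standardised [mu_opt] (row 0) and the standardised y_j (row j + 1) through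
    the standardised observations (x_k - mu) / sd_k. *)
Definition contrast_matrix : 'M[R]_m.+1 := \matrix_(i, k)
  if unlift ord0 i is Some j then
    Num.sqrt (coefb nu s2 t2 j) * ((nu k)%:R / (s2 k - t2 j) * sd k) / Num.sqrt (tau2 + t2 j)
  else (Num.sqrt W * sd k)^-1.
Local Notation O := contrast_matrix.

Lemma contrast_matrix0 k : O ord0 k = (rW * sd k)^-1.
Proof. by rewrite mxE unlift_none. Qed.

Lemma contrast_matrixS j k :
  O (lift ord0 j) k = rb j * (n k / (s2 k - t2 j) * sd k) / rt j.
Proof. by rewrite mxE liftK. Qed.

Let sum_root j : \sum_k n k / (s2 k - t2 j) = 0.
Proof. exact: (root_partial_fractions nu_ge1 s2_inj (rootj j)). Qed.

(** Split tau^2 + s_k^2 as (s_k^2 - t_j^2) + (tau^2 + t_j^2); the second part vanishes by partial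
    fractions. The value does not depend on [j], which is what makes different contrasts
    orthogonal. *)
Let sum_ts j : \sum_k n k * (tau2 + s2 k) / (s2 k - t2 j) = \sum_k n k.
Proof.
transitivity (\sum_k n k + (tau2 + t2 j) * \sum_k n k / (s2 k - t2 j)).
  rewrite mulr_sumr -big_split/=; apply: eq_bigr => k _; field.
  exact: st_neq0.
by rewrite sum_root mulr0 addr0.
Qed.

Let sum_sq j : \sum_k n k / (s2 k - t2 j) ^+ 2 = (b j)^-1.
Proof. by rewrite (coefbE nu_ge1 s2_inj)// invrK. Qed.

Let row00 : \sum_k O ord0 k * O ord0 k = 1.
Proof.
transitivity (\sum_k W^-1 * (n k / (tau2 + s2 k))).
  apply: eq_bigr => k _; rewrite contrast_matrix0 -expr2 exprVn exprMn rW2 sd2.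
  by rewrite invfM invf_div.
by rewrite -mulr_sumr mulVf.
Qed.

Let row0S j : \sum_k O ord0 k * O (lift ord0 j) k = 0.
Proof.
transitivity (\sum_k rb j / (rW * rt j) * (n k / (s2 k - t2 j))).
  apply: eq_bigr => k _; rewrite contrast_matrix0 contrast_matrixS; field.
  by rewrite rW_neq0 rt_neq0 sd_neq0 st_neq0.
by rewrite -mulr_sumr sum_root mulr0.
Qed.

(** For j = l the split of [sum_ts] leaves the sum of squares, which is 1 / b_j. For j <> l the
    product of the two denominators is separated by partial fractions into a difference of two sums,
    equal by [sum_ts]. *)
Let rowSS j l : \sum_k O (lift ord0 j) k * O (lift ord0 l) k = (j == l)%:R.
Proof.
transitivity (\sum_k rb j * rb l / (rt j * rt l) *
    (n k * (tau2 + s2 k) / ((s2 k - t2 j) * (s2 k - t2 l)))).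
  apply: eq_bigr => k _; rewrite !contrast_matrixS.
  transitivity (rb j * rb l / (rt j * rt l) *
     (n k ^+ 2 * sd k ^+ 2 / ((s2 k - t2 j) * (s2 k - t2 l)))).
    by field; rewrite !rt_neq0 !st_neq0.
  by rewrite sd2; field; rewrite !rt_neq0 !st_neq0 n_neq0.
rewrite -mulr_sumr; have [<-|jl] := eqVneq j l.
  transitivity (b j / (tau2 + t2 j) *
      (\sum_k n k / (s2 k - t2 j) + (tau2 + t2 j) * \sum_k n k / (s2 k - t2 j) ^+ 2)).
    rewrite -!expr2 rb2 rt2; congr (_ * _); rewrite mulr_sumr -big_split/=.
    by apply: eq_bigr => k _; field; rewrite st_neq0.
  rewrite sum_root sum_sq add0r (_ : true%:R = 1 :> R)//; field.
  by rewrite tt_neq0 b_neq0.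
have tjl : t2 j - t2 l != 0.
  rewrite subr_eq0; apply: contra jl => /eqP /(negated_roots_inj m_gt0 nu_ge1 s2_inj t2_roots) ->//.
rewrite [X in _ * X](_ : _ = (t2 j - t2 l)^-1 *
    (\sum_k n k * (tau2 + s2 k) / (s2 k - t2 j) - \sum_k n k * (tau2 + s2 k) / (s2 k - t2 l))).
  by rewrite !sum_ts subrr !mulr0.
rewrite -sumrB mulr_sumr; apply: eq_bigr => k _; field.
by rewrite tjl !st_neq0.
Qed.

(** Inner products of rows are the sums that partial fractions evaluate; for a square matrix a right
    inverse is a left inverse, which gives the columns. *)
Lemma contrast_matrix_orthonormal : orthonormal_cols O.
Proof.
have rows : O *m O^T = 1%:M.
  apply/matrixP => i k; rewrite !mxE; under eq_bigr do rewrite [_^T _ _]mxE.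
  have [j ->|->] := unliftP ord0 i; have [l ->|->] := unliftP ord0 k.
  - by rewrite rowSS (inj_eq lift_inj).
  - by under eq_bigr do rewrite mulrC; rewrite row0S lift_eqF.
  - by rewrite row0S eq_liftF.
  - by rewrite row00 eqxx.
have := mulmx1C rows => /matrixP cols j k.
have := cols j k; rewrite mxE [in RHS]mxE => <-.
by apply: eq_bigr => i _; rewrite [_^T _ _]mxE.
Qed.

Variables (x : 'I_m.+1 -> R) (mu : R).
Let z i := (x i - mu) / sd i.
Let Oz i := \sum_k O i k * z k.

Lemma mu_optE : mu_opt nu s2 tau2 x = mu + (Num.sqrt W)^-1 * Oz ord0.
Proof.
have -> : Oz ord0 = rW^-1 * \sum_k n k / (tau2 + s2 k) * (x k - mu).
  rewrite mulr_sumr; apply: eq_bigr => k _; rewrite contrast_matrix0 /z.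
  rewrite invfM -!mulrA; congr (_ * _).
  rewrite mulrCA -invfM -expr2 sd2 invf_div; ring.
rewrite mulrA -invfM -expr2 rW2 /mu_opt -[X in _ = X + _](mulKf W_neq0) -mulrDr mulrC.
congr (_ * _); rewrite /W mulr_suml -big_split/=.
apply: eq_bigr => k _. by field.
Qed.

Lemma contrast_OzE j : tnth (contrast nu s2 t2 x) j =
  Num.sqrt (tau2 + t2 j) * Oz (lift ord0 j).
Proof.
rewrite (contrastE m_gt0 nu_ge1 s2_inj t2_roots).
transitivity (rb j * \sum_k n k / (s2 k - t2 j) * (x k - mu)).
  congr (_ * _); under [RHS]eq_bigr do rewrite mulrBr.
  by rewrite sumrB -mulr_suml sum_root mul0r subr0.
rewrite !mulr_sumr; apply: eq_bigr => k _; rewrite contrast_matrixS /z; field.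
by rewrite rt_neq0 sd_neq0 st_neq0.
Qed.

(** The transpose inverts the transformation, so the standardised observations, and with them the
    sample mean, expand in the rows of the matrix. The coefficient of y_j is evaluated by
    [sum_ts]. *)
Lemma sample_mean_decomposition : sample_mean nu x = mu_opt nu s2 tau2 x +
  \sum_j Num.sqrt (coefb nu s2 t2 j) / (tau2 + t2 j) * tnth (contrast nu s2 t2 x) j.
Proof.
have N0 : \sum_k n k != 0.
  rewrite gt_eqF// big_ord_recl ltr_pwDl// sumr_ge0// => i _; exact: ltW.
have zE k : z k = \sum_i O i k * Oz i.
  have -> : \sum_i O i k * Oz i = \sum_l (\sum_i O i k * O i l) * z l.
    under eq_bigr do rewrite mulr_sumr; rewrite exchange_big/=.
    by apply: eq_bigr => l _; rewrite mulr_suml; apply: eq_bigr => i _; rewrite mulrA.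
  rewrite (bigD1 k)//= [X in _ + X]big1 ?addr0 => [|l lk].
    by rewrite contrast_matrix_orthonormal eqxx mul1r.
  by rewrite contrast_matrix_orthonormal eq_sym (negbTE lk) mul0r.
have -> : sample_mean nu x = mu + \sum_k (n k * sd k / \sum_k n k) * z k.
  rewrite /sample_mean natr_sum.
  have -> : \sum_k (n k * sd k / \sum_k n k) * z k = (\sum_k n k * (x k - mu)) / \sum_k n k.
    rewrite mulr_suml; apply: eq_bigr => k _; rewrite /z; field.
    by rewrite N0 sd_neq0.
  rewrite -[X in _ = X + _](mulfK N0) -mulrDl; congr (_ / _).
  by rewrite mulr_sumr -big_split/=; apply: eq_bigr => k _; ring.
rewrite mu_optE -addrA; congr (_ + _).
under eq_bigr do rewrite zE mulr_sumr.
rewrite exchange_big big_ord_recl/=; congr (_ + _).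
  under eq_bigr do rewrite mulrA; rewrite -mulr_suml; congr (_ * _).
  transitivity ((\sum_k n k)^-1 * rW^-1 * \sum_k n k).
    rewrite mulr_sumr; apply: eq_bigr => k _; rewrite contrast_matrix0; field.
    by rewrite N0 rW_neq0 sd_neq0.
  by rewrite mulrAC mulVf ?mul1r.
apply: eq_bigr => j _; under eq_bigr do rewrite mulrA; rewrite -mulr_suml contrast_OzE mulrA.
congr (_ * _); transitivity ((\sum_k n k)^-1 * (rb j / rt j) * \sum_k n k * (tau2 + s2 k) / (s2 k - t2 j)).
  rewrite mulr_sumr; apply: eq_bigr => k _; rewrite contrast_matrixS.
  transitivity ((\sum_k n k)^-1 * (rb j / rt j) * (n k ^+ 2 * sd k ^+ 2 / (s2 k - t2 j))).
    by field; rewrite N0 rt_neq0 st_neq0.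
  by rewrite sd2; field; rewrite N0 rt_neq0 st_neq0 n_neq0.
rewrite sum_ts -[X in _ = _ / X * _]rt2; field.
by rewrite N0 rt_neq0.
Qed.

End orthogonal_decomposition.

(** * Existence of the roots of Q, interlaced with the -s_i^2 *)

Section existence_of_roots.
Context {R : realType} {m : nat} (nu : 'I_m.+1 -> nat) (s2 : 'I_m.+1 -> R).
Hypothesis nu_ge1 : forall i, (1 <= nu i)%N.
Hypothesis s2_inj : injective s2.

Local Notation Q := (polyQ nu s2).

Let cofactorE i : \prod_(k | k != i) ('X + (s2 k)%:P) =
  \prod_(v <- [seq - s2 k | k <- enum (predC1 i)]) ('X - v%:P).
Proof.
rewrite big_map big_enum/=; apply: eq_bigr => k _.
by rewrite polyCN opprK.
Qed.

Let size_cofactor i : size (\prod_(k | k != i) ('X + (s2 k)%:P)) = m.+1.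
Proof. by rewrite cofactorE size_prod_XsubC size_map -cardE cardC1 card_ord. Qed.

(** The summands of Q have positive coefficients in degree p - 1, so these cannot cancel. *)
Lemma size_polyQ : size Q = m.+1.
Proof.
apply/eqP; rewrite eqn_leq; apply/andP; split.
  apply: leq_trans (size_sum _ _ _) _; apply/bigmax_leqP => i _.
  by apply: leq_trans (size_scale_leq _ _) _; rewrite size_cofactor.
rewrite ltnNge; apply/negP => /leq_sizeP/(_ m (leqnn m)).
rewrite coef_sum => /eqP; apply/negP.
have pos i : 0 < ((nu i)%:R *: \prod_(k | k != i) ('X + (s2 k)%:P))`_m.
  have := monic_prod_XsubC [seq - s2 k | k <- enum (predC1 i)] xpredT idfun.
  rewrite -cofactorE monicE lead_coefE size_cofactor/= => /eqP c1.
  by rewrite coefZ c1 mulr1 ltr0n.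
rewrite gt_eqF// big_ord_recl ltr_pwDl// sumr_ge0// => i _; exact: ltW.
Qed.

Let Q_at i : Q.[- s2 i] = (nu i)%:R * \prod_(k | k != i) (s2 k - s2 i).
Proof.
rewrite horner_polyQ (bigD1 i)//= [X in _ + X]big1 ?addr0 => [|j ji]; last first.
  by rewrite (bigD1 i) 1?eq_sym//= addNr mul0r mulr0.
by congr (_ * _); apply: eq_bigr => k _; rewrite addrC.
Qed.

(** Let s_j^2 be the next value after s_i^2. Each factor with k different from i and j has the same
    sign at both points, because no s_k^2 lies strictly between; the two remaining factors are
    opposite to each other. *)
Let sign_change i j : s2 i < s2 j -> (forall k, s2 i < s2 k -> s2 j <= s2 k) ->
  Q.[- s2 j] * Q.[- s2 i] < 0.
Proof.
move=> ij next; have ji : j != i by apply: contraTneq ij => ->; rewrite ltxx.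
rewrite !Q_at (bigD1 i) 1?eq_sym//= [X in _ * (_ * X)](bigD1 j)//=.
rewrite (eq_bigl (fun k => (k != i) && (k != j))); last by move=> k; rewrite andbC.
set A := \prod_(_ | _) _; set B := \prod_(_ | _) _.
have AB : 0 < A * B.
  rewrite /A /B -big_split/=; apply: prodr_gt0 => k /andP[ki kj].
  have [ik|ik] := ltP (s2 i) (s2 k).
    have := next k ik; rewrite le_eqVlt => /orP[/eqP/s2_inj/eqP|jk].
      by rewrite eq_sym (negbTE kj).
    by rewrite mulr_gt0 ?subr_gt0.
  rewrite nmulr_rgt0 ?subr_lt0; last exact: le_lt_trans ij.
  rewrite lt_neqAle ik andbT; apply: contra ki => /eqP/s2_inj ->//.
have : 0 < (nu i)%:R * (nu j)%:R * (s2 j - s2 i) ^+ 2 * (A * B).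
  rewrite mulr_gt0// mulr_gt0//; last by rewrite exprn_gt0// subr_gt0.
  by rewrite mulr_gt0 ?ltr0n.
by rewrite -oppr_lt0; congr (_ < _); ring.
Qed.

(** The intermediate value theorem gives a root between any two neighbouring -s_i^2, which already
    exhausts the degree. The inadmissibility claim is stated without the t_j^2, so there they have
    to be produced. *)
Lemma negated_roots_exist : exists t2 : 'I_m.+1.-1 -> R, negated_roots_of_Q nu s2 t2.
Proof.
(* Every index except that of the largest s_i^2 has a successor, so [lift im] indexes the p - 1
   gaps. *)
pose im := [arg max_(i > ord0) s2 i]%O.
have im_max k : s2 k <= s2 im by rewrite /im; case: arg_maxP => // i _; apply.
have ex j : exists t, [/\ Q.[- t] = 0, s2 (lift im j) < t &
    forall k, s2 (lift im j) < s2 k -> t < s2 k].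
  set i := lift im j.
  have im_gt : s2 i < s2 im.
    by rewrite lt_neqAle im_max andbT (inj_eq s2_inj) lift_eqF.
  pose nx := [arg min_(k < im | s2 i < s2 k) s2 k]%O.
  have [nx_gt nx_min] : s2 i < s2 nx /\ forall k, s2 i < s2 k -> s2 nx <= s2 k.
    by rewrite /nx; case: arg_minP.
  have [|v] := @polyrcf.poly_ivtoo _ Q (- s2 nx) (- s2 i) _ (sign_change nx_gt nx_min).
    by rewrite lerN2 ltW.
  rewrite in_itv/= => /andP[v1 v2] rv; exists (- v); split.
  - by rewrite opprK; apply/eqP.
  - by rewrite ltrNr.
  - by move=> k /nx_min; apply: lt_le_trans; rewrite ltrNl.
have [t2 t2P] := choice ex.
have lt_t j k : s2 (lift im j) < s2 (lift im k) -> t2 j < t2 k.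
  move=> jk; have [_ _ /(_ _ jk) tj] := t2P j; have [_ tk _] := t2P k.
  exact: lt_trans tk.
have t2_inj : injective t2.
  move=> j k tjk; have [jk|jk|] := ltgtP (s2 (lift im j)) (s2 (lift im k)).
  - by have := lt_t _ _ jk; rewrite tjk ltxx.
  - by have := lt_t _ _ jk; rewrite tjk ltxx.
  - by move=> /s2_inj /lift_inj.
exists t2; rewrite /negated_roots_of_Q.
have := @all_roots_prod_XsubC _ Q [seq - t2 j | j <- enum 'I_m].
rewrite size_polyQ size_map -cardE card_ord => /(_ erefl) QE.
rewrite {1}QE; last 2 first.
- by apply/allP => _ /mapP[j _ ->]; apply/eqP; have [] := t2P j.
- by rewrite uniq_rootsE map_inj_uniq ?enum_uniq// => j k /oppr_inj; exact: t2_inj.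
congr (_ *: _); rewrite big_map big_enum/=; apply: eq_bigr => j _.
by rewrite polyCN opprK.
Qed.

End existence_of_roots.

(** * Variance formulas *)

Section even_combinations.
Context d (T : measurableType d) {R : realType} (P : probability T R).
Context {p : nat}.
Local Notation S := (p.-tuple R * p.-tuple R)%type.
Local Notation mu := (@lebesgue_measure R).

(** Half of the Gaussian exponent absorbs t^2, since t^2 exp(- t^2 / (4 s^2)) <= 4 s^2 by exp v >=
    v. The other half is a normal density with standard deviation sqrt 2 s, up to the ratio of the
    peaks collected in [C]. *)
Lemma normal_integrable_sqr (s : R) : 0 < s ->
  (\int[normal_prob 0 s]_t (t ^+ 2)%:E < +oo)%E.
Proof.
move=> s0; have sn0 : s != 0 by rewrite gt_eqF.
pose r := Num.sqrt 2 * s.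
have r0 : r != 0 by rewrite mulf_neq0// gt_eqF// sqrtr_gt0.
have mpdf (v : R) : measurable_fun [set: R] (EFin \o normal_pdf 0 v).
  by apply/measurable_EFinP; exact: measurable_normal_pdf.
have msq : measurable_fun [set: R] (fun t : R => (t ^+ 2)%:E).
  by apply/measurable_EFinP; exact: exprn_measurable.
have m1 : measurable_fun [set: R] (fun t => (t ^+ 2)%:E * (normal_pdf 0 s t)%:E)%E.
  by apply: emeasurable_funM => //; exact: (mpdf s).
rewrite ge0_integral_normal_prob//; last by move=> t; rewrite lee_fin sqr_ge0.
pose C := 4 * s ^+ 2 * normal_peak s / normal_peak r.
have pk0 := normal_peak_gt0 r0.
have C0 : 0 <= C.
  by rewrite divr_ge0 ?normal_peak_ge0// mulr_ge0 ?normal_peak_ge0// mulr_ge0 ?sqr_ge0.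
have m2 : measurable_fun [set: R] (fun t => C%:E * (normal_pdf 0 r t)%:E)%E.
  by apply: emeasurable_funM => //; exact: (mpdf r).
apply: (@le_lt_trans _ _ (\int[mu]_t (C%:E * (normal_pdf 0 r t)%:E))%E); last first.
  rewrite ge0_integralZl//; [|exact: mpdf|by move=> t _; rewrite lee_fin normal_pdf_ge0].
  by rewrite integral_normal_pdf mule1 ltry.
apply: ge0_le_integral => //.
- by move=> t _; rewrite -EFinM lee_fin mulr_ge0 ?sqr_ge0 ?normal_pdf_ge0.
move=> t _; rewrite -!EFinM lee_fin !normal_pdfE// /normal_fun !subr0 /C.
rewrite [leRHS]mulrA mulfVK ?gt_eqF//.
have s20 : 0 < 4 * s ^+ 2 by rewrite mulr_gt0// exprn_gt0.
have -> : - t ^+ 2 / (s ^+ 2 *+ 2) = - t ^+ 2 / (4 * s ^+ 2) + - t ^+ 2 / (4 * s ^+ 2).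
  by rewrite -mulr_natl; field.
have -> : - t ^+ 2 / (r ^+ 2 *+ 2) = - t ^+ 2 / (4 * s ^+ 2).
  rewrite /r exprMn sqr_sqrtr// -mulr_natl; field.
  by [].
rewrite expRD mulrACA [_ * (_ * expR _)]mulrA.
have key : t ^+ 2 * expR (- t ^+ 2 / (4 * s ^+ 2)) <= 4 * s ^+ 2.
  rewrite mulNr expRN ler_pdivrMr ?expR_gt0// mulrC -ler_pdivrMr//.
  by apply: le_trans (expR_ge1Dx _); rewrite lerDr.
have : 0 <= normal_peak s * expR (- t ^+ 2 / (4 * s ^+ 2)).
  by rewrite mulr_ge0 ?normal_peak_ge0 ?expR_ge0.
move=> /ler_wpM2l/(_ _ _ key); congr (_ <= _); ring.
Qed.

Variables (X U : 'I_p -> T -> R).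
Hypothesis mX : forall i, measurable_fun setT (X i).
Hypothesis mU : forall i, measurable_fun setT (U i).
Hypothesis iXU : mutually_independent P (data_family X U).
Variable s : 'I_p -> R.
Hypothesis s0 : forall k, 0 < s k.
Hypothesis lX : forall k, has_law P (X k) (normal_prob 0 (s k)).

Lemma integrable_coord_sqr k : P.-integrable setT (fun w => (X k w ^+ 2)%:E).
Proof.
have msq : measurable_fun [set: R] (fun t : R => (t ^+ 2)%:E).
  by apply/measurable_EFinP; exact: exprn_measurable.
apply/integrableP; split; first exact: (measurableT_comp msq (mX k)).
under eq_integral => w _ do rewrite gee0_abs ?lee_fin ?sqr_ge0//.
rewrite -[X in (X < _)%E](@ge0_integral_pushforward _ _ _ _ R (X k : T -> measurableTypeR R) (mX k) P setT (fun t => (t ^+ 2)%:E))//; last first.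
  by move=> t _; rewrite lee_fin sqr_ge0.
apply: le_lt_trans (normal_integrable_sqr (s0 k)).
rewrite le_eqVlt; apply/orP; left; apply/eqP.
by apply: eq_measure_integral; [exact: mX|move=> ? A mA _; exact: lX].
Qed.

(** At most quadratic growth in the components: finite second moments make every such function
    integrable. *)
Definition moderate (f : T -> R) : Prop := measurable_fun setT f /\
  exists C, forall w, `|f w| <= C * (1 + \sum_k X k w ^+ 2).

Lemma moderate_integrable f : moderate f -> P.-integrable setT (EFin \o f).
Proof.
move=> [mf [C fC]].
have i1 : P.-integrable setT (fun w => (1 + \sum_k X k w ^+ 2)%:E).
  rewrite (_ : (fun _ => _) = (fun w => 1%:E + \sum_k (X k w ^+ 2)%:E)%E); last first.
    by apply/funext => w; rewrite /= sumEFin.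
  apply: integrableD => //; first exact: (finite_measure_integrable_cst P 1 measurableT).
  by apply: integrable_sum => // k _; exact: integrable_coord_sqr.
apply: (le_integrable measurableT _ _ (integrableZl measurableT C i1)).
  exact/measurable_EFinP.
move=> w _ /=; rewrite lee_fin; apply: le_trans (fC w) _.
by rewrite ler_norm.
Qed.

Section coefficients.
Variables (h : 'I_p -> S -> R) (K : R).
Hypothesis mh : forall k, measurable_fun setT (h k).
Hypothesis hK : forall k z, `|h k z| <= K.
Hypothesis h_even : forall k l z, h k (set_data l z (- tnth z.1 l)) = h k z.

Let V := data X U.
Let sumsq w := \sum_k X k w ^+ 2.

Let sqr_le k w : X k w ^+ 2 <= sumsq w.
Proof. by rewrite /sumsq (bigD1 k)//= lerDl sumr_ge0// => i _; exact: sqr_ge0. Qed.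

Let measurable_hV k : measurable_fun setT (fun w => h k (V w)).
Proof. by apply: (measurableT_comp (mh k)); exact: measurable_data. Qed.

Lemma moderate_coord_mul k : moderate (fun w => X k w * h k (V w)).
Proof.
split; first exact: measurable_funM.
exists K => w; rewrite normrM mulrC; apply: ler_pM => //.
have := sqr_le k w; have := sqr_ge0 (`|X k w| - 1).
rewrite -(real_normK (num_real (X k w))) -/(sumsq w); nra.
Qed.

Lemma moderate_coord_mul2 k l :
  moderate (fun w => (X k w * h k (V w)) * (X l w * h l (V w))).
Proof.
split; first by apply: measurable_funM; exact: measurable_funM.
exists (K ^+ 2) => w.
rewrite mulrACA normrM mulrC; apply: ler_pM => //.
  by rewrite normrM expr2; apply: ler_pM.
have := sqr_le k w; have := sqr_le l w; have := sqr_ge0 (`|X k w| - `|X l w|).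
rewrite normrM -(real_normK (num_real (X k w))) -(real_normK (num_real (X l w))) -/(sumsq w).
nra.
Qed.

Let D w := \sum_k X k w * h k (V w).

Lemma integral_even_sum : (\int[P]_w (D w)%:E = 0)%E.
Proof.
under eq_integral do rewrite /D -sumEFin.
rewrite integral_sum//; last by move=> k; exact/moderate_integrable/moderate_coord_mul.
rewrite big1// => k _.
have iH := moderate_integrable (moderate_coord_mul k).
pose H (z : S) := tnth z.1 k * h k z.
transitivity (\int[P]_w (H (data X U w))%:E)%E.
  by apply: eq_integral => w _; rewrite /H tnth_mktuple.
apply: (integral_odd_coordinate mX mU iXU (s0 k) (lX k) (H := H)).
- apply: measurable_funM => //.
  exact: (measurableT_comp (measurable_tnth k) measurable_fst).
- by move=> z; rewrite /H h_even tnth_set_data mulNr.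
- rewrite (_ : _ \o _ = EFin \o (fun w => X k w * h k (V w)))//.
  by apply/funext => w /=; rewrite /H tnth_mktuple.
Qed.

Lemma integral_even_sum_sqr : (\int[P]_w (D w ^+ 2)%:E =
  \sum_k \int[P]_w (X k w ^+ 2 * h k (V w) ^+ 2)%:E)%E.
Proof.
transitivity (\int[P]_w (\sum_k \sum_l ((X k w * h k (V w)) * (X l w * h l (V w)))%:E))%E.
  apply: eq_integral => w _; rewrite expr2 /D mulr_suml -sumEFin.
  by apply: eq_bigr => k _; rewrite mulr_sumr -sumEFin.
have int2 k l := moderate_integrable (moderate_coord_mul2 k l).
rewrite integral_sum//; last by move=> k; apply: integrable_sum => // l _; exact: int2.
apply: eq_bigr => k _; rewrite integral_sum//; last by move=> l; exact: int2.
rewrite (bigD1 k)//= big1 ?adde0 => [|l lk].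
  by apply: eq_integral => w _; congr (_%:E); ring.
pose H (z : S) := (tnth z.1 k * h k z) * (tnth z.1 l * h l z).
have mk i : measurable_fun setT (fun z : S => tnth z.1 i).
  exact: (measurableT_comp (measurable_tnth i) measurable_fst).
transitivity (\int[P]_w (H (data X U w))%:E)%E.
  by apply: eq_integral => w _; rewrite /H !tnth_mktuple.
apply: (integral_odd_coordinate mX mU iXU (s0 k) (lX k) (H := H)).
- by apply: measurable_funM; apply: measurable_funM.
- move=> z; rewrite /H !h_even tnth_set_data [in tnth _ l]/set_data/= tnth_mktuple (negbTE lk).
  by rewrite !mulNr.
- rewrite (_ : _ \o _ = EFin \o (fun w => (X k w * h k (V w)) * (X l w * h l (V w))))//.
  by apply/funext => w /=; rewrite /H !tnth_mktuple.
Qed.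

Lemma moderate_even_sum : moderate D.
Proof.
split; first by apply: measurable_sum => k; exact: measurable_funM.
exists (p%:R * K) => w; rewrite -/(sumsq w).
apply: le_trans (ler_norm_sum _ _ _) _.
apply: (@le_trans _ _ (\sum_(k < p) K * (1 + sumsq w))); last first.
  by rewrite sumr_const card_ord -[leLHS]mulr_natl -mulrA.
apply: ler_sum => k _; rewrite normrM mulrC; apply: ler_pM => //.
have := sqr_le k w; have := sqr_ge0 (`|X k w| - 1).
rewrite -(real_normK (num_real (X k w))); nra.
Qed.

Lemma expectation_even_sum c : ('E_P[fun w => (c + D w)%R] = c%:E)%E.
Proof.
rewrite unlock; under eq_integral do rewrite EFinD.
rewrite integralD//; last 2 first.
- exact: (finite_measure_integrable_cst P c measurableT).
- exact: (moderate_integrable moderate_even_sum).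
by rewrite integral_even_sum adde0 -[RHS](expectation_cst P c) unlock.
Qed.

Lemma variance_even_sum c : ('V_P[fun w => (c + D w)%R] =
  \sum_k 'E_P[fun w => (X k w ^+ 2 * h k (V w) ^+ 2)%R])%E.
Proof.
rewrite /variance (unlock covariance_unlockable) expectation_even_sum.
under [RHS]eq_bigr do rewrite unlock.
rewrite unlock -integral_even_sum_sqr; apply: eq_integral => w _.
congr (_%:E); rewrite -[LHS]/((c + D w - c) * (c + D w - c)); ring.
Qed.

End coefficients.

End even_combinations.

(** * The estimator expressed through independent components *)

Section model.
Context {R : realType} {m : nat} (nu : 'I_m.+1 -> nat) (s2 : 'I_m.+1 -> R).
Hypothesis nu_ge1 : forall i, (1 <= nu i)%N.
Hypothesis s2_gt0 : forall i, 0 < s2 i.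
Hypothesis s2_inj : injective s2.
Variable t2 : 'I_m.+1.-1 -> R.
Hypothesis t2_roots : negated_roots_of_Q nu s2 t2.
Context d (T : measurableType d) (P : probability T R).
Variables (mu tau2 : R) (x u2 : 'I_m.+1 -> T -> R).
Hypothesis tau2_ge0 : 0 <= tau2.
Hypothesis model : random_effects_model nu s2 P mu tau2 x u2.

Local Notation S := (m.+1.-tuple R * m.+1.-tuple R)%type.
Local Notation b := (coefb nu s2 t2).
Local Notation sd := (obs_sd nu s2 tau2).
Local Notation rW := (Num.sqrt (total_precision nu s2 tau2)).

Let m_gt0 : (0 < m.+1)%N. Proof. by []. Qed.

Let t2_gt0 j : 0 < t2 j.
Proof. exact: (root_gt0 m_gt0 nu_ge1 s2_gt0 (negated_root t2_roots j)). Qed.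
Let tt_gt0 j : 0 < tau2 + t2 j. Proof. by rewrite ltr_wpDl. Qed.
Let b_gt0 j : 0 < b j. Proof. exact: coefb_gt0. Qed.
Let sd_gt0 i : 0 < sd i. Proof. exact: obs_sd_gt0. Qed.
Let rW_gt0 : 0 < rW. Proof. by rewrite sqrtr_gt0 total_precision_gt0. Qed.

Let z i w := (x i w - mu) / sd i.

(** Component 0 stays standardised, the scale of [mu_opt] being kept as the separate factor [rW^-1];
    the other components are the y_j themselves. *)
Definition component_sd (k : 'I_m.+1) : R :=
  if unlift ord0 k is Some j then Num.sqrt (tau2 + t2 j) else 1.

Definition component (k : 'I_m.+1) (w : T) : R :=
  component_sd k * linear_combinations z (contrast_matrix nu s2 t2 tau2) k w.
Local Notation Y := component.

Lemma component_sd_gt0 k : 0 < component_sd k.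
Proof. by rewrite /component_sd; case: unliftP => [j _|_] //; rewrite sqrtr_gt0. Qed.

Let mz i : measurable_fun setT (z i).
Proof.
apply: measurable_funM => //; apply: measurable_funB => //.
exact: (rem_measurable_x model).
Qed.

Let izu : mutually_independent P (data_family z u2).
Proof.
pose g (k : 'I_m.+1 + 'I_m.+1) : R -> R :=
  match k with inl i => fun v => (v - mu) / sd i | inr _ => idfun end.
rewrite (_ : data_family z u2 = fun k w => g k (data_family x u2 k w)); last first.
  by apply/funext => -[i|i].
apply: mutually_independent_comp; last exact: (rem_independent model).
by move=> [i|i] /=; [apply: measurable_funM => //; exact: measurable_funB|exact: measurable_id].
Qed.

Let lz i : has_law P (z i) (normal_prob 0 1).
Proof.
apply: has_law_normal_standardize; first by rewrite gt_eqF.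
exact: (rem_law_x model).
Qed.

Let orthogonal := orthogonal_independent mz (rem_measurable_u2 model) izu lz
  (contrast_matrix_orthonormal nu_ge1 s2_gt0 s2_inj t2_roots tau2_ge0).

Lemma measurable_component k : measurable_fun setT (Y k).
Proof. by apply: measurable_funM => //; exact: measurable_linear_combinations. Qed.

Lemma independent_components : mutually_independent P (data_family Y u2).
Proof.
pose g (k : 'I_m.+1 + 'I_m.+1) : R -> R :=
  match k with inl i => fun v => component_sd i * v | inr _ => idfun end.
rewrite (_ : data_family Y u2 = fun k w => g k (data_family
    (linear_combinations z (contrast_matrix nu s2 t2 tau2)) u2 k w)); last first.
  by apply/funext => -[i|i].
apply: mutually_independent_comp; last exact: orthogonal.1.
by move=> [i|i] /=; [exact: measurable_funM|exact: measurable_id].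
Qed.

Lemma has_law_component k : has_law P (Y k) (normal_prob 0 (component_sd k)).
Proof.
apply: has_law_normal_scale; first by rewrite gt_eqF// component_sd_gt0.
exact: orthogonal.2.
Qed.

Lemma contrast_component w j :
  tnth (contrast nu s2 t2 (fun i => x i w)) j = Y (lift ord0 j) w.
Proof.
rewrite (contrast_OzE nu_ge1 s2_gt0 s2_inj t2_roots tau2_ge0 _ mu).
by rewrite /component /component_sd liftK.
Qed.

Lemma mu_opt_component w :
  mu_opt nu s2 tau2 (fun i => x i w) = mu + rW^-1 * Y ord0 w.
Proof.
rewrite (mu_optE nu_ge1 s2_gt0 t2 tau2_ge0 _ mu).
by rewrite /component /component_sd unlift_none mul1r.
Qed.

Definition contrast_part (v : S) : m.+1.-1.-tuple R :=
  [tuple tnth v.1 (lift ord0 j) | j < m.+1.-1].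

(** [shrinkage_weights] bounds the weights only at nonnegative u, whereas the results on even
    coefficients ask for bounds on the whole sample space. Absolute values bridge this and change
    nothing on the data, where [u2] is nonnegative. *)
Definition abs_tuple (u : m.+1.-tuple R) : m.+1.-tuple R :=
  [tuple `|tnth u i| | i < m.+1].

Lemma measurable_contrast_part : measurable_fun setT contrast_part.
Proof.
apply/measurable_fun_tnthP => j.
rewrite [Z in measurable_fun _ Z](_ : _ = fun v : S => tnth v.1 (lift ord0 j)).
  exact: (measurableT_comp (measurable_tnth _) measurable_fst).
by apply/funext => v /=; rewrite tnth_mktuple.
Qed.

Lemma measurable_abs_tuple : measurable_fun setT abs_tuple.
Proof.
apply/measurable_fun_tnthP => i.
rewrite [Z in measurable_fun _ Z](_ : _ = fun u : m.+1.-tuple R => `|tnth u i|).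
  by apply: measurableT_comp => //; exact: measurable_tnth.
by apply/funext => v /=; rewrite tnth_mktuple.
Qed.

Lemma measurable_squares n : measurable_fun setT (@squares R n).
Proof.
apply/measurable_fun_tnthP => i.
rewrite [Z in measurable_fun _ Z](_ : _ = fun u : n.-tuple R => tnth u i ^+ 2).
  by apply: measurable_funX; exact: measurable_tnth.
by apply/funext => v /=; rewrite tnth_mktuple.
Qed.

Lemma contrast_part_data w :
  contrast_part (data Y u2 w) = contrast nu s2 t2 (fun i => x i w).
Proof.
by apply: eq_from_tnth => j; rewrite contrast_component !tnth_mktuple.
Qed.

Lemma abs_tuple_data w : abs_tuple (data Y u2 w).2 = [tuple u2 i w | i < m.+1].
Proof.
apply: eq_from_tnth => i; rewrite !tnth_mktuple ger0_norm//.
exact: (rem_u2_ge0 model).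
Qed.

Lemma squares_contrast_part_opp l (v : S) :
  squares (contrast_part (set_data l v (- tnth v.1 l))) = squares (contrast_part v).
Proof.
apply: eq_from_tnth => j; rewrite !tnth_mktuple.
by case: eqP => [->|//]; rewrite sqrrN.
Qed.

Lemma contrast_part_set (v : S) j t :
  contrast_part (set_data (lift ord0 j) v t) = set_coord (contrast_part v) j t.
Proof.
by apply: eq_from_tnth => i; rewrite !tnth_mktuple (inj_eq lift_inj).
Qed.

Lemma variance_mu_opt :
  ('V_P[fun w => mu_opt nu s2 tau2 (fun i => x i w)] =
   'E_P[fun w => (Y ord0 w ^+ 2 * rW^-1 ^+ 2)%R])%E.
Proof.
pose h (k : 'I_m.+1) (_ : S) : R := if k == ord0 then rW^-1 else 0.
have mh k : measurable_fun setT (h k) by exact: measurable_cst.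
have hK k v : `|h k v| <= rW^-1.
  have r0 : 0 < rW^-1 by rewrite invr_gt0.
  by rewrite /h; case: ifP => _; [rewrite gtr0_norm|rewrite normr0 ltW].
have h_even k l v : h k (set_data l v (- tnth v.1 l)) = h k v by [].
have E w : mu_opt nu s2 tau2 (fun i => x i w) =
    mu + \sum_k Y k w * h k (data Y u2 w).
  rewrite mu_opt_component big_ord_recl big1 ?addr0 => [|i _].
    by rewrite /h eqxx mulrC.
  by rewrite /h mulr0.
rewrite (funext E) (variance_even_sum measurable_component (rem_measurable_u2 model)
  independent_components component_sd_gt0 has_law_component mh hK h_even).
rewrite big_ord_recl big1 ?adde0 => [|i _].
  by congr expectation; apply/funext => w; rewrite /h eqxx.
rewrite unlock integral0_eq// => w _.
by rewrite /h expr0n mulr0.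
Qed.

Section weights.
Variable wt : 'I_m.+1.-1 -> m.+1.-1.-tuple R * m.+1.-tuple R -> R.
Hypothesis mwt : forall j, measurable_fun setT (wt j).
Hypothesis wt_bounds : forall j a u, nonneg a -> nonneg u ->
  0 <= wt j (a, u) <= (t2 j)^-1.

Definition weight_at j (v : S) : R :=
  wt j (squares (contrast_part v), abs_tuple v.2).

Lemma measurable_weight_at j : measurable_fun setT (weight_at j).
Proof.
apply: (measurableT_comp (mwt j)); apply: measurable_fun_pair.
  exact: (measurableT_comp (@measurable_squares _) measurable_contrast_part).
exact: (measurableT_comp measurable_abs_tuple measurable_snd).
Qed.

Lemma weight_at_bounds j v : 0 <= weight_at j v <= (t2 j)^-1.
Proof.
apply: wt_bounds => i; first by rewrite tnth_mktuple sqr_ge0.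
by rewrite tnth_mktuple.
Qed.

Lemma weight_at_opp j l (v : S) :
  weight_at j (set_data l v (- tnth v.1 l)) = weight_at j v.
Proof. by rewrite /weight_at squares_contrast_part_opp. Qed.

Lemma weight_at_data j w : weight_at j (data Y u2 w) =
  wt j (squares (contrast nu s2 t2 (fun i => x i w)), [tuple u2 i w | i < m.+1]).
Proof. by rewrite /weight_at contrast_part_data abs_tuple_data. Qed.

(** Coefficients of delta - mu in the components. They depend on y only through squares, hence are
    even in each component. *)
Definition error_coef (k : 'I_m.+1) (v : S) : R :=
  if unlift ord0 k is Some j then
    Num.sqrt (b j) * ((tau2 + t2 j)^-1 - weight_at j v)
  else rW^-1.

Let bound := rW^-1 + \sum_j Num.sqrt (b j) * ((tau2 + t2 j)^-1 + (t2 j)^-1).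

Let measurable_error_coef k : measurable_fun setT (error_coef k).
Proof.
rewrite /error_coef; case: unliftP => [j _|_] //.
apply: measurable_funM => //; apply: measurable_funB => //.
exact: measurable_weight_at.
Qed.

Let error_coef_bound k v : `|error_coef k v| <= bound.
Proof.
have t0 j : 0 <= Num.sqrt (b j) * ((tau2 + t2 j)^-1 + (t2 j)^-1).
  by rewrite mulr_ge0 ?sqrtr_ge0// addr_ge0// invr_ge0 ltW.
rewrite /error_coef /bound; case: unliftP => [j _|_]; last first.
  rewrite ger0_norm; last by rewrite invr_ge0 ltW.
  by rewrite lerDl; apply: sumr_ge0 => j _; exact: t0.
rewrite normrM (ger0_norm (sqrtr_ge0 _)) (bigD1 j)//=.
apply: (@le_trans _ _ (Num.sqrt (b j) * ((tau2 + t2 j)^-1 + (t2 j)^-1))); last first.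
  have s0 : 0 <= \sum_(i | i != j) Num.sqrt (b i) * ((tau2 + t2 i)^-1 + (t2 i)^-1).
    by apply: sumr_ge0 => i _; exact: t0.
  have r0 : 0 < rW^-1 by rewrite invr_gt0.
  by move: s0 r0; set A := \sum_(_ | _) _; set B := _ * _; lra.
rewrite ler_wpM2l ?sqrtr_ge0//; have /andP[w0 w1] := weight_at_bounds j v.
have r0 : 0 < (tau2 + t2 j)^-1 by rewrite invr_gt0.
rewrite ler_norml; apply/andP; split; lra.
Qed.

Let error_coef_even k l v :
  error_coef k (set_data l v (- tnth v.1 l)) = error_coef k v.
Proof. by rewrite /error_coef; case: unliftP => // j _; rewrite weight_at_opp. Qed.

Lemma estimator_component w :
  shrinkage_estimator nu s2 t2 wt (data x u2 w) =
  mu + \sum_k Y k w * error_coef k (data Y u2 w).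
Proof.
rewrite /shrinkage_estimator /= (_ : tnth [tuple x i w | i < m.+1] = fun i => x i w); last first.
  by apply/funext => i; rewrite tnth_mktuple.
rewrite (sample_mean_decomposition nu_ge1 s2_gt0 s2_inj t2_roots tau2_ge0 _ mu).
rewrite mu_opt_component big_ord_recl -!addrA; congr (_ + _).
rewrite {1}/error_coef unlift_none mulrC; congr (_ + _).
rewrite -sumrB; apply: eq_bigr => j _; rewrite contrast_component.
rewrite /error_coef liftK weight_at_data; ring.
Qed.

Lemma expectation_estimator :
  ('E_P[fun w => shrinkage_estimator nu s2 t2 wt (data x u2 w)] = mu%:E)%E.
Proof.
rewrite (funext estimator_component).
exact: (expectation_even_sum measurable_component (rem_measurable_u2 model)
  independent_components component_sd_gt0 has_law_component
  measurable_error_coef error_coef_bound error_coef_even).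
Qed.

Lemma integrable_sqr_contrast j (g : S -> R) (C : R) : measurable_fun setT g ->
  (forall v, `|g v| <= C) ->
  P.-integrable setT (fun w => (Y (lift ord0 j) w ^+ 2 * g (data Y u2 w))%:E).
Proof.
move=> mg gC.
apply: (moderate_integrable measurable_component component_sd_gt0 has_law_component (f := fun w => _)).
split.
  apply: measurable_funM; first by apply: measurable_funX; exact: measurable_component.
  apply: (measurableT_comp mg); apply: measurable_data; first exact: measurable_component.
  exact: (rem_measurable_u2 model).
exists C => w; rewrite normrM mulrC; apply: ler_pM => //.
rewrite ger0_norm ?sqr_ge0// (bigD1 (lift ord0 j))//=.
by rewrite addrCA lerDl addr_ge0// sumr_ge0// => i _; exact: sqr_ge0.
Qed.

Let integrable_sqr_error j : P.-integrable setT (fun w =>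
  (Y (lift ord0 j) w ^+ 2 * (weight_at j (data Y u2 w) - (tau2 + t2 j)^-1) ^+ 2)%:E).
Proof.
apply: (@integrable_sqr_contrast j (fun v => (weight_at j v - (tau2 + t2 j)^-1) ^+ 2)
  (((tau2 + t2 j)^-1 + (t2 j)^-1) ^+ 2)).
  by apply: measurable_funX; apply: measurable_funB => //; exact: measurable_weight_at.
move=> v; have /andP[w0 w1] := weight_at_bounds j v.
have r0 : 0 < (tau2 + t2 j)^-1 by rewrite invr_gt0.
rewrite ger0_norm ?sqr_ge0// -(real_normK (num_real (_ - _))).
rewrite lerXn2r ?nnegrE//; first by lra.
rewrite ler_norml; apply/andP; split; lra.
Qed.

Lemma variance_estimator_sum :
  ('V_P[fun w => shrinkage_estimator nu s2 t2 wt (data x u2 w)] =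
   'E_P[fun w => (Y ord0 w ^+ 2 * rW^-1 ^+ 2)%R] +
   \sum_j (b j)%:E * 'E_P[fun w => (Y (lift ord0 j) w ^+ 2 *
       (weight_at j (data Y u2 w) - (tau2 + t2 j)^-1) ^+ 2)%R])%E.
Proof.
rewrite (funext estimator_component).
rewrite (variance_even_sum measurable_component (rem_measurable_u2 model)
  independent_components component_sd_gt0 has_law_component
  measurable_error_coef error_coef_bound error_coef_even).
rewrite big_ord_recl; congr (_ + _)%E.
  by congr expectation; apply/funext => w; rewrite /error_coef unlift_none.
apply: eq_bigr => j _; rewrite unlock -(integralZl measurableT (integrable_sqr_error j)).
apply: eq_integral => w _; rewrite /error_coef liftK -EFinM; congr (_%:E).
rewrite (exprMn _ (Num.sqrt (b j))) sqr_sqrtr ?ltW//; ring.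
Qed.

Lemma variance_estimator_fin_num :
  ('V_P[fun w => shrinkage_estimator nu s2 t2 wt (data x u2 w)] \is a fin_num)%E.
Proof.
rewrite variance_estimator_sum fin_numD unlock; apply/andP; split.
  apply: integrable_fin_num => //.
  rewrite (_ : (fun _ => _) = fun w => ((rW^-1 ^+ 2)%:E * (Y ord0 w ^+ 2)%:E)%E).
    apply: integrableZl => //.
    exact: (integrable_coord_sqr measurable_component component_sd_gt0 has_law_component).
  by apply/funext => w; rewrite -EFinM mulrC.
apply/sum_fin_numP => j _ _; rewrite fin_numM//.
exact: (integrable_fin_num measurableT (integrable_sqr_error j)).
Qed.

(** The estimator is unbiased, being mu plus a sum of terms of mean 0. *)
Lemma quadratic_risk_estimator :
  quadratic_risk P mu x u2 (shrinkage_estimator nu s2 t2 wt) =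
  ('V_P[fun w => shrinkage_estimator nu s2 t2 wt (data x u2 w)])%E.
Proof.
rewrite /quadratic_risk /variance (unlock covariance_unlockable).
by rewrite expectation_estimator.
Qed.

Local Notation y w := (contrast nu s2 t2 (fun i => x i w)).
Local Notation u w := [tuple u2 i w | i < m.+1].

Lemma variance_estimator :
  ('V_P[fun w => shrinkage_estimator nu s2 t2 wt (data x u2 w)] =
   'V_P[fun w => mu_opt nu s2 tau2 (fun i => x i w)] +
   \sum_j (b j)%:E * 'E_P[fun w => (tnth (y w) j ^+ 2 *
       (wt j (squares (y w), u w) - (tau2 + t2 j)^-1) ^+ 2)%R])%E.
Proof.
rewrite variance_estimator_sum variance_mu_opt; congr (_ + _)%E.
apply: eq_bigr => j _; congr (_ * expectation _ _)%E; apply/funext => w.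
by rewrite contrast_component weight_at_data.
Qed.

Hypothesis wt_piecewise : forall j u, nonneg u ->
  piecewise_differentiable_in_each (fun y => wt j (squares y, u)).

Let f j w := weighted_contrast wt j (y w) (u w).
Let df j w := partial_derivative j (fun y' => weighted_contrast wt j y' (u w)) (y w).

Let part j (v : S) : R := tnth v.1 (lift ord0 j) * weight_at j v.

Let part_set j (v : S) t : part j (set_data (lift ord0 j) v t) =
  t * wt j (squares (set_coord (contrast_part v) j t), abs_tuple v.2).
Proof. by rewrite /part /weight_at contrast_part_set tnth_set_data. Qed.

Let measurable_part j : measurable_fun setT (part j).
Proof.
apply: measurable_funM; last exact: measurable_weight_at.
exact: (measurableT_comp (measurable_tnth _) measurable_fst).
Qed.

Let part_data j w : part j (data Y u2 w) = f j w.
Proof.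
by rewrite /part weight_at_data /f /weighted_contrast contrast_component tnth_mktuple.
Qed.

Let part_derivative_data j w :
  coord_derivative (lift ord0 j) (part j) (data Y u2 w) = df j w.
Proof.
rewrite /coord_derivative /df /partial_derivative contrast_component tnth_mktuple.
congr (derive1 _ _); apply/funext => t.
by rewrite part_set /weighted_contrast contrast_part_data abs_tuple_data tnth_mktuple eqxx.
Qed.

(** Stein's identity in the component y_j for y_j w_j, whose growth is linear because w_j <= 1 /
    t_j^2. *)
Lemma integral_contrast_weighted j : P.-integrable setT (EFin \o df j) ->
  (\int[P]_w (tnth (y w) j * f j w)%:E =
   (tau2 + t2 j)%:E * \int[P]_w (df j w)%:E)%E.
Proof.
move=> idf.
have := @coordinate_stein _ _ _ P _ Y u2 measurable_component
  (rem_measurable_u2 model) independent_components (lift ord0 j) _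
  (component_sd_gt0 _) (has_law_component _) (part j) (t2 j)^-1 (measurable_part j).
have -> : component_sd (lift ord0 j) ^+ 2 = tau2 + t2 j.
  by rewrite /component_sd liftK sqr_sqrtr// ltW.
have EY w : Y (lift ord0 j) w * part j (data Y u2 w) = tnth (y w) j * f j w.
  by rewrite part_data contrast_component.
have ED w : coord_derivative (lift ord0 j) (part j) (data Y u2 w) = df j w.
  exact: part_derivative_data.
rewrite (funext (fun w => congr1 EFin (EY w))) (funext (fun w => congr1 EFin (ED w))).
apply => //.
- move=> v; have [cg [B [fB dB]]] := wt_piecewise j (u := abs_tuple v.2)
    (ltac:(by move=> i; rewrite tnth_mktuple)) (contrast_part v) j.
  rewrite (funext (part_set j v)); split.
    by move=> t; apply: cvgM; [exact: cvg_id|exact: cg].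
  by exists B; split => // t Bt; apply: derivableM => //; exact: dB.
- move=> v; rewrite /part normrM mulrC ler_wpM2r//.
  by have /andP[w0 w1] := weight_at_bounds j v; rewrite ger0_norm.
- have := @integrable_sqr_contrast j (weight_at j) (t2 j)^-1 (measurable_weight_at j).
  have hb v : `|weight_at j v| <= (t2 j)^-1.
    by have /andP[w0 w1] := weight_at_bounds j v; rewrite ger0_norm.
  move=> /(_ hb); congr (integrable _ _ _); apply/funext => w; congr (_%:E).
  by rewrite -EY /part tnth_mktuple; ring.
Qed.

End weights.

(** With these weights the shrinkage estimator is the sample mean, so the variance, risk and
    finiteness results for delta apply to it as well. *)
Let zero_weight (_ : 'I_m.+1.-1) (_ : m.+1.-1.-tuple R * m.+1.-tuple R) : R := 0.

Let zero_weight_bounds j (a : m.+1.-1.-tuple R) (v : m.+1.-tuple R) :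
  nonneg a -> nonneg v -> 0 <= zero_weight j (a, v) <= (t2 j)^-1.
Proof. by move=> _ _; rewrite lexx invr_ge0 ltW. Qed.

Let sample_mean_estimator w : sample_mean nu (fun i => x i w) =
  shrinkage_estimator nu s2 t2 zero_weight (data x u2 w).
Proof.
rewrite /shrinkage_estimator/= big1 => [|j _]; last by rewrite mulr0 mul0r.
by rewrite subr0; congr (sample_mean _ _); apply/funext => i; rewrite tnth_mktuple.
Qed.

Let sample_mean_estimator_tnth v : sample_mean nu (tnth v.1) =
  shrinkage_estimator nu s2 t2 zero_weight v.
Proof.
by rewrite /shrinkage_estimator/= big1 ?subr0// => j _; rewrite mulr0 mul0r.
Qed.

Let measurable_zero_weight j :
  measurable_fun [set: m.+1.-1.-tuple R * m.+1.-tuple R] (zero_weight j).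
Proof. exact: measurable_cst. Qed.

Lemma variance_sample_mean_fin_num :
  ('V_P[fun w => sample_mean nu (fun i => x i w)] \is a fin_num)%E.
Proof.
rewrite (funext sample_mean_estimator).
exact: (variance_estimator_fin_num measurable_zero_weight zero_weight_bounds).
Qed.

Lemma quadratic_risk_sample_mean :
  quadratic_risk P mu x u2 (fun v => sample_mean nu (tnth v.1)) =
  ('V_P[fun w => sample_mean nu (fun i => x i w)])%E.
Proof.
rewrite (funext sample_mean_estimator) (funext sample_mean_estimator_tnth).
exact: (quadratic_risk_estimator measurable_zero_weight zero_weight_bounds).
Qed.

Section variance_comparison.
Variable wt : 'I_m.+1.-1 -> m.+1.-1.-tuple R * m.+1.-tuple R -> R.
Hypothesis weights : shrinkage_weights t2 wt.

Local Notation y w := (contrast nu s2 t2 (fun i => x i w)).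
Local Notation u w := [tuple u2 i w | i < m.+1].
Let f j w := weighted_contrast wt j (y w) (u w).
Let df j w := partial_derivative j (fun y' => weighted_contrast wt j y' (u w)) (y w).
Hypothesis idf : forall j, P.-integrable setT (EFin \o df j).

Let mwt := sw_measurable weights.
Let wt_bounds := sw_bounds weights.

Let fE j w : f j w = Y (lift ord0 j) w * weight_at wt j (data Y u2 w).
Proof. by rewrite weight_at_data /f /weighted_contrast contrast_component. Qed.

Let weight_norm j v : `|weight_at wt j v| <= (t2 j)^-1.
Proof. by have /andP[w0 w1] := weight_at_bounds wt_bounds j v; rewrite ger0_norm. Qed.

Let integrable_f2 j : P.-integrable setT (fun w => (f j w ^+ 2)%:E).
Proof.
have := @integrable_sqr_contrast j (fun v => weight_at wt j v ^+ 2) ((t2 j)^-1 ^+ 2).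
have mg : measurable_fun setT (fun v => weight_at wt j v ^+ 2).
  by apply: measurable_funX; exact: measurable_weight_at.
have gC v : `|weight_at wt j v ^+ 2| <= (t2 j)^-1 ^+ 2.
  by rewrite normrX lerXn2r ?nnegrE ?invr_ge0 ?weight_norm// ltW.
move=> /(_ mg gC); congr (integrable _ _ _); apply/funext => w; congr (_%:E).
by rewrite fE; ring.
Qed.

Let integrable_yf j : P.-integrable setT (fun w => (tnth (y w) j * f j w)%:E).
Proof.
have := @integrable_sqr_contrast j (weight_at wt j) (t2 j)^-1
  (measurable_weight_at mwt j) (weight_norm j).
congr (integrable _ _ _); apply/funext => w; congr (_%:E).
by rewrite fE contrast_component; ring.
Qed.

Let integrable_y2 j (c : R) : P.-integrable setT (fun w => (tnth (y w) j ^+ 2 * c)%:E).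
Proof.
have := @integrable_sqr_contrast j (cst c) `|c| (measurable_cst _) (fun=> lexx _).
by congr (integrable _ _ _); apply/funext => w; rewrite contrast_component.
Qed.

Let gain j w := f j w ^+ 2 - 2 * df j w.

Let integrable_2df j : P.-integrable setT (fun w => (2 * df j w)%:E).
Proof.
rewrite (_ : (fun _ => _) = fun w => (2%:E * (EFin \o df j) w)%E); last first.
  by apply/funext => w; rewrite /= EFinM.
exact: integrableZl.
Qed.

Let integrable_gain j : P.-integrable setT (EFin \o gain j).
Proof.
rewrite (_ : EFin \o _ = fun w => ((f j w ^+ 2)%:E - (2 * df j w)%:E)%E)//.
exact: integrableB.
Qed.

Lemma integrable_gain_sum : P.-integrable setT
  (EFin \o (fun w => \sum_j b j * (f j w ^+ 2 - 2 * df j w))).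
Proof.
rewrite (_ : EFin \o _ = fun w => (\sum_j (b j)%:E * (EFin \o gain j) w)%E).
  by apply: integrable_sum => // j _; exact: integrableZl.
by apply/funext => w; rewrite /= -sumEFin.
Qed.

Let integrable_scaled_yf j : P.-integrable setT
  (fun w => (2 * (tau2 + t2 j)^-1 * (tnth (y w) j * f j w))%:E).
Proof.
rewrite (_ : (fun _ => _) = fun w =>
  ((2 * (tau2 + t2 j)^-1)%:E * (tnth (y w) j * f j w)%:E)%E)//.
exact: integrableZl.
Qed.

Let integral_gain j : (\int[P]_w (gain j w)%:E =
  \int[P]_w (f j w ^+ 2 - 2 * (tau2 + t2 j)^-1 * (tnth (y w) j * f j w))%:E)%E.
Proof.
transitivity (\int[P]_w (f j w ^+ 2)%:E - \int[P]_w (2 * df j w)%:E)%E.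
  exact: (integralB_EFin measurableT (integrable_f2 j) (integrable_2df j)).
transitivity (\int[P]_w (f j w ^+ 2)%:E -
    \int[P]_w (2 * (tau2 + t2 j)^-1 * (tnth (y w) j * f j w))%:E)%E; last first.
  by symmetry; exact: (integralB_EFin measurableT (integrable_f2 j) (integrable_scaled_yf j)).
congr (_ - _)%E.
transitivity (2%:E * \int[P]_w (df j w)%:E)%E.
  by rewrite -(integralZl measurableT (idf j)).
transitivity ((2 * (tau2 + t2 j)^-1)%:E * \int[P]_w (tnth (y w) j * f j w)%:E)%E; last first.
  by rewrite -(integralZl measurableT (integrable_yf j)).
rewrite (integral_contrast_weighted mwt wt_bounds (sw_piecewise_differentiable weights) (idf j)).
by rewrite muleA -EFinM mulfVK// gt_eqF.
Qed.

(** Subtract the first formula at weight 0 from the one at [wt]. With r = 1 / (tau^2 + t_j^2) the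
    difference of the squares is y_j^2 ((w_j - r)^2 - r^2) = f_j^2 - 2 r y_j f_j, and Stein's
    identity replaces r y_j f_j by the derivative of f_j. *)
Lemma variance_estimator_stein :
  ('V_P[fun w => shrinkage_estimator nu s2 t2 wt (data x u2 w)] =
   'V_P[fun w => sample_mean nu (fun i => x i w)] +
   'E_P[fun w => (\sum_j b j * (f j w ^+ 2 - 2 * df j w))%R])%E.
Proof.
rewrite (funext sample_mean_estimator).
rewrite (@variance_estimator zero_weight (fun=> measurable_cst _) zero_weight_bounds).
rewrite (variance_estimator mwt wt_bounds) -addeA; congr (_ + _)%E.
have -> : ('E_P[fun w => (\sum_j b j * (f j w ^+ 2 - 2 * df j w))%R] =
    \sum_j (b j)%:E * \int[P]_w (gain j w)%:E)%E.
  rewrite unlock; under eq_integral do rewrite -sumEFin.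
  rewrite integral_sum//; last first.
    move=> j; rewrite (_ : (fun _ => _) = fun w => ((b j)%:E * (EFin \o gain j) w)%E)//.
    exact: integrableZl.
  by apply: eq_bigr => j _; exact: (integralZl measurableT (integrable_gain j)).
rewrite -big_split/=; apply: eq_bigr => j _.
rewrite -muleDr; last 2 first.
- by [].
- apply: fin_num_adde_defl; exact: integrable_fin_num (integrable_gain j).
congr (_ * _)%E; rewrite unlock integral_gain -integralD//.
- apply: eq_integral => w _; rewrite -EFinD; congr (_%:E).
  rewrite /f /weighted_contrast /zero_weight; ring.
- exact: (integrable_y2 j ((0 - (tau2 + t2 j)^-1) ^+ 2)).
- rewrite (_ : (fun _ => _) = fun w => ((f j w ^+ 2)%:E -
      (2 * (tau2 + t2 j)^-1 * (tnth (y w) j * f j w))%:E)%E)//.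
  by apply: integrableB => //; exact: integrable_scaled_yf.
Qed.

End variance_comparison.

End model.

(** * Inadmissibility of the sample mean *)

Section quadratic_weights.
Context {R : realType} {p : nat} (beta t2 : 'I_p.-1 -> R).
Hypothesis beta_gt0 : forall j, 0 < beta j.
Hypothesis t2_gt0 : forall j, 0 < t2 j.
Local Notation m := p.-1.

(* James-Stein weights 1 / (beta_j (A + S)) with S = sum_k y_k^2 / beta_k; this
   offset A is large enough for the bound w_j <= 1 / t_j^2. *)
Definition weight_offset : R := \sum_j t2 j / beta j.

(* The absolute values only matter off the cone of nonnegative [a], where they
   keep the denominator of the weights positive. *)
Definition weight_scale (a : m.-tuple R) : R :=
  weight_offset + \sum_k `|tnth a k| / beta k.

Definition quadratic_weight (j : 'I_m) (v : m.-tuple R * p.-tuple R) : R :=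
  (beta j * weight_scale v.1)^-1.

Lemma t2_le_weight_offset j : t2 j <= beta j * weight_offset.
Proof.
rewrite mulrC -ler_pdivrMr// /weight_offset (bigD1 j)//= lerDl sumr_ge0// => i _.
by rewrite divr_ge0// ltW.
Qed.

Lemma weight_offset_gt0 (j : 'I_m) : 0 < weight_offset.
Proof.
rewrite -(pmulr_rgt0 _ (beta_gt0 j)); apply: lt_le_trans (t2_le_weight_offset j).
exact: t2_gt0.
Qed.

Lemma weight_offset_le_scale a : weight_offset <= weight_scale a.
Proof. by rewrite lerDl sumr_ge0// => i _; rewrite divr_ge0// ltW. Qed.

Lemma weight_scale_gt0 (j : 'I_m) a : 0 < weight_scale a.
Proof. exact: lt_le_trans (weight_offset_gt0 j) (weight_offset_le_scale a). Qed.

Let beta_scale_gt0 j a : 0 < beta j * weight_scale a.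
Proof. by rewrite mulr_gt0// (weight_scale_gt0 j). Qed.

Lemma quadratic_weight_bounds j v : 0 <= quadratic_weight j v <= (t2 j)^-1.
Proof.
rewrite invr_ge0 ltW//= lef_pV2 ?posrE//.
apply: le_trans (t2_le_weight_offset j) _.
by rewrite ler_pM2l// weight_offset_le_scale.
Qed.

Lemma measurable_weight_scale : measurable_fun setT weight_scale.
Proof.
apply: measurable_funD => //; apply: measurable_sum => k.
apply: measurable_funM => //; apply: measurableT_comp => //; exact: measurable_tnth.
Qed.

Lemma measurable_quadratic_weight j : measurable_fun setT (quadratic_weight j).
Proof.
(* Positivity of the denominator turns the inverse into the power -1, a measurable function. *)
rewrite (_ : quadratic_weight j = fun v => (beta j * weight_scale v.1) `^ (-1)).
  apply: (measurableT_comp (measurable_powR _)); apply: measurable_funM => //.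
  exact: (measurableT_comp measurable_weight_scale measurable_fst).
by apply/funext => v; rewrite powR_inv1// ltW.
Qed.

(** The part of the scale A + S that stays constant when only coordinate [k] varies. *)
Definition coord_remainder (y : m.-tuple R) (k : 'I_m) : R :=
  weight_offset + \sum_(i | i != k) tnth y i ^+ 2 / beta i.

Lemma weight_scale_set_coord y k t :
  weight_scale (squares (set_coord y k t)) = coord_remainder y k + t ^+ 2 / beta k.
Proof.
rewrite /weight_scale /coord_remainder -addrA; congr (_ + _).
rewrite (bigD1 k)//= !tnth_mktuple eqxx ger0_norm ?sqr_ge0// addrC; congr (_ + _).
by apply: eq_bigr => i /negbTE ik; rewrite !tnth_mktuple ik ger0_norm ?sqr_ge0.
Qed.

Lemma weight_scale_squares y k :
  weight_scale (squares y) = coord_remainder y k + tnth y k ^+ 2 / beta k.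
Proof.
rewrite -weight_scale_set_coord; congr (weight_scale (squares _)).
by apply: eq_from_tnth => i; rewrite tnth_mktuple; case: eqP => [->|].
Qed.

Lemma coord_remainder_gt0 y k : 0 < coord_remainder y k.
Proof.
apply: lt_le_trans (weight_offset_gt0 k) _.
by rewrite lerDl sumr_ge0// => i _; rewrite divr_ge0 ?sqr_ge0// ltW.
Qed.

Let is_derive_denominator (c r : R) (k : 'I_m) (t : R) :
  is_derive t 1 (fun s : R => r * (c + s ^+ 2 / beta k)) (r * (2 * t / beta k)).
Proof.
have -> : (fun s : R => r * (c + s ^+ 2 / beta k)) =
    (fun s => r * c + (r / beta k) * (s * s)).
  by apply/funext => s; ring.
apply: is_derive_eq => /=.
by rewrite /GRing.scale/=; ring.
Qed.

Let is_derive_weight y j k t : let c := beta j * (coord_remainder y k + t ^+ 2 / beta k) in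
  is_derive t 1 (fun s => (beta j * (coord_remainder y k + s ^+ 2 / beta k))^-1)
    (- c ^- 2 * (beta j * (2 * t / beta k))).
Proof.
have D := is_derive_denominator (coord_remainder y k) (beta j) k t.
apply: is_deriveV; rewrite mulf_neq0 ?gt_eqF//.
by rewrite ltr_pwDl ?coord_remainder_gt0// divr_ge0 ?sqr_ge0// ltW.
Qed.

Lemma quadratic_shrinkage_weights : shrinkage_weights t2 quadratic_weight.
Proof.
split => [|j a u _ _|j u _ y k].
- exact: measurable_quadratic_weight.
- exact: quadratic_weight_bounds.
have -> : (fun t => quadratic_weight j (squares (set_coord y k t), u)) =
    fun t => (beta j * (coord_remainder y k + t ^+ 2 / beta k))^-1.
  by apply/funext => t; rewrite /quadratic_weight weight_scale_set_coord.
have der (t : R) : derivable (fun t : R => (beta j * (coord_remainder y k + t ^+ 2 / beta k))^-1) t 1.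
  by have := is_derive_weight y j k t => -[].
split; first by move=> t; apply/differentiable_continuous/derivable1_diffP.
by exists set0; split => // a b; rewrite set0I.
Qed.

Lemma quadratic_weight_derivative j y u (W := quadratic_weight j (squares y, u)) :
  partial_derivative j (fun y' => weighted_contrast quadratic_weight j y' u) y =
  W - 2 * (tnth y j * W) ^+ 2.
Proof.
rewrite /partial_derivative derive1E.
have -> : (fun t => weighted_contrast quadratic_weight j (set_coord y j t) u) =
    fun t => t * (beta j * (coord_remainder y j + t ^+ 2 / beta j))^-1.
  apply/funext => t; rewrite /weighted_contrast /quadratic_weight.
  by rewrite weight_scale_set_coord tnth_mktuple eqxx.
have dW := is_derive_weight y j j (tnth y j).
rewrite derive_val /= /W /quadratic_weight/= (weight_scale_squares y j) /GRing.scale/=.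
have D0 : coord_remainder y j + tnth y j ^+ 2 / beta j != 0.
  by rewrite -weight_scale_squares gt_eqF// (weight_scale_gt0 j).
have B0 : beta j != 0 by rewrite gt_eqF.
move: D0; set c := coord_remainder y j; set a := _ + _ => a0.
by field; rewrite a0 B0.
Qed.

Lemma quadratic_weight_gain_lt0 y u : (3 <= m)%N ->
  \sum_j beta j * (weighted_contrast quadratic_weight j y u ^+ 2 -
    2 * partial_derivative j (fun y' => weighted_contrast quadratic_weight j y' u) y) < 0.
Proof.
move=> m3; have [j0] : exists j0 : 'I_m, true by exists (Ordinal (ltn_trans (ltn0Sn 1) m3)).
move=> _.
pose D := weight_scale (squares y); have D0 : 0 < D by exact: weight_scale_gt0 j0 _.
have SD : \sum_k tnth y k ^+ 2 / beta k < D.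
  rewrite -subr_gt0 /D /weight_scale -addrA -sumrB big1 ?addr0.
    exact: weight_offset_gt0.
  move=> k _; apply/eqP; rewrite subr_eq0; apply/eqP.
  by rewrite tnth_mktuple ger0_norm ?sqr_ge0.
(* The 5 is 1 + 4: f_j^2 contributes 1, and -2 times the derivative W - 2 f_j^2 contributes 4. The
   comparison is then 5 S < 5 D <= 2 m D, strict because the offset is positive, and valid from m =
   3 on since 2 m >= 6. *)
rewrite (eq_bigr (fun j => 5 * D ^- 2 * (tnth y j ^+ 2 / beta j) - 2 / D)); last first.
  move=> j _; rewrite quadratic_weight_derivative /weighted_contrast /quadratic_weight -/D.
  by field; rewrite !gt_eqF.
rewrite big_split/= -mulr_sumr sumr_const card_ord.
move: SD; set S := \sum_k _ => SD.
have -> : 5 / D ^+ 2 * S + (- (2 / D)) *+ m = (5 * S - 2 * m%:R * D) / D ^+ 2.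
  by rewrite -mulr_natr; field; rewrite gt_eqF.
rewrite pmulr_llt0 ?invr_gt0 ?exprn_gt0// subr_lt0.
have m3' : 3 <= m%:R :> R by rewrite ler_nat.
apply: (@lt_le_trans _ _ (5 * D)); first by rewrite ltr_pM2l.
by rewrite ler_pM2r//; lra.
Qed.

(** As y_j^2 W <= 1, the derivative W - 2 (y_j W)^2 lies between -W and W. This bound yields the
    integrability of the derivative that the second variance formula demands. *)
Lemma quadratic_weight_derivative_bound j y u :
  `|partial_derivative j (fun y' => weighted_contrast quadratic_weight j y' u) y|
  <= (t2 j)^-1.
Proof.
rewrite quadratic_weight_derivative.
have /andP[_] := quadratic_weight_bounds j (squares y, u).
rewrite /quadratic_weight/=; set D := beta j * _ => Dt.
have D0 : 0 < D by exact: beta_scale_gt0.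
have yD : tnth y j ^+ 2 <= D.
  rewrite /D (weight_scale_squares y j) mulrDr mulrCA divff ?gt_eqF// mulr1.
  by rewrite lerDr mulr_ge0// ltW// coord_remainder_gt0.
have : (tnth y j / D) ^+ 2 <= D^-1.
  by rewrite exprMn exprVn ler_pdivrMr ?exprn_gt0// expr2 mulrA mulVf ?gt_eqF// mul1r.
have := sqr_ge0 (tnth y j / D); set q := _ ^+ 2 => q0 q1.
rewrite ler_norml; apply/andP; split; lra.
Qed.

End quadratic_weights.

(** A zero integral would force the function, which has constant sign, to vanish almost everywhere,
    so the whole space would be a null set. *)
Lemma integral_lt0 d (T : measurableType d) (R : realType) (P : probability T R)
    (g : T -> R) : P.-integrable setT (EFin \o g) -> (forall w, g w < 0) ->
  (\int[P]_w (g w)%:E < 0)%E.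
Proof.
move=> ig g0.
have mg : measurable_fun setT (EFin \o g) by have /integrableP[] := ig.
have -> : (\int[P]_w (g w)%:E = - \int[P]_w `|(EFin \o g) w|)%E.
  by rewrite -integral_ge0N//; apply: eq_integral => w _ /=; rewrite ltr0_norm// opprK.
rewrite oppe_lt0 lt0e integral_ge0// andbT; apply/eqP => /(ae_eq_integral_abs P measurableT mg).
move=> [N [mN N0 subN]].
have : (P setT <= P N)%E.
  apply: le_measure; rewrite ?inE// => w _; apply: subN => /= /(_ I) [gw].
  by have := g0 w; rewrite gw ltxx.
by rewrite probability_setT N0 lee_fin ler10.
Qed.

Section estimator_measurability.
Context {R : realType} {p : nat} (nu : 'I_p -> nat) (s2 : 'I_p -> R).
Variable t2 : 'I_p.-1 -> R.

Lemma measurable_contrast :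
  measurable_fun setT (fun v : p.-tuple R => contrast nu s2 t2 (tnth v)).
Proof.
apply/measurable_fun_tnthP => j.
rewrite [Z in measurable_fun _ Z](_ : _ = fun v : p.-tuple R =>
    (Num.sqrt (coefb nu s2 t2 j))^-1 * \sum_i coefA nu s2 t2 i j * tnth v i).
  apply: measurable_funM => //; apply: measurable_sum => i.
  by apply: measurable_funM => //; exact: measurable_tnth.
by apply/funext => v /=; rewrite tnth_mktuple.
Qed.

Lemma measurable_sample_mean :
  measurable_fun setT (fun v : p.-tuple R => sample_mean nu (tnth v)).
Proof.
apply: measurable_funM => //; apply: measurable_sum => i.
by apply: measurable_funM => //; exact: measurable_tnth.
Qed.

Lemma measurable_shrinkage_estimator
    (w : 'I_p.-1 -> p.-1.-tuple R * p.-tuple R -> R) :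
  (forall j, measurable_fun setT (w j)) ->
  measurable_fun setT (shrinkage_estimator nu s2 t2 w).
Proof.
move=> mw.
have m1 : measurable_fun setT (fun z : p.-tuple R * p.-tuple R => contrast nu s2 t2 (tnth z.1)).
  exact: (measurableT_comp measurable_contrast measurable_fst).
apply: measurable_funB.
  exact: (measurableT_comp measurable_sample_mean measurable_fst).
apply: measurable_sum => j; apply: measurable_funM.
  apply: measurable_funM => //; apply: (measurableT_comp (mw j)).
  apply: measurable_fun_pair; last exact: measurable_snd.
  exact: (measurableT_comp (@measurable_squares _ _) m1).
exact: (measurableT_comp (measurable_tnth j) m1).
Qed.

End estimator_measurability.

(** The weights are built from b_j and t_j^2, which depend only on [nu] and [s2]; hence a single
    estimator serves all parameters, and its risk is strictly smaller at each of them. *)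
Lemma sample_mean_inadmissible (R : realType) (m : nat) (nu : 'I_m.+1 -> nat)
    (s2 : 'I_m.+1 -> R) d (T : measurableType d) (P : R -> R -> probability T R)
    (x u2 : 'I_m.+1 -> T -> R) :
  (forall i, (1 <= nu i)%N) -> (forall i, 0 < s2 i) -> injective s2 -> (3 <= m)%N ->
  (forall mu tau2, 0 <= tau2 -> random_effects_model nu s2 (P mu tau2) mu tau2 x u2) ->
  inadmissible P x u2 (fun z => sample_mean nu (tnth z.1)).
Proof.
move=> nu_ge1 s2_gt0 s2_inj m3 model.
have [t2 t2_roots] := negated_roots_exist nu_ge1 s2_inj.
have t2_gt0 j : 0 < t2 j.
  exact: (root_gt0 (ltn0Sn m) nu_ge1 s2_gt0 (negated_root t2_roots j)).
have b_gt0 j : 0 < coefb nu s2 t2 j by exact: coefb_gt0.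
pose wt := quadratic_weight (p := m.+1) (coefb nu s2 t2) t2.
have weights : shrinkage_weights t2 wt by exact: quadratic_shrinkage_weights.
have mwt := sw_measurable weights; have wt_bounds := sw_bounds weights.
have risk_lt mu tau2 : 0 <= tau2 ->
    (quadratic_risk (P mu tau2) mu x u2 (shrinkage_estimator nu s2 t2 wt) <
     quadratic_risk (P mu tau2) mu x u2 (fun z => sample_mean nu (tnth z.1)))%E.
  move=> tau2_ge0; have M := model mu tau2 tau2_ge0.
  rewrite (quadratic_risk_estimator nu_ge1 s2_gt0 s2_inj t2_roots tau2_ge0 M mwt wt_bounds).
  rewrite (quadratic_risk_sample_mean nu_ge1 s2_gt0 s2_inj t2_roots tau2_ge0 M).
  pose y w := contrast nu s2 t2 (fun i => x i w); pose u w := [tuple u2 i w | i < m.+1].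
  pose df j w := partial_derivative j (fun y' => weighted_contrast wt j y' (u w)) (y w).
  have my : measurable_fun setT y.
    rewrite (_ : y = fun w => contrast nu s2 t2 (tnth (data x u2 w).1)).
      apply: (measurableT_comp (measurable_contrast nu s2 t2)).
      apply: (measurableT_comp measurable_fst); apply: measurable_data.
        exact: (rem_measurable_x M).
      exact: (rem_measurable_u2 M).
    by apply/funext => w; congr contrast; apply/funext => i; rewrite tnth_mktuple.
  have mu2 : measurable_fun setT u.
    apply/measurable_fun_tnthP => i; rewrite [Z in measurable_fun _ Z](_ : _ = u2 i).
      exact: (rem_measurable_u2 M).
    by apply/funext => w /=; rewrite tnth_mktuple.
  have mwtyu j : measurable_fun setT (fun w => wt j (squares (y w), u w)).
    apply: (measurableT_comp (mwt j)); apply: measurable_fun_pair => //.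
    exact: (measurableT_comp (@measurable_squares _ _) my).
  have mdf j : measurable_fun setT (df j).
    rewrite (_ : df j = fun w => wt j (squares (y w), u w) -
        2 * (tnth (y w) j * wt j (squares (y w), u w)) ^+ 2).
      apply: measurable_funB => //; apply: measurable_funM => //; apply: measurable_funX.
      by apply: measurable_funM => //; exact: (measurableT_comp (measurable_tnth j) my).
    by apply/funext => w; exact: quadratic_weight_derivative.
  have idf j : (P mu tau2).-integrable setT (EFin \o df j).
    apply: (le_integrable measurableT _ _
      (finite_measure_integrable_cst (P mu tau2) (t2 j)^-1 measurableT)).
      exact/measurable_EFinP.
    move=> w _ /=; rewrite lee_fin; apply: le_trans (ler_norm _).
    exact: (quadratic_weight_derivative_bound (p := m.+1) b_gt0 t2_gt0 j (y w) (u w)).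
  rewrite (variance_estimator_stein nu_ge1 s2_gt0 s2_inj t2_roots tau2_ge0 M weights idf).
  rewrite gteDl; last exact: (variance_sample_mean_fin_num nu_ge1 s2_gt0 s2_inj t2_roots tau2_ge0 M).
  rewrite unlock; apply: integral_lt0; last by move=> w; exact: quadratic_weight_gain_lt0.
  exact: (integrable_gain_sum nu_ge1 s2_gt0 s2_inj t2_roots tau2_ge0 M weights idf).
exists (shrinkage_estimator nu s2 t2 wt); split.
- exact: measurable_shrinkage_estimator.
- by move=> mu tau2 /risk_lt/ltW.
(* The risk inequality is strict everywhere, so any parameter with tau^2 >= 0 can be the witness. *)
- by exists 0, 0; split => //; exact: risk_lt.
Qed.

Theorem proposition2p1 (R : realType) (p : nat) (nu : 'I_p -> nat)
    (s2 : 'I_p -> R) (hp : (2 <= p)%N) (hnu : forall i, (1 <= nu i)%N)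
    (hs2_gt0 : forall i, 0 < s2 i) (hs2_inj : injective s2) :
  (forall (t2 : 'I_p.-1 -> R)
      (w : 'I_p.-1 -> p.-1.-tuple R * p.-tuple R -> R)
      (d : measure_display) (T : measurableType d) (P : probability T R)
      (mu tau2 : R) (x u2 : 'I_p -> T -> R),
    negated_roots_of_Q nu s2 t2 ->
    shrinkage_weights t2 w ->
    0 <= tau2 ->
    random_effects_model nu s2 P mu tau2 x u2 ->
    let b := coefb nu s2 t2 in
    let y := fun omega => contrast nu s2 t2 (fun i => x i omega) in
    let u := fun omega => [tuple u2 i omega | i < p] in
    let delta := fun omega => shrinkage_estimator nu s2 t2 w (data x u2 omega) in
    let xbar := fun omega => sample_mean nu (fun i => x i omega) in
    let f := fun j omega => weighted_contrast w j (y omega) (u omega) in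
    let df := fun j omega =>
      partial_derivative j (fun y' => weighted_contrast w j y' (u omega))
        (y omega) in
    ('V_P[delta] =
       'V_P[fun omega => mu_opt nu s2 tau2 (fun i => x i omega)] +
       \sum_j (b j)%:E *
         'E_P[fun omega => (tnth (y omega) j ^+ 2 *
                (w j (squares (y omega), u omega) - (tau2 + t2 j)^-1) ^+ 2)%R])%E /\
    ((forall j, P.-integrable [set: T] (EFin \o df j)) ->
     ('V_P[delta] =
       'V_P[xbar] +
       'E_P[fun omega => (\sum_j b j * (f j omega ^+ 2 - 2 * df j omega))%R])%E))
  /\
  ((3 < p)%N ->
   forall (d : measure_display) (T : measurableType d)
      (P : R -> R -> probability T R) (x u2 : 'I_p -> T -> R),
    (forall mu tau2, 0 <= tau2 ->
       random_effects_model nu s2 (P mu tau2) mu tau2 x u2) ->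
    inadmissible P x u2 (fun z => sample_mean nu (tnth z.1))).
Proof.
case: p nu s2 hp hnu hs2_gt0 hs2_inj => [//|m] nu s2 hm nu_ge1 s2_gt0 s2_inj.
split=> [t2 w d T P mu tau2 x u2 t2_roots weights tau2_ge0 model b y u delta xbar f df|m3].
  split=> [|idf].
    exact: (variance_estimator nu_ge1 s2_gt0 s2_inj t2_roots tau2_ge0 model
      (sw_measurable weights) (sw_bounds weights)).
  exact: (variance_estimator_stein nu_ge1 s2_gt0 s2_inj t2_roots tau2_ge0 model weights idf).
by move=> d T P x u2 model; exact: sample_mean_inadmissible.
Qed.
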